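(* Let $\lambda(n):=\pi\sqrt{24n-1}/6$. For each pair of positive integers $\alpha,k$ there is an effectively computable positive integer $B_k(\alpha)$ such that for all integers $n\geq B_k(\alpha)$, $$\frac{\sqrt{3}}{\pi\sqrt{24n-1}}\left(1-\frac{1}{\alpha n^k}\right)e^{\lambda(n)}<\mathrm{spt}(n)<\frac{\sqrt{3}}{\pi\sqrt{24n-1}}\left(1+\frac{1}{\alpha n^k}\right)e^{\lambda(n)}.$$
   Context: $\mathrm{spt}(n)$ is the total number of smallest parts among all partitions of $n$, counted with multiplicity; equivalently $\sum_{n\ge1}\mathrm{spt}(n)q^n=\sum_{n\ge1}\frac{q^n}{(1-q^n)^2(q^{n+1};q)_\infty}$. *)

(* Defs.v *)
From Stdlib Require Import Reals.
From mathcomp Require Import all_boot.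

Set Implicit Arguments.
Unset Strict Implicit.
Unset Printing Implicit Defensive.

(* A partition is its list of positive parts in weakly decreasing order. *)
Definition is_partition (n : nat) (s : seq nat) : bool :=
  [&& sorted geq s, 0 \notin s & sumn s == n].

(* A partition of n has at most n parts, each at most n, so the bounded
   sequences over 'I_n.+1 contain every partition of n exactly once.  The parts
   decrease, so the smallest one is the last. *)
Definition spt (n : nat) : nat :=
  \sum_(s : n.-bseq 'I_n.+1 | is_partition n (map val s))
     count_mem (last 0 (map val s)) (map val s).

Local Open Scope R_scope.

Definition lambda (n : nat) : R := PI * sqrt (24 * INR n - 1) / 6.

Local Close Scope R_scope.

(* Codes for the n-ary partial recursive functions. *)
Inductive murec : nat -> Type :=
| MZero n : murec n
| MSucc : murec 1
| MProj n (i : 'I_n) : murec n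
| MComp m n (f : murec m) (g : 'I_m -> murec n) : murec n
| MPrim n (f : murec n) (g : murec n.+2) : murec n.+1
| MMin n (f : murec n.+1) : murec n.

(* [eval c v y]: the computation of c on v halts with value y.
   - MPrim recurses on its first argument, h being the list of successive
     values: h 0 = f(v) and h (i+1) = g(i, h i, v).
   - MMin f is the least y with f(y, v) = 0, all smaller values of the first
     argument being required to give a defined nonzero result. *)
Fixpoint eval (n : nat) (c : murec n) : n.-tuple nat -> nat -> Prop :=
  match c in murec n return n.-tuple nat -> nat -> Prop with
  | MZero _ => fun _ y => y = 0
  | MSucc => fun v y => y = (thead v).+1
  | MProj _ i => fun v y => y = tnth v i
  | MComp m _ f g => fun v y =>
      exists2 w : m.-tuple nat,
        (forall i, eval (g i) v (tnth w i)) & eval f w y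
  | MPrim _ f g => fun v y =>
      exists h : nat -> nat,
        [/\ eval f [tuple of behead v] (h 0),
            forall i, i < thead v ->
              eval g [tuple of i :: h i :: behead v] (h i.+1)
          & y = h (thead v)]
  | MMin _ f => fun v y =>
      eval f [tuple of y :: v] 0 /\
      forall i, i < y -> exists z, eval f [tuple of i :: v] z.+1
  end.

Definition computable2 (F : nat -> nat -> nat) : Prop :=
  exists c : murec 2, forall a b, eval c [tuple a; b] (F a b).

(* Main.v *)
(* Let q = e^(-tau). Removing copies of the smallest part gives
   sum spt(n) q^n = A(q) / (q;q)_oo with A(q) = sum_{n>=1} (q)_{n-1} q^n / (1 - q^n).

   A(q) is the Newton interpolation series, at the nodes 1, 1/q, 1/q^2, ..., of the derivative
   of log at 1, divided by tau. The remainder after N terms is an explicit integral of size at most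
   prod_{j<=N} |1 - q^j|, which is exponentially small when N is about 1/|tau|. Hence
   A(q) = 1/tau up to a relative error O(e^(-0.4/|tau|)).

   By the pentagonal number theorem and Poisson summation,
   (q;q)_oo = sqrt(2 pi / tau) e^(tau/24 - pi^2/(6 tau)) up to an exponentially small relative error,
   so the generating function is close to (2 pi tau)^(-1/2) e^(pi^2/(6 tau) - tau/24).

   The coefficient is the integral of e^(n tau) times the generating function along any path from
   tau_0 to tau_0 + 2 pi i. With x = n - 1/24 and t = pi / sqrt(6x), take the arc |tau| = t,
   |arg tau| <= phi1, continued by vertical segments. On the arc the main term is a real Gaussian
   integral, whose complete value is sqrt 3 / (pi sqrt(24n-1)) e^(lambda n); on the segments the
   generating function is exponentially smaller than at the real point of the arc. The relative
   error is therefore O(e^(-c sqrt n)), and a polynomial in alpha and k suffices for B. *)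

(* Every power of 1/n has to be beaten at once, so a stationary-phase expansion is not enough: each
   step may lose only an exponentially small relative error. Hence the arc |tau| = t, on which the
   exponent of the main term is real and an exact substitution gives a Gaussian integral. The angle
   [phi1] = atan(5/12), with cosine 12/13 and sine 5/13, is a compromise. Interpolation works only
   while the nodes stay in the right half-plane, that is N |Im tau| < pi/2 with N near 1/|tau|; a
   narrow sector ensures this. But on the segments Re tau = 12t/13, and the bound by the real point
   exceeds the saddle value by e^(xt/156). The gain e^(-1/(48t)) from leaving the real axis must pay
   for it; with pi <= 4 as the only numerical input, e^(-1/(300t)) is left. Contour integration is
   applied only to truncated power series, whose monomials have elementary primitives. A majorant
   series at Re tau = 12t/13 bounds the truncation error uniformly along the contour. *)
Require Import Defs.
From Stdlib Require Import Reals Lra Lia Factorial.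
From Coquelicot Require Import Coquelicot.
Open Scope R_scope.

(** * Complex exponential and integrals of complex functions of a real variable *)

Definition Cexp (z : C) : C := (exp (fst z) * cos (snd z), exp (fst z) * sin (snd z)).

Lemma Cexp_plus (z w : C) : Cexp (z + w) = (Cexp z * Cexp w)%C.
Proof.
destruct z as [a b], w as [c d]; unfold Cexp, Cplus, Cmult; simpl.
rewrite exp_plus, cos_plus, sin_plus; f_equal; ring.
Qed.

Lemma Cexp_0 : Cexp 0 = 1.
Proof. unfold Cexp; simpl; rewrite exp_0, cos_0, sin_0; unfold RtoC; f_equal; ring. Qed.

Lemma Cexp_RtoC (x : R) : Cexp x = exp x.
Proof. unfold Cexp; simpl; rewrite cos_0, sin_0; unfold RtoC; f_equal; ring. Qed.

Lemma Cmod_Cexp (z : C) : Cmod (Cexp z) = exp (fst z).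
Proof.
unfold Cmod, Cexp; simpl.
replace (_ + _) with (exp (fst z) ^ 2).
- rewrite sqrt_pow2; [reflexivity|]; left; apply exp_pos.
- pose proof (sin2_cos2 (snd z)) as H; unfold Rsqr in H; nra.
Qed.

Lemma Cexp_neq_0 (z : C) : Cexp z <> 0.
Proof.
intro H; apply (f_equal Cmod) in H; rewrite Cmod_Cexp, Cmod_0 in H.
pose proof (exp_pos (fst z)); lra.
Qed.

Lemma Cexp_pow (z : C) (n : nat) : (Cexp z ^ n)%C = Cexp (INR n * z).
Proof.
induction n as [|n IH].
- simpl; rewrite Cmult_0_l, Cexp_0; reflexivity.
- rewrite Cpow_S, IH, <- Cexp_plus, S_INR; f_equal; rewrite RtoC_plus; ring.
Qed.

Lemma Cexp_opp (z : C) : Cexp (- z) = (/ Cexp z)%C.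
Proof.
assert (H : (Cexp (- z) * Cexp z)%C = 1).
{ rewrite <- Cexp_plus, <- Cexp_0; f_equal; ring. }
rewrite <- (Cmult_1_l (/ Cexp z)), <- H; field; apply Cexp_neq_0.
Qed.

Lemma Cmod_le_abs (z : C) : Cmod z <= Rabs (fst z) + Rabs (snd z).
Proof.
destruct z as [a b]; simpl.
replace (a, b) with (Cplus (RtoC a) (Cmult Ci (RtoC b))).
- eapply Rle_trans; [apply Cmod_triangle|].
  rewrite Cmod_mult, !Cmod_R.
  assert (Cmod Ci = 1) as ->.
  { unfold Cmod, Ci; simpl; replace (_ + _) with 1 by ring; apply sqrt_1. }
  lra.
- unfold Cplus, Cmult, Ci, RtoC; simpl; f_equal; ring.
Qed.

Lemma abs_fst_le (z : C) : Rabs (fst z) <= Cmod z.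
Proof. eapply Rle_trans; [apply Rmax_l|apply (Rmax_Cmod z)]. Qed.

Lemma abs_snd_le (z : C) : Rabs (snd z) <= Cmod z.
Proof. eapply Rle_trans; [apply Rmax_r|apply (Rmax_Cmod z)]. Qed.

Lemma fst_le_Cmod (z : C) : fst z <= Cmod z.
Proof. eapply Rle_trans; [apply Rle_abs|apply abs_fst_le]. Qed.

Lemma Cmod_sqr (z : C) : Cmod z ^ 2 = fst z ^ 2 + snd z ^ 2.
Proof. unfold Cmod; rewrite pow2_sqrt; [reflexivity|nra]. Qed.

Lemma Cmod_le_sqr (z : C) (r : R) : 0 <= r -> fst z ^ 2 + snd z ^ 2 <= r ^ 2 -> Cmod z <= r.
Proof. intros Hr H; apply Rsqr_incr_0_var; [rewrite !Rsqr_pow2, Cmod_sqr; exact H|exact Hr]. Qed.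

Lemma Cneq0_fst (z : C) : 0 < fst z -> z <> 0.
Proof. intros H E; rewrite E in H; simpl in H; lra. Qed.

Lemma one_minus_cos_le (y : R) : 2 * (1 - cos y) <= y ^ 2.
Proof.
assert (Hs : sin (y / 2) ^ 2 <= (y / 2) ^ 2).
{ rewrite <- !Rsqr_pow2; apply Rsqr_le_abs_1.
  destruct (Rle_dec 0 (y / 2)) as [H|H].
  - rewrite (Rabs_right (y / 2)) by lra; apply Rabs_le; split.
    + destruct (Req_dec (y/2) 0) as [E|E]; [rewrite E, sin_0; lra|].
      destruct (Rle_dec (y / 2) 1).
      * pose proof (sin_gt_0 (y / 2)); pose proof PI2_1; lra.
      * pose proof (SIN_bound (y / 2)); lra.
    + destruct (Req_dec (y/2) 0) as [E|E]; [rewrite E, sin_0; lra|].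
      left; apply sin_lt_x; lra.
  - rewrite (Rabs_left (y / 2)) by lra; rewrite <- Rabs_Ropp, <- sin_neg; apply Rabs_le; split.
    + destruct (Rle_dec (- (y / 2)) 1).
      * pose proof (sin_gt_0 (- (y / 2))); pose proof PI2_1; lra.
      * pose proof (SIN_bound (- (y / 2))); lra.
    + left; apply sin_lt_x; lra. }
replace y with (2 * (y / 2)) at 1 by field; rewrite cos_2a_sin; nra.
Qed.

Lemma exp_ineq (x : R) : 1 + x <= exp x.
Proof. destruct (Req_dec x 0) as [->|H]; [rewrite exp_0; lra|left; apply exp_ineq1; exact H]. Qed.

Lemma exp_neg_le_inv (x : R) : 0 <= x -> exp (- x) <= / (1 + x).
Proof.
intro H; rewrite exp_Ropp; apply Rinv_le_contravar; [lra|apply exp_ineq].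
Qed.

Lemma exp_le (x y : R) : x <= y -> exp x <= exp y.
Proof. intros [H| ->]; [left; apply exp_increasing; exact H|right; reflexivity]. Qed.

(** For z = x + iy the squared modulus is (1 - e^(-x))^2 + 2 e^(-x) (1 - cos y), and the two terms
    are at most x^2 and y^2. Applied to j z, this bounds each factor of (q;q)_N by j |z|. *)
Lemma Cmod_one_minus_exp (z : C) : 0 <= fst z -> Cmod (1 - Cexp (- z)) <= Cmod z.
Proof.
intro Hx; apply Cmod_le_sqr; [apply Cmod_ge_0|]; rewrite Cmod_sqr.
destruct z as [x y]; unfold Cexp; simpl in *.
rewrite cos_neg, sin_neg.
pose proof (exp_ineq (- x)) as H1.
assert (H2 : exp (- x) <= 1) by (rewrite <- exp_0; apply exp_le; lra).
pose proof (exp_pos (- x)) as H3.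
pose proof (one_minus_cos_le y) as H4.
pose proof (COS_bound y).
pose proof (sin2_cos2 y) as H5; unfold Rsqr in H5.
assert (E : exp (- x) * (2 * (1 - cos y)) <= y ^ 2) by nra.
assert ((1 - exp (-x))^2 <= x^2) by nra.
replace (_ + _) with ((1 - exp (- x)) ^ 2 + exp (- x) * (2 * (1 - cos y))
  + exp (-x) ^ 2 * (sin y * sin y + cos y * cos y - 1)) by ring.
rewrite H5; nra.
Qed.

Ltac eq_in_C := match goal with |- @eq _ ?a ?b => change (@eq C a b) end.

(** Complex integrals are pairs of real ones, so that only real primitives are ever needed; the
    price is the factor 2 in [is_CInt_bound]. *)
Definition is_CInt (f : R -> C) (a b : R) (I : C) : Prop :=
  is_RInt (fun x => fst (f x)) a b (fst I) /\ is_RInt (fun x => snd (f x)) a b (snd I).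

Lemma is_CInt_ext (f g : R -> C) (a b : R) (I : C) :
  a <= b -> (forall x, a < x < b -> f x = g x) -> is_CInt f a b I -> is_CInt g a b I.
Proof.
intros Hab H [H1 H2]; split.
- apply is_RInt_ext with (fun x => fst (f x)); [|exact H1]; intros x Hx.
  rewrite Rmin_left, Rmax_right in Hx by exact Hab; rewrite H; [reflexivity|exact Hx].
- apply is_RInt_ext with (fun x => snd (f x)); [|exact H2]; intros x Hx.
  rewrite Rmin_left, Rmax_right in Hx by exact Hab; rewrite H; [reflexivity|exact Hx].
Qed.

Lemma is_CInt_plus (f g : R -> C) (a b : R) (I J : C) :
  is_CInt f a b I -> is_CInt g a b J -> is_CInt (fun x => f x + g x)%C a b (I + J)%C.
Proof.
intros [H1 H2] [H3 H4]; split.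
- apply (is_RInt_plus (fun x => fst (f x)) (fun x => fst (g x))); assumption.
- apply (is_RInt_plus (fun x => snd (f x)) (fun x => snd (g x))); assumption.
Qed.

Lemma is_CInt_scal (c : C) (f : R -> C) (a b : R) (I : C) :
  is_CInt f a b I -> is_CInt (fun x => c * f x)%C a b (c * I)%C.
Proof.
intros [H1 H2]; split; simpl.
- apply (is_RInt_minus (fun x => fst c * fst (f x)) (fun x => snd c * snd (f x)));
    apply (is_RInt_scal (V := R_NormedModule)); assumption.
- apply (is_RInt_plus (fun x => fst c * snd (f x)) (fun x => snd c * fst (f x)));
    apply (is_RInt_scal (V := R_NormedModule)); assumption.
Qed.

Lemma is_RInt_abs_le (f : R -> R) (a b M I : R) :
  a <= b -> is_RInt f a b I -> (forall x, a <= x <= b -> Rabs (f x) <= M) ->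
  Rabs I <= (b - a) * M.
Proof.
intros Hab H HM; rewrite <- (is_RInt_unique _ _ _ _ H).
apply abs_RInt_le_const; [exact Hab|exists I; exact H|exact HM].
Qed.

Lemma is_CInt_bound (f : R -> C) (a b M : R) (I : C) :
  a <= b -> is_CInt f a b I -> (forall x, a <= x <= b -> Cmod (f x) <= M) ->
  Cmod I <= 2 * ((b - a) * M).
Proof.
intros Hab [H1 H2] HM; eapply Rle_trans; [apply Cmod_le_abs|].
assert (Rabs (fst I) <= (b - a) * M).
{ eapply is_RInt_abs_le; [exact Hab|exact H1|]; intros x Hx.
  eapply Rle_trans; [apply abs_fst_le|apply HM, Hx]. }
assert (Rabs (snd I) <= (b - a) * M).
{ eapply is_RInt_abs_le; [exact Hab|exact H2|]; intros x Hx.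
  eapply Rle_trans; [apply abs_snd_le|apply HM, Hx]. }
lra.
Qed.

Fixpoint qpoch (q : C) (n : nat) : C :=
  match n with O => 1 | S m => qpoch q m * (1 - q ^ S m) end%C.

Lemma pow_lt_1 (r : R) (n : nat) : 0 <= r < 1 -> (0 < n)%nat -> r ^ n < 1.
Proof.
intros Hr Hn; destruct n as [|n]; [lia|].
simpl; assert (0 <= r ^ n <= 1).
{ split; [apply pow_le; lra|]. rewrite <- (pow1 n); apply pow_incr; lra. }
nra.
Qed.

Lemma one_minus_Cpow_neq_0 (q : C) (n : nat) : Cmod q < 1 -> (0 < n)%nat -> (1 - q ^ n)%C <> 0.
Proof.
intros Hq Hn E; apply Ceq_minus in E.
apply (f_equal Cmod) in E; rewrite Cmod_1, Cmod_pow in E.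
pose proof (pow_lt_1 (Cmod q) n (conj (Cmod_ge_0 q) Hq) Hn); lra.
Qed.

(** * The factor sum of (q)_{n-1} q^n / (1 - q^n) *)

Definition segment_from_1 (x : C) (u : R) : C := (RtoC (1 - u) + RtoC u * x)%C.

Lemma segment_fst_pos (x : C) (u : R) : 0 < fst x -> 0 <= u <= 1 -> 0 < fst (segment_from_1 x u).
Proof. destruct x as [p r]; unfold segment_from_1; simpl; intros; nra. Qed.

Lemma segment_neq_0 (x : C) (u : R) : 0 < fst x -> 0 <= u <= 1 -> segment_from_1 x u <> 0.
Proof. intros; apply Cneq0_fst, segment_fst_pos; assumption. Qed.

Lemma Cmod_segment_ge (x : C) (u : R) :
  0 < fst x -> 0 <= u <= 1 -> 1 - u <= Cmod (segment_from_1 x u).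
Proof.
intros Hx Hu; eapply Rle_trans; [|apply fst_le_Cmod].
destruct x as [p r]; unfold segment_from_1; simpl in *; nra.
Qed.

(** The value is the principal logarithm of [x]. The segment from 1 to [x] stays in the right
    half-plane, where half the log of the squared modulus and the arctangent of the slope are
    primitives of the two parts of dlog. *)
Lemma is_CInt_log (x : C) : 0 < fst x ->
  is_CInt (fun u => (x - 1) / segment_from_1 x u)%C 0 1
    (/ 2 * ln (fst x ^ 2 + snd x ^ 2), atan (snd x / fst x)).
Proof.
destruct x as [p r]; simpl; intro Hp.
assert (HA : forall u, 0 <= u <= 1 -> 0 < 1 - u + u * p) by (intros; nra).
assert (HD : forall u, 0 <= u <= 1 -> 0 < (1 - u + u * p) ^ 2 + (u * r) ^ 2).
{ intros u Hu; specialize (HA u Hu); nra. }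
split; simpl.
- replace (/ 2 * _) with
   (minus (/ 2 * ln ((1 - 1 + 1 * p) ^ 2 + (1 * r) ^ 2)) (/ 2 * ln ((1 - 0 + 0 * p) ^ 2 + (0 * r) ^ 2))).
  2:{ unfold minus, plus, opp; simpl. replace ((1 - 0 + 0 * p) * ((1 - 0 + 0 * p) * 1) + 0 * r * (0 * r * 1)) with 1 by ring.
      rewrite ln_1; match goal with |- / 2 * ln ?a + _ = / 2 * ln ?b => replace a with b by ring end; ring. }
  apply (is_RInt_derive (fun u => / 2 * ln ((1 - u + u * p) ^ 2 + (u * r) ^ 2))).
  + intros u Hu; rewrite Rmin_left, Rmax_right in Hu by lra.
    specialize (HA u Hu); specialize (HD u Hu).
    auto_derive; [simpl in HD; lra|]. field. simpl in HD.
    repeat split; try nra; lra.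
  + intros u Hu; rewrite Rmin_left, Rmax_right in Hu by lra.
    specialize (HA u Hu); specialize (HD u Hu).
    apply (ex_derive_continuous (V := R_NormedModule)); auto_derive.
    simpl in HD; repeat split; nra.
- replace (atan _) with
   (minus (atan (1 * r / (1 - 1 + 1 * p))) (atan (0 * r / (1 - 0 + 0 * p)))).
  2:{ unfold minus, plus, opp; simpl. replace (0 * r / (1 - 0 + 0 * p)) with 0 by (field; lra).
      rewrite atan_0; replace (1 * r / (1 - 1 + 1 * p)) with (r / p) by (field; lra); ring. }
  apply (is_RInt_derive (fun u => atan (u * r / (1 - u + u * p)))).
  + intros u Hu; rewrite Rmin_left, Rmax_right in Hu by lra.
    specialize (HA u Hu); specialize (HD u Hu).
    auto_derive; [lra|]. field. simpl in HD.
    repeat split; try nra; lra.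
  + intros u Hu; rewrite Rmin_left, Rmax_right in Hu by lra.
    specialize (HA u Hu); specialize (HD u Hu).
    apply (ex_derive_continuous (V := R_NormedModule)); auto_derive.
    simpl in HD; repeat split; nra.
Qed.

(** The condition on Im z puts e^(-z) in the right half-plane, where the principal logarithm returns
    -z without a multiple of 2 pi i. *)
Lemma is_CInt_log_exp (z : C) : Rabs (snd z) < PI / 2 ->
  is_CInt (fun u => (Cexp (- z) - 1) / segment_from_1 (Cexp (- z)) u)%C 0 1 (- z)%C.
Proof.
intro Hz; apply Rabs_def2 in Hz.
assert (Hc : 0 < cos (- snd z)) by (rewrite cos_neg; apply cos_gt_0; lra).
pose proof (exp_pos (- fst z)) as He.
assert (Hp : 0 < fst (Cexp (- z))) by (simpl; nra).
pose proof (is_CInt_log _ Hp) as K.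
assert (E : (/ 2 * ln (fst (Cexp (- z)) ^ 2 + snd (Cexp (- z)) ^ 2),
  atan (snd (Cexp (- z)) / fst (Cexp (- z)))) = (- z)%C).
{ rewrite <- Cmod_sqr, Cmod_Cexp; destruct z as [x y]; unfold Copp; simpl in *; f_equal.
  - rewrite Rmult_1_r, <- exp_plus, ln_exp; field.
  - replace (_ / _) with (tan (- y)).
    + apply atan_tan; lra.
    + unfold tan; field; lra. }
rewrite E in K; exact K.
Qed.

Fixpoint segment_prod (q : C) (i n : nat) (u : R) : C :=
  match n with O => 1 | S m => segment_prod q i m u * segment_from_1 (q ^ (i + m)) u end%C.

(** The product is built from the right, but the divided-difference recurrence must also be able to
    drop the leftmost node. *)
Lemma segment_prod_Sl (q : C) (i n : nat) (u : R) :
  segment_prod q i (S n) u = (segment_from_1 (q ^ i) u * segment_prod q (S i) n u)%C.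
Proof.
induction n as [|n IH].
- simpl; rewrite Nat.add_0_r, Cmult_1_l, Cmult_1_r; reflexivity.
- change (segment_prod q i (S n) u * segment_from_1 (q ^ (i + S n)) u =
    segment_from_1 (q ^ i) u * (segment_prod q (S i) n u * segment_from_1 (q ^ (S i + n)) u))%C.
  rewrite IH; replace (i + S n)%nat with (S i + n)%nat by lia; rewrite Cmult_assoc; reflexivity.
Qed.

Lemma segment_prod_neq_0 (q : C) (i n : nat) (u : R) :
  (forall j, (j < i + n)%nat -> 0 < fst (q ^ j)%C) -> 0 <= u <= 1 -> segment_prod q i n u <> 0.
Proof.
intros H Hu; induction n as [|n IH]; simpl; [apply C1_nz|].
apply Cmult_neq_0; [apply IH; intros; apply H; lia|apply segment_neq_0; [apply H; lia|exact Hu]].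
Qed.

(** Keeping the arguments of all nodes below pi/2 is the constraint that ties the number N of nodes
    to Im z; the kernels below divide by segments ending at these nodes. *)
Lemma fst_Cexp_pow_pos (z : C) (N j : nat) :
  INR N * Rabs (snd z) < PI / 2 -> (j <= N)%nat -> 0 < fst (Cexp (- z) ^ j)%C.
Proof.
intros HN Hj; rewrite Cexp_pow; unfold Cexp.
cbn [fst snd]; apply Rmult_lt_0_compat; [apply exp_pos|].
assert (H : Rabs (INR j * snd z) < PI / 2).
{ rewrite Rabs_mult, (Rabs_right (INR j)) by (apply Rle_ge, pos_INR).
  eapply Rle_lt_trans; [|exact HN]; apply Rmult_le_compat_r; [apply Rabs_pos|apply le_INR, Hj]. }
replace (snd (RtoC (INR j) * - z)%C) with (- (INR j * snd z)) by (destruct z; simpl; ring).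
rewrite cos_neg; apply Rabs_def2 in H; apply cos_gt_0; lra.
Qed.

(* Up to a factor, the divided difference of the logarithm at [q^i, ..., q^(i+n+1)],
   in the form [int_0^oo ds / prod (1 + s q^j)] with [s = u / (1 - u)]. *)
Definition divdiff_kernel (q : C) (i n : nat) (u : R) : C :=
  (RtoC (1 - u) ^ n / segment_prod q i (n + 2) u)%C.

(** Induction on [n] by the recurrence of divided differences: the kernel with one more node is a
    combination of the kernels lacking the last and the first node. For [n] = 0, partial fractions
    give two logarithm integrals. *)
Lemma is_CInt_divdiff (z : C) (i n : nat) : let q := Cexp (- z) in
  0 < fst z -> INR (i + n + 1) * Rabs (snd z) < PI / 2 ->
  is_CInt (divdiff_kernel q i n) 0 1 (z / (q ^ i * (1 - q ^ (n + 1))))%C.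
Proof.
intros q Hz; revert i.
assert (Hq : Cmod q < 1).
{ unfold q; rewrite Cmod_Cexp, <- exp_0; apply exp_increasing; destruct z; simpl in *; lra. }
assert (Hq0 : q <> 0) by apply Cexp_neq_0.
assert (Hpos := fun N j => fst_Cexp_pow_pos z N j).
induction n as [|n IH]; intros i Hi.
- assert (Hx : forall j, (j <= i + 1)%nat -> is_CInt (fun u => (q ^ j - 1) / segment_from_1 (q ^ j) u)%C 0 1 (- (INR j * z))%C).
  { intros j Hj.
    assert (E : (q ^ j)%C = Cexp (- (INR j * z))) by (unfold q; rewrite Cexp_pow; f_equal; ring).
    rewrite E; apply is_CInt_log_exp.
    replace (snd (RtoC (INR j) * z)%C) with (INR j * snd z) by (destruct z; simpl; ring).
    rewrite Rabs_mult, (Rabs_right (INR j)) by (apply Rle_ge, pos_INR).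
    eapply Rle_lt_trans; [|exact Hi]; apply Rmult_le_compat_r; [apply Rabs_pos|apply le_INR; lia]. }
  assert (N1 : (1 - q)%C <> 0).
  { replace q with (q ^ 1)%C by (simpl; ring); apply one_minus_Cpow_neq_0; [exact Hq|lia]. }
  assert (Ni := Cpow_nz q i Hq0).
  replace (z / (q ^ i * (1 - q ^ (0 + 1))))%C
    with (/ (q ^ i * (1 - q)) * (- (INR i * z) + (-1) * (- (INR (i + 1) * z))))%C.
  2:{ rewrite plus_INR, RtoC_plus; simpl; field; split; assumption. }
  eapply is_CInt_ext; [lra| |apply is_CInt_scal, is_CInt_plus; [apply (Hx i); lia|apply is_CInt_scal, (Hx (i+1)%nat); lia]].
  intros u Hu; cbv beta; unfold divdiff_kernel.
  assert (Hu' : 0 <= u <= 1) by lra.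
  assert (L0 := segment_neq_0 (q ^ i) u (Hpos _ i Hi ltac:(lia)) Hu').
  assert (L1 := segment_neq_0 (q ^ (i + 1)) u (Hpos _ (i + 1)%nat Hi ltac:(lia)) Hu').
  simpl segment_prod; rewrite Nat.add_0_r.
  rewrite Cpow_add_r in L1 |- *; replace (q ^ 1)%C with q in * by (simpl; ring).
  unfold segment_from_1 in *; rewrite RtoC_minus in *; simpl Cpow.
  field; repeat split; assumption.
- assert (Hi' : INR (i + n + 1) * Rabs (snd z) < PI / 2).
  { eapply Rle_lt_trans; [|exact Hi]; apply Rmult_le_compat_r; [apply Rabs_pos|apply le_INR; lia]. }
  assert (Hi2 : INR (S i + n + 1) * Rabs (snd z) < PI / 2).
  { replace (S i + n + 1)%nat with (i + S n + 1)%nat by lia; exact Hi. }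
  assert (Nn : (1 - q ^ (n + 2))%C <> 0) by (apply one_minus_Cpow_neq_0; [exact Hq|lia]).
  assert (Nn1 : (1 - q ^ (n + 1))%C <> 0) by (apply one_minus_Cpow_neq_0; [exact Hq|lia]).
  assert (Ni := Cpow_nz q i Hq0).
  (* Writing seg for [segment_from_1], the coefficients come from q^i seg(q^(i+n+2)) - q^(i+n+2)
     seg(q^i) = (1 - u) (q^i - q^(i+n+2)); the factor 1 - u is the extra power in the longer
     kernel. *)
  pose proof (is_CInt_plus _ _ _ _ _ _
    (is_CInt_scal (q ^ i / (q ^ i * (1 - q ^ (n + 2))))%C _ _ _ _ (IH i Hi'))
    (is_CInt_scal (- (q ^ i * q ^ (n + 2)) / (q ^ i * (1 - q ^ (n + 2))))%C _ _ _ _ (IH (S i) Hi2))) as K.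
  replace (z / (q ^ i * (1 - q ^ (S n + 1))))%C with
    (q ^ i / (q ^ i * (1 - q ^ (n + 2))) * (z / (q ^ i * (1 - q ^ (n + 1)))) +
      - (q ^ i * q ^ (n + 2)) / (q ^ i * (1 - q ^ (n + 2))) * (z / (q ^ S i * (1 - q ^ (n + 1)))))%C.
  2:{ replace (S n + 1)%nat with (n + 2)%nat by lia.
      assert (E2 : (q ^ (n + 2))%C = (q * q ^ (n + 1))%C) by (replace (n + 2)%nat with (S (n + 1)) by lia; reflexivity).
      rewrite E2 in *; rewrite (Cpow_S q i); field; repeat split; assumption. }
  eapply is_CInt_ext; [lra| |exact K].
  intros u Hu; cbv beta; unfold divdiff_kernel.
  assert (Hu' : 0 <= u <= 1) by lra.
  assert (L0 := segment_neq_0 (q ^ i) u (Hpos _ i Hi ltac:(lia)) Hu').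
  assert (L1 := segment_neq_0 (q ^ (i + (n + 2))) u (Hpos _ (i + (n + 2))%nat Hi ltac:(lia)) Hu').
  assert (LP : segment_prod q (S i) (n + 1) u <> 0).
  { apply segment_prod_neq_0; [|exact Hu']; intros j Hj; apply (Hpos _ j Hi); lia. }
  replace (segment_prod q i (n + 2) u)
    with (segment_from_1 (q ^ i) u * segment_prod q (S i) (n + 1) u)%C
    by (replace (n + 2)%nat with (S (n + 1)) by lia; rewrite segment_prod_Sl; reflexivity).
  replace (segment_prod q (S i) (n + 2) u)
    with (segment_prod q (S i) (n + 1) u * segment_from_1 (q ^ (i + (n + 2))) u)%C.
  2:{ replace (i + (n + 2))%nat with (S i + (n + 1))%nat by lia; replace (n + 2)%nat with (S (n + 1)) by lia; reflexivity. }
  replace (segment_prod q i (S n + 2) u)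
    with (segment_from_1 (q ^ i) u * (segment_prod q (S i) (n + 1) u * segment_from_1 (q ^ (i + (n + 2))) u))%C.
  2:{ replace (i + (n + 2))%nat with (S i + (n + 1))%nat by lia; replace (S n + 2)%nat with (S (S (n + 1))) by lia; rewrite segment_prod_Sl; reflexivity. }
  rewrite Cpow_S.
  set (Y := (RtoC (1 - u) ^ n)%C).
  assert (EX : RtoC (1 - u) = (1 - u)%C) by (rewrite RtoC_minus; reflexivity).
  set (PP := segment_prod q (S i) (n + 1) u) in *.
  rewrite (Cpow_add_r q i (n + 2)) in L1 |- *.
  set (QQ := (q ^ (n + 2))%C) in *.
  unfold segment_from_1 in *; rewrite EX in *.
  field; repeat split; assumption.
Qed.

(* [qpoch q n * prod_j (1 - u) / (1 - u + u q^j)], whose integral is the error of the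
   Newton interpolation of the logarithm at [1, q^-1, ..., q^-n], differentiated at [1]. *)
Definition newton_remainder (q : C) (n : nat) (u : R) : C :=
  (qpoch q n * RtoC (1 - u) ^ n / segment_prod q 1 n u)%C.

Fixpoint csum (f : nat -> C) (n : nat) : C :=
  match n with O => 0 | S m => csum f m + f m end%C.

Lemma csum_S (f : nat -> C) (n : nat) : csum f (S n) = (csum f n + f n)%C.
Proof. reflexivity. Qed.

(** The term n = m + 1 of A(q), shifted so that sums start at 0. *)
Definition spt_quot (q : C) (m : nat) : C := (qpoch q m * q ^ S m / (1 - q ^ S m))%C.

(** Adding the node q^(n+1) changes the remainder by -(q)_n q^(n+1) times the kernel on 1, q, ...,
    q^(n+1), whose integral is known; each such step subtracts z times one term of A(q). With no
    node besides 1 the remainder is the constant 1. *)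
Lemma is_CInt_newton_remainder (z : C) (n : nat) : let q := Cexp (- z) in
  0 < fst z -> INR n * Rabs (snd z) < PI / 2 ->
  is_CInt (newton_remainder q n) 0 1 (1 - z * csum (spt_quot q) n)%C.
Proof.
intros q Hz Hn.
assert (Hq : Cmod q < 1).
{ unfold q; rewrite Cmod_Cexp, <- exp_0; apply exp_increasing; destruct z; simpl in *; lra. }
induction n as [|n IH].
- apply is_CInt_ext with (fun _ => RtoC 1); [lra| |].
  + intros u Hu; unfold newton_remainder; simpl; field; apply C1_nz.
  + simpl csum; replace (1 - z * 0)%C with (RtoC 1) by ring.
    split; simpl.
    * evar_last; [apply (is_RInt_const (V := R_NormedModule))|simpl; unfold scal; simpl; unfold mult; simpl; ring].
    * evar_last; [apply (is_RInt_const (V := R_NormedModule))|simpl; unfold scal; simpl; unfold mult; simpl; ring].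
- assert (Hn' : INR n * Rabs (snd z) < PI / 2).
  { eapply Rle_lt_trans; [|exact Hn]; apply Rmult_le_compat_r; [apply Rabs_pos|apply le_INR; lia]. }
  assert (Hn2 : INR (0 + n + 1) * Rabs (snd z) < PI / 2).
  { replace (0 + n + 1)%nat with (S n) by lia; exact Hn. }
  pose proof (is_CInt_plus _ _ _ _ _ _ (IH Hn')
    (is_CInt_scal (- (qpoch q n * q ^ S n))%C _ _ _ _ (is_CInt_divdiff z 0 n Hz Hn2))) as K.
  fold q in K.
  assert (N1 : (1 - q ^ S n)%C <> 0) by (apply one_minus_Cpow_neq_0; [exact Hq|lia]).
  replace (1 - z * csum (spt_quot q) (S n))%C with
   (1 - z * csum (spt_quot q) n + - (qpoch q n * q ^ S n) * (z / (q ^ 0 * (1 - q ^ (n + 1)))))%C.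
  2:{ simpl csum; unfold spt_quot; replace (n + 1)%nat with (S n) by lia.
      replace (q ^ 0)%C with (RtoC 1) by reflexivity; field; exact N1. }
  eapply is_CInt_ext; [lra| |exact K].
  intros u Hu; cbv beta; unfold divdiff_kernel, newton_remainder.
  assert (Hu' : 0 <= u <= 1) by lra.
  assert (Hpos : forall j, (j <= S n)%nat -> 0 < fst (q ^ j)%C)
    by (intros j Hj; apply (fst_Cexp_pow_pos z (S n) j Hn Hj)).
  assert (L1 := segment_neq_0 (q ^ S n) u (Hpos (S n) (le_n _)) Hu').
  assert (LP : segment_prod q 1 n u <> 0).
  { apply segment_prod_neq_0; [|exact Hu']; intros j Hj; apply Hpos; lia. }
  replace (n + 2)%nat with (S (S n)) by lia; rewrite segment_prod_Sl.
  change (segment_prod q 1 (S n) u) with (segment_prod q 1 n u * segment_from_1 (q ^ S n) u)%C.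
  change (qpoch q (S n)) with (qpoch q n * (1 - q ^ S n))%C.
  rewrite (Cpow_S (RtoC (1 - u)) n).
  assert (E1 : segment_from_1 (q ^ 0) u = 1).
  { unfold segment_from_1; simpl; rewrite RtoC_minus; ring. }
  rewrite E1.
  assert (EX : RtoC (1 - u) = (1 - u)%C) by (rewrite RtoC_minus; reflexivity).
  set (Y := (RtoC (1 - u) ^ n)%C).
  unfold segment_from_1 in *; rewrite EX in *.
  set (PP := segment_prod q 1 n u) in *.
  set (QQ := (q ^ S n)%C) in *.
  field; repeat split; assumption || apply C1_nz.
Qed.

Definition Clim (f : nat -> C) (l : C) : Prop :=
  forall eps, 0 < eps -> exists N, forall n, (N <= n)%nat -> Cmod (f n - l) <= eps.

Lemma exp_INR_mult (n : nat) (x : R) : exp (INR n * x) = exp x ^ n.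
Proof.
induction n as [|n IH]; [simpl; rewrite Rmult_0_l; apply exp_0|].
rewrite S_INR, Rmult_plus_distr_r, Rmult_1_l, exp_plus, IH; simpl; ring.
Qed.

(** Serves to trade powers of 1/t for a slightly worse exponential rate. It is y <= (k/e) exp(e y /
    k) raised to the power k. *)
Lemma pow_le_exp (k : nat) (e : R) : 0 < e ->
  exists K, 0 < K /\ forall y, 0 <= y -> y ^ k <= K * exp (e * y).
Proof.
intro He; destruct k as [|k].
- exists 1; split; [lra|]; intros y Hy; simpl; rewrite Rmult_1_l, <- exp_0; apply exp_le; nra.
- set (n := S k); assert (Hn : 0 < INR n) by (apply lt_0_INR; unfold n; lia).
  exists ((INR n / e) ^ n); split; [apply pow_lt, Rdiv_lt_0_compat; assumption|].
  intros y Hy; replace (e * y) with (INR n * (e / INR n * y)) by (field; lra).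
  rewrite exp_INR_mult, <- Rpow_mult_distr; apply pow_incr; split; [exact Hy|].
  pose proof (exp_ineq (e / INR n * y)) as H.
  assert (0 < e / INR n) by (apply Rdiv_lt_0_compat; assumption).
  apply Rle_trans with (INR n / e * (e / INR n * y)); [right; field; lra|].
  apply Rmult_le_compat_l; [left; apply Rdiv_lt_0_compat; assumption|lra].
Qed.

(** A weak Stirling bound. The induction step needs e m^(m+1) <= (m+1)^(m+1), which is exp(-1/(m+1))
    >= m/(m+1) raised to the power m + 1. *)
Lemma fact_le_exp (n : nat) : (0 < n)%nat ->
  INR (fact n) <= exp 1 * INR n * INR n ^ n * exp (- INR n).
Proof.
induction n as [|n IH]; [lia|]; intros _.
destruct n as [|n].
- change (INR (fact 1)) with 1; change (INR 1) with 1; rewrite exp_Ropp; right; field.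
  apply Rgt_not_eq, exp_pos.
- specialize (IH ltac:(lia)); set (m := S n) in *.
  assert (Hm : 0 < INR m) by (apply lt_0_INR; unfold m; lia).
  change (fact (S m)) with (S m * fact m)%nat; rewrite mult_INR, S_INR.
  assert (K : exp 1 * INR m ^ S m <= (INR m + 1) ^ S m).
  { assert (E : exp (/ INR (S m)) * INR m <= INR m + 1).
    { pose proof (exp_ineq (- / INR (S m))) as H; rewrite exp_Ropp in H.
      rewrite S_INR in *; pose proof (exp_pos (/ (INR m + 1))) as P.
      apply (Rmult_le_compat_r (exp (/ (INR m + 1)) * (INR m + 1))) in H; [|apply Rlt_le, Rmult_lt_0_compat; lra].
      replace (/ exp (/ (INR m + 1)) * (exp (/ (INR m + 1)) * (INR m + 1))) with (INR m + 1) in H by (field; lra).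
      replace ((1 + - / (INR m + 1)) * (exp (/ (INR m + 1)) * (INR m + 1)))
        with (exp (/ (INR m + 1)) * INR m) in H by (field; lra); exact H. }
    assert (P : 0 <= exp (/ INR (S m)) * INR m) by (apply Rmult_le_pos; [left; apply exp_pos|lra]).
    pose proof (pow_incr _ _ (S m) (conj P E)) as E2.
    rewrite Rpow_mult_distr, <- exp_INR_mult, Rinv_r in E2; [exact E2|apply not_0_INR; lia]. }
  apply Rle_trans with ((INR m + 1) * (exp 1 * INR m * INR m ^ m * exp (- INR m))).
  + apply Rmult_le_compat_l; [lra|exact IH].
  + replace (- (INR m + 1)) with (- INR m + - (1)) by ring.
    rewrite exp_plus, (exp_Ropp 1); pose proof (exp_pos 1); pose proof (exp_pos (- INR m)).
    replace ((INR m + 1) * (exp 1 * INR m * INR m ^ m * exp (- INR m)))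
      with ((INR m + 1) * exp (- INR m) * (exp 1 * INR m ^ S m)) by (simpl; ring).
    replace (exp 1 * (INR m + 1) * (INR m + 1) ^ S m * (exp (- INR m) * / exp 1))
      with ((INR m + 1) * exp (- INR m) * (INR m + 1) ^ S m) by (field; lra).
    apply Rmult_le_compat_l; [apply Rmult_le_pos; lra|exact K].
Qed.

(** Each factor satisfies |1 - q^j| <= j |z|. Together with Stirling and N |z| <= 1 this makes (q)_N
    of order e^(-1/|z|), the source of the exponential precision for A(q). *)
Lemma Cmod_qpoch_le (z : C) (n : nat) : 0 <= fst z ->
  Cmod (qpoch (Cexp (- z)) n) <= INR (fact n) * Cmod z ^ n.
Proof.
intro Hz; induction n as [|n IH]; [simpl; rewrite Cmod_1; lra|].
change (qpoch (Cexp (- z)) (S n)) with (qpoch (Cexp (- z)) n * (1 - Cexp (- z) ^ S n))%C.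
rewrite Cmod_mult, Cexp_pow.
replace (RtoC (INR (S n)) * - z)%C with (- (RtoC (INR (S n)) * z))%C by ring.
assert (H : Cmod (1 - Cexp (- (RtoC (INR (S n)) * z))) <= INR (S n) * Cmod z).
{ eapply Rle_trans; [apply Cmod_one_minus_exp|].
  - replace (fst (RtoC (INR (S n)) * z)%C) with (INR (S n) * fst z) by (destruct z; simpl; ring).
    apply Rmult_le_pos; [apply pos_INR|exact Hz].
  - rewrite Cmod_mult, Cmod_R, Rabs_right by (apply Rle_ge, pos_INR); lra. }
replace (INR (fact (S n)) * Cmod z ^ S n) with ((INR (fact n) * Cmod z ^ n) * (INR (S n) * Cmod z)).
- apply Rmult_le_compat; try apply Cmod_ge_0; assumption.
- change (fact (S n)) with (S n * fact n)%nat; rewrite mult_INR; simpl pow; ring.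
Qed.

Lemma Cmod_segment_prod_ge (q : C) (n : nat) (u : R) :
  (forall j, (j <= n)%nat -> 0 < fst (q ^ j)%C) -> 0 <= u <= 1 ->
  (1 - u) ^ n <= Cmod (segment_prod q 1 n u).
Proof.
intros H Hu; induction n as [|n IH]; [simpl; rewrite Cmod_1; lra|].
change (segment_prod q 1 (S n) u) with (segment_prod q 1 n u * segment_from_1 (q ^ S n) u)%C.
rewrite Cmod_mult; simpl pow; rewrite Rmult_comm; apply Rmult_le_compat.
- apply pow_le; lra.
- lra.
- apply IH; intros; apply H; lia.
- apply Cmod_segment_ge; [apply H; lia|exact Hu].
Qed.

(** The powers of 1 - u cancel against the lower bound 1 - u for each segment, valid because the
    nodes have positive real part; the estimate is therefore uniform in [u]. *)
Lemma Cmod_newton_remainder_le (q : C) (n : nat) (u : R) :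
  (forall j, (j <= n)%nat -> 0 < fst (q ^ j)%C) -> 0 <= u <= 1 ->
  Cmod (newton_remainder q n u) <= Cmod (qpoch q n).
Proof.
intros H Hu; unfold newton_remainder.
assert (N : segment_prod q 1 n u <> 0)
  by (apply segment_prod_neq_0; [intros j Hj; apply H; lia|exact Hu]).
rewrite Cmod_div by exact N; rewrite Cmod_mult, Cmod_pow, Cmod_R, Rabs_right by lra.
pose proof (Cmod_segment_prod_ge q n u H Hu) as K.
assert (P : 0 < Cmod (segment_prod q 1 n u)) by (apply Cmod_gt_0; exact N).
apply Rmult_le_reg_r with (1 := P).
unfold Rdiv; rewrite Rmult_assoc, Rinv_l by lra; rewrite Rmult_1_r.
apply Rmult_le_compat_l; [apply Cmod_ge_0|exact K].
Qed.

Lemma Cmod_one_minus_pow_ge (q : C) (m : nat) : Cmod q < 1 -> 1 - Cmod q <= Cmod (1 - q ^ S m).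
Proof.
intro Hq; pose proof (Cmod_ge_0 q) as H0.
assert (H : Cmod (q ^ S m) <= Cmod q).
{ rewrite Cmod_pow; simpl. assert (Cmod q ^ m <= 1) by (rewrite <- (pow1 m); apply pow_incr; lra). nra. }
pose proof (Cmod_triangle (1 - q ^ S m) (q ^ S m)) as T.
replace (1 - q ^ S m + q ^ S m)%C with (RtoC 1) in T by ring; rewrite Cmod_1 in T; lra.
Qed.

(** Beyond N each factor is at most 1 + |q|^j <= exp(|q|^j). The geometric sum is kept in closed
    form so that the induction goes through. *)
Lemma qpoch_growth (q : C) (N k : nat) : Cmod q < 1 ->
  Cmod (qpoch q (N + k)) <=
    Cmod (qpoch q N) * exp ((Cmod q ^ S N - Cmod q ^ S (N + k)) / (1 - Cmod q)).
Proof.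
intro Hq; pose proof (Cmod_ge_0 q) as H0; induction k as [|k IH].
- rewrite Nat.add_0_r; replace (_ - _) with 0 by ring; unfold Rdiv; rewrite Rmult_0_l, exp_0; lra.
- rewrite Nat.add_succ_r.
  change (qpoch q (S (N + k))) with (qpoch q (N + k) * (1 - q ^ S (N + k)))%C.
  rewrite Cmod_mult.
  set (s := Cmod q ^ S (N + k)) in *.
  replace (Cmod q ^ S (S (N + k))) with (Cmod q * s) by reflexivity.
  replace ((Cmod q ^ S N - Cmod q * s) / (1 - Cmod q)) with ((Cmod q ^ S N - s) / (1 - Cmod q) + s) by (field; lra).
  rewrite exp_plus, <- Rmult_assoc; apply Rmult_le_compat; try apply Cmod_ge_0; [exact IH|].
  eapply Rle_trans; [|apply exp_ineq].
  unfold Cminus; eapply Rle_trans; [apply Cmod_triangle|].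
  rewrite Cmod_1, Cmod_opp, Cmod_pow; unfold s; lra.
Qed.

(** Terms past N inherit the smallness of (q)_N, up to the growth factor of the product, and a
    geometric series adds them up. *)
Lemma spt_quot_tail (q : C) (N k : nat) : Cmod q < 1 ->
  Cmod (csum (spt_quot q) (N + k) - csum (spt_quot q) N) <=
    Cmod (qpoch q N) * exp (Cmod q ^ S N / (1 - Cmod q)) / (1 - Cmod q) * ((1 - Cmod q ^ k) / (1 - Cmod q)).
Proof.
intro Hq; pose proof (Cmod_ge_0 q) as H0.
set (B := Cmod (qpoch q N) * exp (Cmod q ^ S N / (1 - Cmod q)) / (1 - Cmod q)).
induction k as [|k IH].
- rewrite Nat.add_0_r; replace (_ - _)%C with (RtoC 0) by ring; rewrite Cmod_0; simpl; right; field; lra.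
- rewrite Nat.add_succ_r; simpl csum.
  replace (csum (spt_quot q) (N + k) + spt_quot q (N + k) - csum (spt_quot q) N)%C
    with ((csum (spt_quot q) (N + k) - csum (spt_quot q) N) + spt_quot q (N + k))%C by ring.
  eapply Rle_trans; [apply Cmod_triangle|].
  assert (K : Cmod (spt_quot q (N + k)) <= B * Cmod q ^ k).
  { unfold spt_quot; rewrite Cmod_div by (apply one_minus_Cpow_neq_0; [exact Hq|lia]).
    rewrite Cmod_mult, Cmod_pow; unfold B.
    pose proof (Cmod_one_minus_pow_ge q (N + k) Hq) as G.
    assert (P : 0 <= Cmod q ^ S (N + k) <= Cmod q ^ k).
    { split; [apply pow_le, H0|]. replace (S (N + k)) with (k + S N)%nat by lia; rewrite pow_add.
      assert (0 <= Cmod q ^ S N <= 1) by (split; [apply pow_le, H0|rewrite <- (pow1 (S N)); apply pow_incr; lra]).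
      assert (0 <= Cmod q ^ k) by apply pow_le, H0; nra. }
    assert (Q : Cmod (qpoch q (N + k)) <= Cmod (qpoch q N) * exp (Cmod q ^ S N / (1 - Cmod q))).
    { eapply Rle_trans; [apply qpoch_growth, Hq|]; apply Rmult_le_compat_l; [apply Cmod_ge_0|].
      apply exp_le; unfold Rdiv; apply Rmult_le_compat_r; [left; apply Rinv_0_lt_compat; lra|lra]. }
    unfold Rdiv; rewrite (Rmult_assoc (_ * _) (/ (1 - Cmod q)) (Cmod q ^ k)), (Rmult_comm (/ (1 - Cmod q))), <- Rmult_assoc.
    apply Rmult_le_compat.
    - apply Rmult_le_pos; [apply Cmod_ge_0|lra].
    - left; apply Rinv_0_lt_compat; lra.
    - apply Rmult_le_compat; [apply Cmod_ge_0|lra|exact Q|lra].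
    - apply Rinv_le_contravar; lra. }
  replace (B * ((1 - Cmod q ^ S k) / (1 - Cmod q)))
    with (B * ((1 - Cmod q ^ k) / (1 - Cmod q)) + B * Cmod q ^ k) by (simpl; field; lra).
  lra.
Qed.

Lemma one_minus_exp_inv_le (x : R) : 0 < x -> / (1 - exp (- x)) <= 1 + / x.
Proof.
intro Hx; pose proof (exp_neg_le_inv x ltac:(lra)) as H.
replace (1 + / x) with (/ (1 - / (1 + x))) by (field; lra).
apply Rinv_le_contravar; [|lra].
replace (1 - / (1 + x)) with (x / (1 + x)) by (field; lra); apply Rdiv_lt_0_compat; lra.
Qed.

Lemma nat_floor_inv (t : R) : 0 < t <= 1 ->
  exists N, (0 < N)%nat /\ INR N * t <= 1 < (INR N + 1) * t.
Proof.
intro Ht; destruct (nfloor_ex (/ t)) as [N HN].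
{ left; apply Rinv_0_lt_compat; lra. }
exists N.
assert (H1 : INR N * t <= 1).
{ apply Rmult_le_reg_r with (/ t); [apply Rinv_0_lt_compat; lra|].
  rewrite Rmult_assoc, Rinv_r by lra; lra. }
assert (H2 : 1 < (INR N + 1) * t).
{ apply Rmult_lt_reg_r with (/ t); [apply Rinv_0_lt_compat; lra|].
  rewrite Rmult_assoc, Rinv_r by lra; lra. }
split; [|lra]. destruct N; [simpl in H2; nra|lia].
Qed.

(** Here N is the integer part of 1/|z|: enough nodes for (q)_N to be about e^(-1/|z|), few enough
    to keep them in the right half-plane. The tail loses e^(169/(300|z|)) by growth, and powers of
    1/|z| are absorbed at rate 11/300; 1 - 169/300 - 11/300 = 2/5. *)
Lemma spt_quot_series_estimate : exists K, 0 < K /\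
  forall (z A : C), 0 < Cmod z <= 1 -> 12 / 13 * Cmod z <= fst z ->
    Clim (csum (spt_quot (Cexp (- z)))) A ->
    Cmod (z * A - 1) <= K * exp (- (2 / 5) / Cmod z).
Proof.
destruct (pow_le_exp 2 (11 / 300) ltac:(lra)) as [K [HK HK2]].
exists (exp 1 * exp 1 * (2 + 9 * exp 1) * K).
pose proof (exp_pos 1) as He.
split; [repeat apply Rmult_lt_0_compat; lra|].
intros z A Ht Hz HA; set (t := Cmod z) in *; set (q := Cexp (- z)) in *.
destruct (nat_floor_inv t Ht) as [N [HN0 [HN1 HN2]]].
assert (Hr : Cmod q = exp (- fst z)) by (unfold q; rewrite Cmod_Cexp; destruct z; reflexivity).
assert (Hx : 0 < fst z) by lra.
assert (Hq : Cmod q < 1) by (rewrite Hr, <- exp_0; apply exp_increasing; lra).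
(* The hypothesis says that the argument of z has cosine at least 12/13, hence sine at most 5/13 in
   absolute value. *)
assert (Hy : Rabs (snd z) <= 5 / 13 * t).
{ apply Rsqr_incr_0_var; [|lra]; rewrite <- Rsqr_abs, !Rsqr_pow2.
  pose proof (Cmod_sqr z) as E; fold t in E; nra. }
assert (HNy : INR N * Rabs (snd z) < PI / 2).
{ apply Rle_lt_trans with (INR N * (5 / 13 * t)); [apply Rmult_le_compat_l; [apply pos_INR|exact Hy]|].
  pose proof PI2_1; nra. }
assert (Hp : forall j, (j <= N)%nat -> 0 < fst (q ^ j)%C)
  by (intros j Hj; apply (fst_Cexp_pow_pos z N j HNy Hj)).
set (Q := Cmod (qpoch q N)).
assert (HQ : Q <= exp 1 * exp 1 * / t * exp (- / t)).
{ unfold Q; eapply Rle_trans; [apply Cmod_qpoch_le; lra|]; fold t.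
  eapply Rle_trans; [apply Rmult_le_compat_r; [apply pow_le; lra|apply fact_le_exp, HN0]|].
  replace (exp 1 * INR N * INR N ^ N * exp (- INR N) * t ^ N)
    with (exp 1 * INR N * (INR N * t) ^ N * exp (- INR N)) by (rewrite Rpow_mult_distr; ring).
  assert (P1 : 0 <= (INR N * t) ^ N <= 1).
  { split; [apply pow_le; pose proof (pos_INR N); nra|].
    rewrite <- (pow1 N); apply pow_incr; pose proof (pos_INR N); nra. }
  assert (P2 : exp (- INR N) <= exp 1 * exp (- / t)).
  { rewrite <- exp_plus; apply exp_le.
    assert (/ t < INR N + 1); [|lra].
    apply Rmult_lt_reg_r with t; [lra|]; rewrite Rinv_l; lra. }
  assert (P3 : INR N <= / t) by (apply Rmult_le_reg_r with t; [lra|]; rewrite Rinv_l; lra).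
  pose proof (exp_pos (- INR N)); pose proof (pos_INR N).
  replace (exp 1 * exp 1 * / t * exp (- / t)) with (exp 1 * / t * (exp 1 * exp (- / t))) by ring.
  apply Rmult_le_compat; [|lra| |exact P2].
  - apply Rmult_le_pos; [apply Rmult_le_pos; lra|lra].
  - rewrite <- (Rmult_1_r (exp 1 * / t)); apply Rmult_le_compat; try lra.
    + apply Rmult_le_pos; lra.
    + apply Rmult_le_compat_l; lra. }
assert (HQ0 : 0 <= Q) by apply Cmod_ge_0.
assert (R1 : Cmod (1 - z * csum (spt_quot q) N) <= 2 * Q).
{ eapply Rle_trans; [apply (is_CInt_bound (newton_remainder q N) 0 1 Q); [lra|apply is_CInt_newton_remainder; assumption|]|lra].
  intros u Hu; apply Cmod_newton_remainder_le; assumption. }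
assert (Hr1 : 0 < / (1 - Cmod q) <= 3 / t).
{ split; [apply Rinv_0_lt_compat; lra|]. rewrite Hr; eapply Rle_trans; [apply one_minus_exp_inv_le, Hx|].
  assert (/ fst z <= / (12 / 13 * t)) by (apply Rinv_le_contravar; lra).
  replace (/ (12 / 13 * t)) with (13 / 12 * / t) in H by (field; lra).
  assert (1 <= / t) by (rewrite <- Rinv_1; apply Rinv_le_contravar; lra); unfold Rdiv; lra. }
(* Since (N + 1)|z| > 1, |q|^(N+1) <= e^(-12/13) <= 13/25, and 13/25 times 13/12 is 169/300. *)
assert (HS : Cmod q ^ S N / (1 - Cmod q) <= 1 + 169 / 300 * / t).
{ assert (Cmod q ^ S N <= 13 / 25).
  { rewrite Hr, <- exp_INR_mult, S_INR.
    apply Rle_trans with (exp (- (12 / 13))).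
    - apply exp_le; nra.
    - eapply Rle_trans; [apply exp_neg_le_inv; lra|]; lra. }
  assert (Hq1 : / (1 - Cmod q) <= 1 + 13 / 12 * / t).
  { rewrite Hr; eapply Rle_trans; [apply one_minus_exp_inv_le, Hx|].
    assert (/ fst z <= / (12 / 13 * t)) by (apply Rinv_le_contravar; lra).
    replace (/ (12 / 13 * t)) with (13 / 12 * / t) in H0 by (field; lra); lra. }
  assert (0 <= Cmod q ^ S N) by (apply pow_le, Cmod_ge_0).
  assert (0 < / t) by (apply Rinv_0_lt_compat; lra).
  unfold Rdiv at 1; apply Rle_trans with (13 / 25 * (1 + 13 / 12 * / t)); [|lra].
  apply Rmult_le_compat; lra. }
set (T := Q * exp (1 + 169 / 300 * / t) * (9 / t ^ 2)).
assert (R2 : forall k, Cmod (csum (spt_quot q) (N + k) - csum (spt_quot q) N) <= T).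
{ intro k; eapply Rle_trans; [apply spt_quot_tail, Hq|]; fold Q; unfold T.
  pose proof (exp_le _ _ HS) as HE.
  assert (0 <= Cmod q ^ k) by (apply pow_le, Cmod_ge_0).
  assert (Cmod q ^ k <= 1) by (rewrite <- (pow1 k); apply pow_incr; pose proof (Cmod_ge_0 q); lra).
  replace (9 / t ^ 2) with (3 / t * (3 / t)) by (field; lra).
  pose proof (exp_pos (Cmod q ^ S N / (1 - Cmod q))).
  assert (P : 0 <= 1 - Cmod q ^ k <= 1) by lra.
  replace (Q * exp (Cmod q ^ S N / (1 - Cmod q)) / (1 - Cmod q) * ((1 - Cmod q ^ k) / (1 - Cmod q)))
    with (Q * (exp (Cmod q ^ S N / (1 - Cmod q)) * (/ (1 - Cmod q) * ((1 - Cmod q ^ k) * / (1 - Cmod q)))))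
    by (field; lra).
  rewrite (Rmult_assoc Q (exp _)); apply Rmult_le_compat_l; [exact HQ0|].
  apply Rmult_le_compat; [lra| |exact HE|].
  - apply Rmult_le_pos; [lra|apply Rmult_le_pos; lra].
  - apply Rmult_le_compat; [lra|apply Rmult_le_pos; lra|lra|].
    rewrite <- (Rmult_1_l (3 / t)); apply Rmult_le_compat; lra. }
assert (R3 : Cmod (A - csum (spt_quot q) N) <= T).
{ apply Rnot_lt_le; intro H.
  destruct (HA ((Cmod (A - csum (spt_quot q) N) - T) / 2) ltac:(lra)) as [M HM].
  specialize (HM (N + M)%nat ltac:(lia)); specialize (R2 M).
  pose proof (Cmod_triangle (csum (spt_quot q) (N + M) - csum (spt_quot q) N) (- (csum (spt_quot q) (N + M) - A))) as TT.
  rewrite Cmod_opp in TT.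
  replace (csum (spt_quot q) (N + M) - csum (spt_quot q) N + - (csum (spt_quot q) (N + M) - A))%C
    with (A - csum (spt_quot q) N)%C in TT by ring.
  lra. }
assert (R4 : Cmod (z * A - 1) <= 2 * Q + t * T).
{ replace (z * A - 1)%C with (z * (A - csum (spt_quot q) N) + - (1 - z * csum (spt_quot q) N))%C by ring.
  eapply Rle_trans; [apply Cmod_triangle|]; rewrite Cmod_opp, Cmod_mult; fold t.
  assert (t * Cmod (A - csum (spt_quot q) N) <= t * T) by (apply Rmult_le_compat_l; lra); lra. }
eapply Rle_trans; [exact R4|]; unfold T.
assert (Hit : 1 <= / t) by (rewrite <- Rinv_1; apply Rinv_le_contravar; lra).
assert (Hexp : 1 <= exp (169 / 300 * / t)) by (rewrite <- exp_0; apply exp_le; lra).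
rewrite exp_plus.
apply Rle_trans with (Q * ((2 + 9 * exp 1) * / t * exp (169 / 300 * / t))).
{ replace (2 * Q + t * (Q * (exp 1 * exp (169 / 300 * / t)) * (9 / t ^ 2)))
    with (Q * (2 + 9 * exp 1 * / t * exp (169 / 300 * / t))) by (field; lra).
  apply Rmult_le_compat_l; [exact HQ0|].
  assert (1 <= / t * exp (169 / 300 * / t)) by nra; nra. }
apply Rle_trans with (exp 1 * exp 1 * / t * exp (- / t) * ((2 + 9 * exp 1) * / t * exp (169 / 300 * / t))).
{ apply Rmult_le_compat_r; [repeat apply Rmult_le_pos; lra|exact HQ]. }
specialize (HK2 (/ t) ltac:(lra)).
replace (- (2 / 5) / t) with (11 / 300 * / t + (- / t + 169 / 300 * / t)) by (field; lra).
rewrite !exp_plus.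
pose proof (exp_pos (- / t)); pose proof (exp_pos (169 / 300 * / t)).
replace (exp 1 * exp 1 * / t * exp (- / t) * ((2 + 9 * exp 1) * / t * exp (169 / 300 * / t)))
  with (exp 1 * exp 1 * (2 + 9 * exp 1) * exp (- / t) * exp (169 / 300 * / t) * (/ t) ^ 2) by (simpl; ring).
replace (exp 1 * exp 1 * (2 + 9 * exp 1) * K * (exp (11 / 300 * / t) * (exp (- / t) * exp (169 / 300 * / t))))
  with (exp 1 * exp 1 * (2 + 9 * exp 1) * exp (- / t) * exp (169 / 300 * / t) * (K * exp (11 / 300 * / t))) by ring.
apply Rmult_le_compat_l; [repeat apply Rmult_le_pos; lra|exact HK2].
Qed.

(** * Gaussian integrals *)

Ltac continuity_2d :=
  repeat first
  [ apply continuity_2d_pt_const | apply continuity_2d_pt_id1 | apply continuity_2d_pt_id2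
  | apply continuity_2d_pt_plus | apply continuity_2d_pt_minus | apply continuity_2d_pt_mult
  | apply continuity_2d_pt_opp
  | apply (continuity_1d_2d_pt_comp exp); [apply derivable_continuous_pt, derivable_pt_exp|]
  | apply (continuity_1d_2d_pt_comp cos); [apply derivable_continuous_pt, derivable_pt_cos|]
  | apply (continuity_1d_2d_pt_comp sin); [apply derivable_continuous_pt, derivable_pt_sin|] ].

Ltac eq_in_R := match goal with |- @eq _ ?a ?b => change (@eq R a b) end.

Lemma ex_RInt_derivable (f : R -> R) (a b : R) : (forall x, ex_derive f x) -> ex_RInt f a b.
Proof.
intro H; apply (ex_RInt_continuous (V := R_CompleteNormedModule)); intros x _.
apply (ex_derive_continuous (V := R_NormedModule)), H.
Qed.

Definition gauss_int (y : R) : R := RInt (fun v => exp (- (v * v))) 0 y.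

Lemma is_derive_gauss_int (y : R) : is_derive gauss_int y (exp (- (y * y))).
Proof.
apply (is_derive_RInt (V := R_NormedModule) (fun v => exp (- (v * v))) gauss_int 0).
- apply filter_forall; intro x; apply (RInt_correct (V := R_CompleteNormedModule)), ex_RInt_derivable.
  intro; auto_derive; exact I.
- apply (ex_derive_continuous (V := R_NormedModule)); auto_derive; exact I.
Qed.

(** Auxiliary integral of the classical evaluation: its derivative cancels that of the square of
    [gauss_int], which avoids a double integral. *)
Definition gauss_aux (y : R) : R :=
  RInt (fun u => exp (- (y * y * (1 + u * u))) / (1 + u * u)) 0 1.

Lemma is_derive_gauss_aux (y : R) :
  is_derive gauss_aux y (- (2 * (gauss_int y * exp (- (y * y))))).
Proof.
assert (D : forall y u, is_derive (fun y => exp (- (y * y * (1 + u * u))) / (1 + u * u)) y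
   (- (2 * y) * exp (- (y * y * (1 + u * u))))).
{ intros y' u; assert (0 < 1 + u * u) by nra; auto_derive; [lra|field; lra]. }
evar_last.
- apply is_derive_RInt_param.
  + apply filter_forall; intros x u _; eexists; apply D.
  + intros u _.
    apply continuity_2d_pt_ext with (fun y u => - (2 * y) * exp (- (y * y * (1 + u * u)))).
    * intros a b; symmetry; apply is_derive_unique, D.
    * continuity_2d.
  + apply filter_forall; intros x; apply ex_RInt_derivable; intro u.
    assert (0 < 1 + u * u) by nra; auto_derive; lra.
(* Substitution v = y u, written in the affine form y u + 0 that [RInt_comp_lin] expects. *)
- transitivity (RInt (fun u => - (2 * exp (- (y * y))) * (y * exp (- ((y * u + 0) * (y * u + 0))))) 0 1).
  + apply RInt_ext; intros u _; etransitivity; [apply (is_derive_unique _ _ _ (D y u))|].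
    replace (- (y * y * (1 + u * u))) with (- (y * y) + - ((y * u + 0) * (y * u + 0))) by ring.
    rewrite exp_plus; eq_in_R; ring.
  + rewrite (RInt_scal (V := R_CompleteNormedModule) (fun u => y * exp (- ((y * u + 0) * (y * u + 0))))).
    * pose proof (RInt_comp_lin (V := R_CompleteNormedModule) (fun v => exp (- (v * v))) y 0 0 1
        ltac:(apply ex_RInt_derivable; intro; auto_derive; exact I)) as K.
      etransitivity; [apply f_equal, K|].
      replace (y * 0 + 0) with 0 by ring; replace (y * 1 + 0) with y by ring.
      unfold scal; simpl; unfold mult; simpl; fold (gauss_int y); ring.
    * apply ex_RInt_derivable; intro; auto_derive; exact I.
Qed.

(** The left side has derivative 0, and at 0 it is the integral of 1/(1 + u^2) over [0, 1]. *)
Lemma gauss_int_aux (y : R) : 0 <= y -> gauss_int y ^ 2 + gauss_aux y = PI / 4.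
Proof.
intro Hy.
assert (H0 : gauss_int 0 ^ 2 + gauss_aux 0 = PI / 4).
{ unfold gauss_int; rewrite RInt_point; unfold zero; simpl.
  assert (E : gauss_aux 0 = minus (atan 1) (atan 0)).
  { unfold gauss_aux; apply is_RInt_unique, (is_RInt_ext (fun u => / (1 + u * u))).
    - intros u _; replace (- (0 * 0 * (1 + u * u))) with 0 by ring.
      rewrite exp_0; unfold Rdiv; eq_in_R; ring.
    - apply (is_RInt_derive (V := R_CompleteNormedModule) atan).
      + intros u _; assert (0 < 1 + u * u) by nra; auto_derive; [exact I|]; field; lra.
      + intros u _; assert (0 < 1 + u * u) by nra.
        apply (ex_derive_continuous (V := R_NormedModule)); auto_derive; lra. }
  rewrite E, atan_1, atan_0; unfold minus, plus, opp; simpl; ring. }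
rewrite <- H0.
assert (D : forall x, is_derive (fun y => gauss_int y ^ 2 + gauss_aux y) x 0).
{ intro x; evar_last.
  - apply (is_derive_plus (V := R_NormedModule) (fun y => gauss_int y ^ 2) gauss_aux); [apply (is_derive_pow gauss_int 2), is_derive_gauss_int|apply is_derive_gauss_aux].
  - unfold plus; simpl; ring. }
destruct (Req_dec y 0) as [->|Hn]; [reflexivity|].
destruct (MVT_gen (fun y => gauss_int y ^ 2 + gauss_aux y) 0 y (fun _ => 0)) as [c [_ Hc]].
- intros x _; apply D.
- intros x _; apply continuity_pt_filterlim.
  apply (ex_derive_continuous (V := R_NormedModule) (fun y => gauss_int y ^ 2 + gauss_aux y)); eexists; apply D.
- cbv beta in Hc; lra.
Qed.

(** Factor pi/4 - G^2 as a difference of squares: the factor sqrt(pi)/2 + G is at least 1/2, and the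
    auxiliary integral is at most e^(-y^2). *)
Lemma gauss_int_bounds (y : R) : 0 <= y ->
  0 <= sqrt PI / 2 - gauss_int y <= 2 * exp (- (y * y)).
Proof.
intro Hy; pose proof (gauss_int_aux y Hy) as H.
assert (G0 : 0 <= gauss_int y).
{ apply RInt_ge_0; [exact Hy|apply ex_RInt_derivable; intro; auto_derive; exact I|].
  intros; left; apply exp_pos. }
assert (A : 0 <= gauss_aux y <= exp (- (y * y))).
{ assert (EX : ex_RInt (fun u => exp (- (y * y * (1 + u * u))) / (1 + u * u)) 0 1).
  { apply ex_RInt_derivable; intro u; assert (0 < 1 + u * u) by nra; auto_derive; lra. }
  split.
  - apply RInt_ge_0; [lra|exact EX|]; intros u _; assert (0 < 1 + u * u) by nra.
    left; apply Rdiv_lt_0_compat; [apply exp_pos|assumption].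
  - replace (exp (- (y * y))) with (RInt (fun _ => exp (- (y * y))) 0 1)
      by (rewrite RInt_const; unfold scal; simpl; unfold mult; simpl; ring).
    apply RInt_le; [lra|exact EX|apply ex_RInt_derivable; intro; auto_derive; exact I|].
    intros u _; assert (0 < 1 + u * u) by nra.
    apply Rle_trans with (exp (- (y * y * (1 + u * u)))).
    + rewrite <- (Rmult_1_r (exp _)) at 2; apply Rmult_le_compat_l; [left; apply exp_pos|].
      rewrite <- Rinv_1; apply Rinv_le_contravar; nra.
    + apply exp_le; assert (0 <= (y * y) * (u * u)) by (apply Rmult_le_pos; nra); lra. }
assert (S : sqrt PI * sqrt PI = PI) by (apply sqrt_sqrt; left; apply PI_RGT_0).
assert (S1 : 1 <= sqrt PI) by (rewrite <- sqrt_1; apply sqrt_le_1_alt; pose proof PI2_1; lra).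
set (s := sqrt PI) in *.
assert (F : (s / 2 - gauss_int y) * (s / 2 + gauss_int y) = gauss_aux y) by (simpl in H; nra).
split; nra.
Qed.

Lemma RInt_half_gauss (X : R) : 0 < X ->
  RInt (fun x => exp (- (x * x) / 2)) (- X) X = 2 * sqrt 2 * gauss_int (X / sqrt 2).
Proof.
intro HX.
assert (E : forall x, ex_derive (fun x => exp (- (x * x) / 2)) x) by (intro; auto_derive; exact I).
assert (s0 : 0 < sqrt 2) by (apply sqrt_lt_R0; lra).
assert (ss : sqrt 2 * sqrt 2 = 2) by (apply sqrt_sqrt; lra).
assert (P : RInt (fun x => exp (- (x * x) / 2)) 0 X = sqrt 2 * gauss_int (X / sqrt 2)).
{ unfold gauss_int.
  pose proof (RInt_comp_lin (V := R_CompleteNormedModule) (fun v => exp (- (v * v))) (/ sqrt 2) 0 0 X) as K.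
  replace (/ sqrt 2 * 0 + 0) with 0 in K by ring; replace (/ sqrt 2 * X + 0) with (X / sqrt 2) in K by (field; lra).
  specialize (K ltac:(apply ex_RInt_derivable; intro; auto_derive; exact I)).
  rewrite (RInt_scal (V := R_CompleteNormedModule) (fun u => exp (- ((/ sqrt 2 * u + 0) * (/ sqrt 2 * u + 0))))) in K
    by (apply ex_RInt_derivable; intro; auto_derive; exact I).
  rewrite <- K.
  unfold scal; simpl; unfold mult; simpl; rewrite <- Rmult_assoc, Rinv_r, Rmult_1_l by lra.
  apply RInt_ext; intros u _; f_equal.
  replace ((/ sqrt 2 * u + 0) * (/ sqrt 2 * u + 0)) with (u * u / (sqrt 2 * sqrt 2)) by (field; lra).
  rewrite ss; field. }
rewrite <- (RInt_Chasles (V := R_CompleteNormedModule) _ (- X) 0 X) by (apply ex_RInt_derivable, E).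
assert (N : RInt (fun x => exp (- (x * x) / 2)) (- X) 0 = RInt (fun x => exp (- (x * x) / 2)) 0 X).
{ pose proof (RInt_comp_lin (V := R_CompleteNormedModule) (fun x => exp (- (x * x) / 2)) (-1) 0 X 0) as K.
  replace (-1 * X + 0) with (- X) in K by ring; replace (-1 * 0 + 0) with 0 in K by ring.
  rewrite <- K by (apply ex_RInt_derivable, E).
  rewrite <- (opp_RInt_swap (V := R_CompleteNormedModule) _ 0 X)
    by (apply ex_RInt_derivable; intro; unfold scal; simpl; unfold mult; simpl; auto_derive; exact I).
  rewrite <- (RInt_opp (V := R_CompleteNormedModule))
    by (apply ex_RInt_derivable; intro; unfold scal; simpl; unfold mult; simpl; auto_derive; exact I).
  apply RInt_ext; intros u _; unfold opp, scal; simpl; unfold mult; simpl.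
  replace (- ((-1 * u + 0) * (-1 * u + 0)) / 2) with (- (u * u) / 2) by field; ring. }
unfold plus; simpl; rewrite N, P; ring.
Qed.

(* Deforming an integrand [u 0] into [u 1] costs only boundary terms when the
   [s]-derivative of [u] is an [x]-derivative. *)
Lemma RInt_homotopy (u w us : R -> R -> R) (X M : R) :
  (forall s x, is_derive (fun s => u s x) s (us s x)) ->
  (forall s x, is_derive (fun x => w s x) x (us s x)) ->
  (forall s x, continuity_2d_pt us s x) ->
  (forall s x, ex_derive (fun x => u s x) x) ->
  (forall s, 0 <= s <= 1 -> Rabs (w s X - w s (- X)) <= M) ->
  Rabs (RInt (u 1) (- X) X - RInt (u 0) (- X) X) <= M.
Proof.
intros Hu Hw Hc Hx HM.
assert (D : forall s, is_derive (fun s => RInt (fun x => u s x) (- X) X) s (w s X - w s (- X))).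
{ intro s; evar_last.
  - apply is_derive_RInt_param.
    + apply filter_forall; intros y x _; eexists; apply Hu.
    + intros x _; apply continuity_2d_pt_ext with us; [|apply Hc].
      intros a b; symmetry; apply is_derive_unique, Hu.
    + apply filter_forall; intro y; apply ex_RInt_derivable, Hx.
  - transitivity (RInt (us s) (- X) X).
    + apply RInt_ext; intros x _; apply is_derive_unique, Hu.
    + apply is_RInt_unique, (is_RInt_derive (V := R_CompleteNormedModule) (fun x => w s x)).
      * intros x _; apply Hw.
      * intros x _; apply continuity_pt_filterlim.
        specialize (Hc s x); intros eps He; destruct (Hc (mkposreal _ He)) as [d Hd].
        exists d; split; [apply cond_pos|]; intros y [_ Hy].
        apply (Hd s y); [rewrite Rminus_diag, Rabs_R0; apply cond_pos|exact Hy]. }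
destruct (MVT_gen (fun s => RInt (fun x => u s x) (- X) X) 0 1 (fun s => w s X - w s (- X))) as [c [Hc1 Hc2]].
- intros s _; apply D.
- intros s _; apply continuity_pt_filterlim.
  apply (ex_derive_continuous (V := R_NormedModule) (fun s => RInt (fun x => u s x) (- X) X)); eexists; apply D.
- rewrite Rmin_left, Rmax_right in Hc1 by lra.
  assert (Hc3 : RInt (u 1) (- X) X - RInt (u 0) (- X) X = (w c X - w c (- X)) * (1 - 0)) by exact Hc2.
  rewrite Hc3, Rminus_0_r, Rmult_1_r; apply HM, Hc1.
Qed.

(** With a = p + iq and beta = b + ic, this is the real part of zeta_x exp(-zeta^2/2), where zeta =
    (1 + s(a - 1)) x + s beta moves linearly from x to a x + beta. At s = 0 it is the standard
    Gaussian, at s = 1 the complex one that is wanted. *)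
Definition gauss_re (p q b c s x : R) : R :=
  let P := 1 + s * (p - 1) in let Q := s * q in
  let X := P * x + s * b in let Y := Q * x + s * c in
  exp (- (X * X - Y * Y) / 2) * (P * cos (X * Y) + Q * sin (X * Y)).

Definition gauss_im (p q b c s x : R) : R :=
  let P := 1 + s * (p - 1) in let Q := s * q in
  let X := P * x + s * b in let Y := Q * x + s * c in
  exp (- (X * X - Y * Y) / 2) * (Q * cos (X * Y) - P * sin (X * Y)).

(** Real part of zeta_s exp(-zeta^2/2). Its x-derivative equals the s-derivative of zeta_x
    exp(-zeta^2/2), both being the mixed derivative of a primitive of exp(-zeta^2/2) taken at zeta;
    [gauss_d_re] is the real part of this common value. *)
Definition gauss_bd_re (p q b c s x : R) : R :=
  let X := (1 + s * (p - 1)) * x + s * b in let Y := s * q * x + s * c in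
  exp (- (X * X - Y * Y) / 2) * (((p - 1) * x + b) * cos (X * Y) + (q * x + c) * sin (X * Y)).

Definition gauss_bd_im (p q b c s x : R) : R :=
  let X := (1 + s * (p - 1)) * x + s * b in let Y := s * q * x + s * c in
  exp (- (X * X - Y * Y) / 2) * ((q * x + c) * cos (X * Y) - ((p - 1) * x + b) * sin (X * Y)).

Definition gauss_d_re (p q b c s x : R) : R :=
  let P := 1 + s * (p - 1) in let Q := s * q in
  let X := P * x + s * b in let Y := Q * x + s * c in
  let A := (p - 1) * x + b in let B := q * x + c in
  exp (- (X * X - Y * Y) / 2) * (- (X * P - Y * Q) * (A * cos (X * Y) + B * sin (X * Y))
    + (p - 1) * cos (X * Y) + q * sin (X * Y) + (P * Y + X * Q) * (B * cos (X * Y) - A * sin (X * Y))).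

Definition gauss_d_im (p q b c s x : R) : R :=
  let P := 1 + s * (p - 1) in let Q := s * q in
  let X := P * x + s * b in let Y := Q * x + s * c in
  let A := (p - 1) * x + b in let B := q * x + c in
  exp (- (X * X - Y * Y) / 2) * (- (X * P - Y * Q) * (B * cos (X * Y) - A * sin (X * Y))
    + q * cos (X * Y) - (p - 1) * sin (X * Y) - (P * Y + X * Q) * (A * cos (X * Y) + B * sin (X * Y))).

(** The condition |q| < p keeps the Gaussian decaying during the whole deformation: Re zeta^2 is at
    least (m X - K)^2 for all s in [0, 1], whereas the prefactor grows only linearly. *)
Lemma gauss_bd_le (p q b c : R) : Rabs q < p -> forall eps, 0 < eps -> exists X0, 0 < X0 /\
  forall X s x, X0 <= X -> 0 <= s <= 1 -> Rabs x = X ->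
    Rabs (gauss_bd_re p q b c s x) <= eps /\ Rabs (gauss_bd_im p q b c s x) <= eps.
Proof.
intros Hq eps He.
(* The coefficient 1 + s(p - 1) - s|q| interpolates between 1 and p - |q|, so the smaller of the two
   is a lower bound for every s. *)
set (m := Rmin 1 (p - Rabs q)).
assert (Hm : 0 < m /\ m <= 1 /\ m <= p - Rabs q)
  by (unfold m, Rmin; destruct (Rle_dec 1 (p - Rabs q)); lra).
set (K := Rabs b + Rabs c); set (L := Rabs (p - 1) + Rabs q).
assert (HK : 0 <= K) by (unfold K; pose proof (Rabs_pos b); pose proof (Rabs_pos c); lra).
assert (HL : 0 <= L) by (unfold L; pose proof (Rabs_pos (p - 1)); pose proof (Rabs_pos q); lra).
set (D := L / m + L / m * K + K).
assert (HD : 0 <= D).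
{ unfold D; assert (0 <= L / m) by (apply Rmult_le_pos; [lra|left; apply Rinv_0_lt_compat; lra]); nra. }
exists ((K + 1 + 2 * D / eps) / m).
assert (HDe : 0 <= 2 * D / eps) by (apply Rmult_le_pos; [lra|left; apply Rinv_0_lt_compat, He]).
split; [apply Rdiv_lt_0_compat; lra|].
intros X s x HX Hs Hx.
set (Z := m * X - K).
assert (HZ : 1 + 2 * D / eps <= Z).
{ unfold Z; apply (Rmult_le_compat_l m) in HX; [|lra].
  replace (m * ((K + 1 + 2 * D / eps) / m)) with (K + 1 + 2 * D / eps) in HX by (field; lra); lra. }
assert (X0 : 0 <= X) by (rewrite <- Hx; apply Rabs_pos).
assert (AB : Rabs ((p - 1) * x + b) + Rabs (q * x + c) <= D * Z).
{ apply Rle_trans with (L * X + K).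
  - pose proof (Rabs_triang ((p - 1) * x) b); pose proof (Rabs_triang (q * x) c).
    rewrite Rabs_mult, Hx in H; rewrite Rabs_mult, Hx in H0; unfold L, K; lra.
  - replace (L * X) with (L / m * (Z + K)) by (unfold Z; field; lra).
    assert (0 <= L / m) by (apply Rmult_le_pos; [lra|left; apply Rinv_0_lt_compat; lra]).
    unfold D; assert (L / m * K <= L / m * K * Z) by (rewrite <- (Rmult_1_r (L / m * K)) at 1; apply Rmult_le_compat_l; [nra|lra]).
    assert (K <= K * Z) by (rewrite <- (Rmult_1_r K) at 1; apply Rmult_le_compat_l; lra).
    lra. }
set (U := (1 + s * (p - 1)) * x + s * b) in *; set (V := s * q * x + s * c) in *.
assert (UV : Z * Z <= U * U - V * V).
{ assert (T : Z + Rabs V <= Rabs U).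
  { unfold U, V.
    pose proof (Rabs_triang_inv ((1 + s * (p - 1)) * x) (- (s * b))) as T1.
    pose proof (Rabs_triang (s * q * x) (s * c)) as T2.
    rewrite Rabs_Ropp in T1.
    replace ((1 + s * (p - 1)) * x - - (s * b)) with ((1 + s * (p - 1)) * x + s * b) in T1 by ring.
    rewrite !Rabs_mult, Hx, (Rabs_right s) in T2 by lra.
    rewrite (Rabs_mult _ x), Hx, (Rabs_mult s b), (Rabs_right s) in T1 by lra.
    pose proof (Rabs_pos q).
    rewrite (Rabs_right (1 + s * (p - 1))) in T1 by nra.
    pose proof (Rabs_pos b); pose proof (Rabs_pos c).
    assert (s * Rabs b + s * Rabs c <= K) by (unfold K; nra).
    assert (m * X <= (1 + s * (p - 1) - s * Rabs q) * X) by (apply Rmult_le_compat_r; nra).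
    unfold Z; lra. }
  pose proof (Rabs_pos V).
  assert (Z * Z <= Rabs U * Rabs U - Rabs V * Rabs V) by nra.
  rewrite <- !Rabs_mult, (Rabs_right (U * U)), (Rabs_right (V * V)) in H0 by nra; exact H0. }
assert (E : exp (- (U * U - V * V) / 2) * (D * Z) <= eps).
{ apply Rle_trans with (exp (- (Z * Z / 2)) * (D * Z)).
  - apply Rmult_le_compat_r; [apply Rmult_le_pos; lra|apply exp_le; lra].
  - apply Rle_trans with (/ (Z * Z / 2) * (D * Z)).
    + apply Rmult_le_compat_r; [apply Rmult_le_pos; lra|].
      eapply Rle_trans; [apply exp_neg_le_inv; nra|]; apply Rinv_le_contravar; nra.
    + replace (/ (Z * Z / 2) * (D * Z)) with (2 * D / Z) by (field; lra).
      apply Rmult_le_reg_r with Z; [lra|]; unfold Rdiv; rewrite Rmult_assoc, Rinv_l, Rmult_1_r by lra.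
      apply (Rmult_le_compat_l eps) in HZ; [|lra].
      replace (eps * (1 + 2 * D / eps)) with (eps + 2 * D) in HZ by (field; lra); lra. }
assert (G : forall A B C S, Rabs C <= 1 -> Rabs S <= 1 -> Rabs A + Rabs B <= D * Z ->
  Rabs (exp (- (U * U - V * V) / 2) * (A * C + B * S)) <= eps).
{ intros A B C S HC HS HAB; rewrite Rabs_mult, (Rabs_right (exp _)) by (left; apply exp_pos).
  eapply Rle_trans; [|exact E]; apply Rmult_le_compat_l; [left; apply exp_pos|].
  eapply Rle_trans; [apply Rabs_triang|]; rewrite !Rabs_mult.
  pose proof (Rabs_pos A); pose proof (Rabs_pos B); nra. }
assert (HC : Rabs (cos (U * V)) <= 1) by (apply Rabs_le, COS_bound).
assert (HS : Rabs (sin (U * V)) <= 1) by (apply Rabs_le, SIN_bound).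
split.
- apply (G ((p - 1) * x + b) (q * x + c)); assumption.
- unfold gauss_bd_im; fold U; fold V.
  replace ((q * x + c) * cos (U * V) - ((p - 1) * x + b) * sin (U * V))
    with ((q * x + c) * cos (U * V) + ((p - 1) * x + b) * - sin (U * V)) by ring.
  apply G; [exact HC|rewrite Rabs_Ropp; exact HS|lra].
Qed.

(** Deforming to s = 0 replaces the usual shift and rotation of the contour: the boundary terms
    vanish as X grows and the standard Gaussian remains. *)
Lemma complex_gauss (p q b c : R) : Rabs q < p -> forall eps, 0 < eps -> exists X0, 0 < X0 /\
  forall X, X0 <= X ->
    Rabs (RInt (gauss_re p q b c 1) (- X) X - sqrt (2 * PI)) <= eps /\
    Rabs (RInt (gauss_im p q b c 1) (- X) X) <= eps.
Proof.
intros Hq eps He.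
destruct (gauss_bd_le p q b c Hq (eps / 4) ltac:(lra)) as [X1 [HX1 HB]].
(* Makes X / sqrt 2 at least 1 + 16/eps, so that its Gaussian is at most eps/16 and the missing
   tails cost at most eps/2. *)
set (X2 := sqrt 2 * (1 + 16 / eps)).
assert (s0 : 0 < sqrt 2) by (apply sqrt_lt_R0; lra).
assert (ie : 0 < / eps) by (apply Rinv_0_lt_compat, He).
assert (HX2 : 0 < X2) by (unfold X2; apply Rmult_lt_0_compat; lra).
exists (Rmax X1 X2); split; [apply Rlt_le_trans with X1; [exact HX1|apply Rmax_l]|].
intros X HX.
assert (HXX1 : X1 <= X) by (eapply Rle_trans; [apply Rmax_l|exact HX]).
assert (HXX2 : X2 <= X) by (eapply Rle_trans; [apply Rmax_r|exact HX]).
assert (A1 : Rabs X = X) by (apply Rabs_right; lra).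
assert (A2 : Rabs (- X) = X) by (rewrite Rabs_Ropp; exact A1).
assert (Hre : Rabs (RInt (gauss_re p q b c 1) (- X) X - RInt (gauss_re p q b c 0) (- X) X) <= eps / 2).
{ apply RInt_homotopy with (gauss_bd_re p q b c) (gauss_d_re p q b c).
  - intros s x; unfold gauss_re, gauss_d_re; auto_derive; [exact I|unfold Rdiv, Rminus; field].
  - intros s x; unfold gauss_bd_re, gauss_d_re; auto_derive; [exact I|unfold Rdiv, Rminus; field].
  - intros s x; unfold gauss_d_re, Rdiv; continuity_2d.
  - intros s x; unfold gauss_re; auto_derive; exact I.
  - intros s Hs; destruct (HB X s X HXX1 Hs A1) as [H1 _], (HB X s (- X) HXX1 Hs A2) as [H2 _].
    unfold Rminus; eapply Rle_trans; [apply Rabs_triang|]; rewrite Rabs_Ropp; lra. }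
assert (Him : Rabs (RInt (gauss_im p q b c 1) (- X) X - RInt (gauss_im p q b c 0) (- X) X) <= eps / 2).
{ apply RInt_homotopy with (gauss_bd_im p q b c) (gauss_d_im p q b c).
  - intros s x; unfold gauss_im, gauss_d_im; auto_derive; [exact I|unfold Rdiv, Rminus; field].
  - intros s x; unfold gauss_bd_im, gauss_d_im; auto_derive; [exact I|unfold Rdiv, Rminus; field].
  - intros s x; unfold gauss_d_im, Rdiv; continuity_2d.
  - intros s x; unfold gauss_im; auto_derive; exact I.
  - intros s Hs; destruct (HB X s X HXX1 Hs A1) as [_ H1], (HB X s (- X) HXX1 Hs A2) as [_ H2].
    unfold Rminus; eapply Rle_trans; [apply Rabs_triang|]; rewrite Rabs_Ropp; lra. }
assert (E0 : RInt (gauss_im p q b c 0) (- X) X = 0).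
{ rewrite (RInt_ext _ (fun _ => 0)); [rewrite RInt_const; unfold scal; simpl; unfold mult; simpl; ring|].
  intros x _; unfold gauss_im; cbv zeta.
  replace ((0 * q * x + 0 * c)) with 0 by ring; cbv zeta; rewrite !Rmult_0_r, sin_0, cos_0; eq_in_R; ring. }
assert (E1 : RInt (gauss_re p q b c 0) (- X) X = 2 * sqrt 2 * gauss_int (X / sqrt 2)).
{ rewrite <- RInt_half_gauss by lra; apply RInt_ext; intros x _; unfold gauss_re; cbv zeta.
  replace ((0 * q * x + 0 * c)) with 0 by ring; rewrite !Rmult_0_r, sin_0, cos_0; eq_in_R.
  replace ((1 + 0 * (p - 1)) * x + 0 * b) with x by ring.
  rewrite Rminus_0_r; ring. }
rewrite E0, Rminus_0_r in Him; rewrite E1 in Hre.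
split; [|lra].
set (Y := X / sqrt 2) in *.
assert (HY : 1 + 16 / eps <= Y).
{ unfold Y; apply Rmult_le_reg_r with (sqrt 2); [lra|].
  unfold Rdiv at 2; rewrite Rmult_assoc, Rinv_l, Rmult_1_r by lra; unfold X2 in HXX2; lra. }
destruct (gauss_int_bounds Y ltac:(unfold Rdiv in HY; lra)) as [B1 B2].
assert (B3 : exp (- (Y * Y)) <= eps / 16).
{ eapply Rle_trans; [apply exp_neg_le_inv; nra|].
  replace (eps / 16) with (/ (16 / eps)) by (field; lra).
  apply Rinv_le_contravar; [unfold Rdiv; lra|]. unfold Rdiv in *; nra. }
rewrite sqrt_mult in * by (try lra; left; apply PI_RGT_0).
assert (s2 : sqrt 2 <= 2).
{ rewrite <- (sqrt_square 2) at 2 by lra; apply sqrt_le_1_alt; lra. }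
replace (RInt (gauss_re p q b c 1) (- X) X - sqrt 2 * sqrt PI)
  with ((RInt (gauss_re p q b c 1) (- X) X - 2 * sqrt 2 * gauss_int Y) + - (2 * sqrt 2 * (sqrt PI / 2 - gauss_int Y))) by field.
eapply Rle_trans; [apply Rabs_triang|]; rewrite Rabs_Ropp, (Rabs_right (2 * _ * _)); [nra|].
apply Rle_ge, Rmult_le_pos; lra.
Qed.

(** * The pentagonal number theorem *)

Fixpoint tri (n : nat) : nat := match n with O => O | S m => (tri m + S m)%nat end.

Fixpoint qprod_from (q : C) (s k : nat) : C :=
  match k with O => 1 | S m => qprod_from q s m * (1 - q ^ (s + S m)) end%C.

(** The summand (-1)^s (q)_n/(q)_s q^(sn + s(s+1)/2) of Shanks's finite form of the pentagonal
    number theorem; the quotient is written as a product to stay free of divisions. *)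
Definition shanks_term (q : C) (n s : nat) : C :=
  ((-1) ^ s * qprod_from q s (n - s) * q ^ (s * n + tri s))%C.

(** The exponents are the generalized pentagonal numbers k(3k - 1)/2 and k(3k + 1)/2 for k = m + 1,
    split into a square and a triangular number to avoid division in [nat]. *)
Fixpoint pent_sum (q : C) (n : nat) : C :=
  match n with
  | O => 1
  | S m => pent_sum q m + (-1) ^ S m * (q ^ (S m * S m + tri m) + q ^ (S m * S m + tri (S m)))
  end%C.

Lemma qprod_from_Sl (q : C) (s k : nat) :
  qprod_from q s (S k) = ((1 - q ^ S s) * qprod_from q (S s) k)%C.
Proof.
induction k as [|k IH].
- simpl; replace (s + 1)%nat with (S s) by lia; simpl; ring.
- change (qprod_from q s (S k) * (1 - q ^ (s + S (S k))) =
    (1 - q ^ S s) * (qprod_from q (S s) k * (1 - q ^ (S s + S k))))%C.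
  rewrite IH; replace (s + S (S k))%nat with (S s + S k)%nat by lia; ring.
Qed.

Lemma csum_minus (f g : nat -> C) (n : nat) :
  csum (fun i => f i - g i)%C n = (csum f n - csum g n)%C.
Proof. induction n as [|n IH]; simpl; [ring|rewrite IH; ring]. Qed.

(** Passing from n to n + 1 changes the sum over s <= k by a single product, so the differences
    telescope. At k = n this product is one of the two new pentagonal terms, and the added summand s
    = n + 1 is the other. *)
Lemma shanks_telescope (q : C) (n k : nat) : (k <= n)%nat ->
  csum (fun s => shanks_term q (S n) s - shanks_term q n s)%C (S k) =
  ((-1) ^ S k * qprod_from q k (n - k) * q ^ (S k * S n + tri k))%C.
Proof.
assert (ST : forall k, (k <= n)%nat -> (shanks_term q (S n) k - shanks_term q n k)%C =
  ((-1) ^ k * qprod_from q k (n - k) * q ^ (k * n + tri k) * (q ^ k * (1 - q ^ S n) - 1))%C).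
{ intros j Hj; unfold shanks_term; replace (S n - j)%nat with (S (n - j)) by lia.
  change (qprod_from q j (S (n - j))) with (qprod_from q j (n - j) * (1 - q ^ (j + S (n - j))))%C.
  replace (j + S (n - j))%nat with (S n) by lia.
  replace (j * S n + tri j)%nat with (j + (j * n + tri j))%nat by lia; rewrite (Cpow_add_r q j); ring. }
induction k as [|k IH]; intro Hk.
- simpl csum; rewrite (ST 0%nat) by lia.
  replace (1 * S n + tri 0)%nat with (S n) by (simpl; lia).
  replace (0 * n + tri 0)%nat with 0%nat by (simpl; lia).
  simpl Cpow; ring.
- change (csum (fun s => shanks_term q (S n) s - shanks_term q n s)%C (S (S k)))
    with (csum (fun s => shanks_term q (S n) s - shanks_term q n s)%C (S k)
      + (shanks_term q (S n) (S k) - shanks_term q n (S k)))%C.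
  rewrite IH, ST by lia.
  replace (n - k)%nat with (S (n - S k)) by lia; rewrite qprod_from_Sl.
  replace (S k * S n + tri k)%nat with (S k + (S k * n + tri k))%nat by lia.
  change (tri (S k)) with (tri k + S k)%nat.
  replace (S (S k) * S n + (tri k + S k))%nat with (S n + S k + S k + (S k * n + tri k))%nat by lia.
  replace (S k * n + (tri k + S k))%nat with (S k + (S k * n + tri k))%nat by lia.
  rewrite !(Cpow_add_r q).
  rewrite (Cpow_S (-1) (S k)).
  set (a := (q ^ S k)%C); set (b := (q ^ S n)%C); ring.
Qed.

Lemma shanks (q : C) (n : nat) : csum (shanks_term q n) (S n) = pent_sum q n.
Proof.
induction n as [|n IH].
- simpl; unfold shanks_term; simpl; ring.
- pose proof (shanks_telescope q n n (le_n n)) as T.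
  rewrite csum_minus, IH, Nat.sub_diag in T.
  change (csum (shanks_term q (S n)) (S (S n)))
    with (csum (shanks_term q (S n)) (S n) + shanks_term q (S n) (S n))%C.
  replace (csum (shanks_term q (S n)) (S n))
    with (pent_sum q n + (csum (shanks_term q (S n)) (S n) - pent_sum q n))%C by ring.
  rewrite T; unfold shanks_term; rewrite Nat.sub_diag.
  cbn [pent_sum qprod_from]; ring.
Qed.

Lemma Cmod_qprod_from_le (q : C) (s k : nat) : Cmod q < 1 ->
  Cmod (qprod_from q s k) <= exp (/ (1 - Cmod q)).
Proof.
intro Hq; pose proof (Cmod_ge_0 q) as H0.
assert (H : Cmod (qprod_from q s k) <= exp ((1 - Cmod q ^ k) / (1 - Cmod q))).
{ induction k as [|k IH]; [simpl; rewrite Cmod_1; replace (_ / _) with 0 by (field; lra); rewrite exp_0; lra|].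
  change (qprod_from q s (S k)) with (qprod_from q s k * (1 - q ^ (s + S k)))%C; rewrite Cmod_mult.
  replace ((1 - Cmod q ^ S k) / (1 - Cmod q)) with ((1 - Cmod q ^ k) / (1 - Cmod q) + Cmod q ^ k) by (simpl; field; lra).
  rewrite exp_plus; apply Rmult_le_compat; try apply Cmod_ge_0; [exact IH|].
  eapply Rle_trans; [|apply exp_ineq].
  unfold Cminus; eapply Rle_trans; [apply Cmod_triangle|].
  rewrite Cmod_1, Cmod_opp, Cmod_pow.
  replace (s + S k)%nat with (k + S s)%nat by lia; rewrite pow_add.
  assert (0 <= Cmod q ^ S s <= 1) by (split; [apply pow_le, H0|rewrite <- (pow1 (S s)); apply pow_incr; lra]).
  assert (0 <= Cmod q ^ k) by apply pow_le, H0; nra. }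
eapply Rle_trans; [exact H|]; apply exp_le.
rewrite <- (Rmult_1_l (/ _)); unfold Rdiv; apply Rmult_le_compat_r; [left; apply Rinv_0_lt_compat; lra|].
assert (0 <= Cmod q ^ k) by apply pow_le, H0; lra.
Qed.

Lemma Cmod_csum_le (f : nat -> C) (B : R) (n : nat) :
  (forall i, (i < n)%nat -> Cmod (f i) <= B) -> Cmod (csum f n) <= INR n * B.
Proof.
intro H; induction n as [|n IH]; [simpl; rewrite Cmod_0; lra|].
rewrite S_INR; change (csum f (S n)) with (csum f n + f n)%C.
eapply Rle_trans; [apply Cmod_triangle|].
specialize (IH (fun i Hi => H i ltac:(lia))); specialize (H n ltac:(lia)); lra.
Qed.

Lemma csum_Sl (f : nat -> C) (n : nat) : csum f (S n) = (f O + csum (fun i => f (S i)) n)%C.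
Proof.
induction n as [|n IH]; [simpl; ring|].
change (csum f (S (S n))) with (csum f (S n) + f (S n))%C; rewrite IH; simpl; ring.
Qed.

Lemma qprod_from_0 (q : C) (n : nat) : qprod_from q 0 n = qpoch q n.
Proof. induction n as [|n IH]; simpl; [reflexivity|rewrite IH; reflexivity]. Qed.

(** In Shanks's identity the summand s = 0 is (q)_n itself; each of the n others carries q^(sn), of
    modulus at most |q|^n, times a uniformly bounded product. *)
Lemma pent_sum_qpoch (q : C) (n : nat) : Cmod q < 1 ->
  Cmod (pent_sum q n - qpoch q n) <= INR n * (exp (/ (1 - Cmod q)) * Cmod q ^ n).
Proof.
intro Hq; pose proof (Cmod_ge_0 q) as H0.
rewrite <- shanks, csum_Sl.
replace (shanks_term q n 0) with (qpoch q n).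
2:{ unfold shanks_term; rewrite Nat.sub_0_r, qprod_from_0; simpl; ring. }
replace (qpoch q n + csum (fun i => shanks_term q n (S i)) n - qpoch q n)%C
  with (csum (fun i => shanks_term q n (S i)) n) by ring.
apply Cmod_csum_le; intros i Hi; unfold shanks_term.
rewrite !Cmod_mult, !Cmod_pow.
replace (Cmod (-1)) with 1.
2:{ rewrite Cmod_R, Rabs_left by lra; ring. }
rewrite pow1, Rmult_1_l; apply Rmult_le_compat; [apply Cmod_ge_0|apply pow_le, H0|apply Cmod_qprod_from_le, Hq|].
replace (S i * n + tri (S i))%nat with (n + (i * n + tri (S i)))%nat by lia; rewrite pow_add.
rewrite <- (Rmult_1_r (Cmod q ^ n)) at 2; apply Rmult_le_compat_l; [apply pow_le, H0|].
rewrite <- (pow1 (i * n + tri (S i))); apply pow_incr; lra.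
Qed.

Lemma n_pow_lim (r : R) : 0 <= r < 1 -> forall eps, 0 < eps ->
  exists N, forall n, (N <= n)%nat -> INR n * r ^ n <= eps.
Proof.
intros Hr eps He.
destruct (Req_dec r 0) as [->|Hr0].
{ exists 1%nat; intros n Hn; destruct n; [lia|]; rewrite pow_i by lia; lra. }
set (e := - ln r).
assert (He0 : 0 < e) by (unfold e; pose proof (ln_increasing r 1 ltac:(lra) ltac:(lra)) as H; rewrite ln_1 in H; lra).
destruct (pow_le_exp 2 e He0) as [K [HK HK2]].
destruct (nfloor_ex (K / eps)) as [N HN]; [left; apply Rdiv_lt_0_compat; assumption|].
exists (S N); intros n Hn.
assert (Hn2 : K / eps <= INR n) by (apply Rle_trans with (INR N + 1); [lra|rewrite <- S_INR; apply le_INR, Hn]).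
assert (Hn0 : 0 < INR n) by (apply lt_0_INR; lia).
assert (P : r ^ n = exp (- (e * INR n))).
{ unfold e; replace (- (- ln r * INR n)) with (INR n * ln r) by ring; rewrite exp_INR_mult, exp_ln by lra; reflexivity. }
specialize (HK2 (INR n) ltac:(lra)).
rewrite P, exp_Ropp; pose proof (exp_pos (e * INR n)).
apply Rmult_le_reg_r with (INR n * exp (e * INR n)); [apply Rmult_lt_0_compat; lra|].
replace (INR n * / exp (e * INR n) * (INR n * exp (e * INR n))) with (INR n ^ 2) by (field; lra).
eapply Rle_trans; [exact HK2|].
replace (eps * (INR n * exp (e * INR n))) with (eps * INR n * exp (e * INR n)) by ring.
apply Rmult_le_compat_r; [lra|].
apply (Rmult_le_compat_l eps) in Hn2; [|lra].
replace (eps * (K / eps)) with K in Hn2 by (field; lra); exact Hn2.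
Qed.

Lemma pentagonal (q l : C) : Cmod q < 1 -> Clim (qpoch q) l -> Clim (pent_sum q) l.
Proof.
intros Hq Hl eps He.
pose proof (exp_pos (/ (1 - Cmod q))) as P.
destruct (Hl (eps / 2) ltac:(lra)) as [N1 H1].
destruct (n_pow_lim (Cmod q) (conj (Cmod_ge_0 q) Hq) (eps / 2 / exp (/ (1 - Cmod q)))) as [N2 H2].
{ apply Rdiv_lt_0_compat; lra. }
exists (N1 + N2)%nat; intros n Hn; specialize (H1 n ltac:(lia)); specialize (H2 n ltac:(lia)).
replace (pent_sum q n - l)%C with ((pent_sum q n - qpoch q n) + (qpoch q n - l))%C by ring.
eapply Rle_trans; [apply Cmod_triangle|].
pose proof (pent_sum_qpoch q n Hq) as H3.
apply (Rmult_le_compat_l (exp (/ (1 - Cmod q)))) in H2; [|lra].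
replace (exp (/ (1 - Cmod q)) * (eps / 2 / exp (/ (1 - Cmod q)))) with (eps / 2) in H2 by (field; lra).
lra.
Qed.

(** * Poisson summation *)

Fixpoint rsum (f : nat -> R) (n : nat) : R :=
  match n with O => 0 | S m => rsum f m + f m end.

Lemma rsum_ext (f g : nat -> R) (n : nat) : (forall i, (i < n)%nat -> f i = g i) -> rsum f n = rsum g n.
Proof. intro H; induction n as [|n IH]; simpl; [reflexivity|rewrite IH, H; auto]. Qed.

Lemma rsum_S (f : nat -> R) (n : nat) : rsum f (S n) = rsum f n + f n.
Proof. reflexivity. Qed.

Lemma rsum_Sl (f : nat -> R) (n : nat) : rsum f (S n) = f O + rsum (fun i => f (S i)) n.
Proof. induction n as [|n IH]; [simpl; ring|]. change (rsum f (S (S n))) with (rsum f (S n) + f (S n)); rewrite IH; simpl; ring. Qed.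

Lemma rsum_plus (f g : nat -> R) (n : nat) : rsum (fun i => f i + g i) n = rsum f n + rsum g n.
Proof. induction n as [|n IH]; simpl; [ring|rewrite IH; ring]. Qed.

Lemma rsum_scal (c : R) (f : nat -> R) (n : nat) : rsum (fun i => c * f i) n = c * rsum f n.
Proof. induction n as [|n IH]; simpl; [ring|rewrite IH; ring]. Qed.

Lemma rsum_le (f g : nat -> R) (n : nat) : (forall i, (i < n)%nat -> f i <= g i) -> rsum f n <= rsum g n.
Proof. intro H; induction n as [|n IH]; simpl; [lra|]. pose proof (H n ltac:(lia)); specialize (IH (fun i Hi => H i ltac:(lia))); lra. Qed.

Lemma rsum_abs (f : nat -> R) (n : nat) : Rabs (rsum f n) <= rsum (fun i => Rabs (f i)) n.
Proof. induction n as [|n IH]; simpl; [rewrite Rabs_R0; lra|]. eapply Rle_trans; [apply Rabs_triang|lra]. Qed.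

(** The Fejer kernel of period 1. Being nonnegative with integral 1 over a period, it gives Poisson
    summation without pointwise convergence of Fourier series. *)
Definition fejer (N : nat) (x : R) : R :=
  1 + rsum (fun k => 2 * (1 - INR (S k) / INR (S N)) * cos (2 * PI * INR (S k) * x)) N.

Lemma rsum_rev (g : nat -> R) (n : nat) : rsum (fun j => g (n - j)%nat) n = rsum (fun k => g (S k)) n.
Proof.
induction n as [|n IH]; [reflexivity|].
rewrite rsum_Sl, Nat.sub_0_r.
rewrite (rsum_ext _ (fun j => g (n - j)%nat)) by (intros; f_equal; lia).
rewrite IH; simpl; ring.
Qed.

Lemma cos_sin_sum (t m : R) (n : nat) :
  rsum (fun j => cos (INR j * t)) n * cos (m * t) + rsum (fun j => sin (INR j * t)) n * sin (m * t)
  = rsum (fun j => cos ((m - INR j) * t)) n.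
Proof.
induction n as [|n IH]; simpl rsum; [ring|].
rewrite <- IH, Rmult_minus_distr_r, cos_minus; ring.
Qed.

(** The left side is the squared modulus of the sum of e^(ijt) over j <= N, and the right side is N
    + 1 times the kernel at t = 2 pi x; this is where positivity comes from. *)
Lemma fejer_square (t : R) (N : nat) :
  rsum (fun j => cos (INR j * t)) (S N) ^ 2 + rsum (fun j => sin (INR j * t)) (S N) ^ 2
  = INR (S N) + 2 * rsum (fun k => (INR N - INR k) * cos (INR (S k) * t)) N.
Proof.
induction N as [|N IH].
- simpl; rewrite Rmult_0_l, sin_0, cos_0; ring.
- set (C := rsum (fun j => cos (INR j * t)) (S N)) in *.
  set (S' := rsum (fun j => sin (INR j * t)) (S N)) in *.
  change (rsum (fun j => cos (INR j * t)) (S (S N))) with (C + cos (INR (S N) * t)).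
  change (rsum (fun j => sin (INR j * t)) (S (S N))) with (S' + sin (INR (S N) * t)).
  replace ((C + cos (INR (S N) * t)) ^ 2 + (S' + sin (INR (S N) * t)) ^ 2)
    with (C ^ 2 + S' ^ 2 + (Rsqr (sin (INR (S N) * t)) + Rsqr (cos (INR (S N) * t)))
      + 2 * (C * cos (INR (S N) * t) + S' * sin (INR (S N) * t))) by (unfold Rsqr; ring).
  rewrite sin2_cos2, IH; unfold C, S'; rewrite cos_sin_sum.
  rewrite (rsum_ext (fun j => cos ((INR (S N) - INR j) * t)) (fun j => cos (INR (S N - j) * t)))
    by (intros; rewrite minus_INR by lia; reflexivity).
  rewrite (rsum_rev (fun k => cos (INR k * t))).
  rewrite (rsum_ext (fun k => (INR (S N) - INR k) * cos (INR (S k) * t))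
     (fun k => (INR N - INR k) * cos (INR (S k) * t) + cos (INR (S k) * t)))
    by (intros; rewrite (S_INR N); ring).
  rewrite rsum_plus.
  change (rsum (fun k => (INR N - INR k) * cos (INR (S k) * t)) (S N))
    with (rsum (fun k => (INR N - INR k) * cos (INR (S k) * t)) N + (INR N - INR N) * cos (INR (S N) * t)).
  rewrite (S_INR (S N)); ring.
Qed.

Lemma fejer_ge_0 (N : nat) (x : R) : 0 <= fejer N x.
Proof.
pose proof (fejer_square (2 * PI * x) N) as H.
assert (P : 0 < INR (S N)) by (apply lt_0_INR; lia).
assert (E : INR (S N) * fejer N x = INR (S N) + 2 * rsum (fun k => (INR N - INR k) * cos (INR (S k) * (2 * PI * x))) N).
{ unfold fejer; rewrite Rmult_plus_distr_l, Rmult_1_r; f_equal.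
  rewrite <- !rsum_scal; apply rsum_ext; intros k _.
  replace (INR (S k) * (2 * PI * x)) with (2 * PI * INR (S k) * x) by ring.
  rewrite !S_INR in *; field; lra. }
rewrite <- H in E.
apply Rmult_le_reg_l with (INR (S N)); [exact P|]; rewrite Rmult_0_r, E; nra.
Qed.

Lemma is_derive_fejer (N : nat) (x : R) : ex_derive (fejer N) x.
Proof.
unfold fejer; apply (ex_derive_plus (V := R_NormedModule)); [auto_derive; exact I|].
generalize N at 2; intro n; induction n as [|n IH]; simpl; [auto_derive; exact I|].
apply (ex_derive_plus (V := R_NormedModule)); [exact IH|auto_derive; exact I].
Qed.

Lemma ex_RInt_rsum (f : nat -> R -> R) (a b : R) (n : nat) : (forall k, ex_RInt (f k) a b) ->
  ex_RInt (fun x => rsum (fun k => f k x) n) a b /\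
  RInt (fun x => rsum (fun k => f k x) n) a b = rsum (fun k => RInt (f k) a b) n.
Proof.
intro H; induction n as [|n [IH1 IH2]]; simpl.
- split; [apply ex_RInt_const|rewrite RInt_const; unfold scal; simpl; unfold mult; simpl; eq_in_R; ring].
- split; [apply (ex_RInt_plus (V := R_NormedModule)); [exact IH1|apply H]|].
  rewrite (RInt_plus (V := R_CompleteNormedModule)), IH2 by (exact IH1 || apply H); reflexivity.
Qed.

Lemma RInt_mult_fejer (g : R -> R) (N : nat) (a b : R) : (forall x, ex_derive g x) ->
  RInt (fun x => g x * fejer N x) a b = RInt g a b +
   rsum (fun k => 2 * (1 - INR (S k) / INR (S N)) * RInt (fun x => g x * cos (2 * PI * INR (S k) * x)) a b) N.
Proof.
intro Hg.
assert (E : forall k, ex_RInt (fun x => g x * cos (2 * PI * INR k * x)) a b)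
  by (intro k; apply ex_RInt_derivable; intro x; specialize (Hg x); auto_derive; auto).
set (f := fun k x => (2 * (1 - INR (S k) / INR (S N))) * (g x * cos (2 * PI * INR (S k) * x))).
assert (Ef : forall k, ex_RInt (f k) a b) by (intro k; apply (ex_RInt_scal (V := R_NormedModule)), E).
destruct (ex_RInt_rsum f a b N Ef) as [H1 H2].
rewrite (RInt_ext _ (fun x => g x + rsum (fun k => f k x) N)).
- rewrite (RInt_plus (V := R_CompleteNormedModule)); [|apply ex_RInt_derivable, Hg|exact H1].
  unfold plus; simpl; rewrite H2; f_equal; apply rsum_ext; intros k _.
  unfold f; rewrite (RInt_scal (V := R_CompleteNormedModule)) by apply E; reflexivity.
- intros x _; unfold fejer; eq_in_R; rewrite Rmult_plus_distr_l, Rmult_1_r; f_equal.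
  rewrite <- rsum_scal; apply rsum_ext; intros k _; unfold f; ring.
Qed.

Lemma sin_INR_PI (k : nat) : sin (INR k * PI) = 0.
Proof.
induction k as [|k IH]; [simpl; rewrite Rmult_0_l; apply sin_0|].
rewrite S_INR, Rmult_plus_distr_r, Rmult_1_l, neg_sin, IH; ring.
Qed.

Lemma RInt_cos_unit (k : nat) : (0 < k)%nat -> RInt (fun x => cos (2 * PI * INR k * x)) (- (1 / 2)) (1 / 2) = 0.
Proof.
intro Hk; assert (P : 0 < INR k) by (apply lt_0_INR, Hk); pose proof PI_RGT_0 as P2.
rewrite (is_RInt_unique _ _ _ (minus (sin (2 * PI * INR k * (1 / 2)) / (2 * PI * INR k)) (sin (2 * PI * INR k * (- (1 / 2))) / (2 * PI * INR k)))).
- unfold minus, plus, opp; simpl.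
  replace (2 * PI * INR k * (1 / 2)) with (INR k * PI) by field.
  replace (2 * PI * INR k * - (1 / 2)) with (- (INR k * PI)) by field.
  rewrite sin_neg, sin_INR_PI; field; split; lra.
- apply (is_RInt_derive (V := R_CompleteNormedModule) (fun x => sin (2 * PI * INR k * x) / (2 * PI * INR k))).
  + intros x _; auto_derive; [exact I|field; split; lra].
  + intros x _; apply (ex_derive_continuous (V := R_NormedModule)); auto_derive; exact I.
Qed.

Lemma RInt_fejer (N : nat) : RInt (fejer N) (- (1 / 2)) (1 / 2) = 1.
Proof.
rewrite (RInt_ext _ (fun x => 1 * fejer N x)) by (intros; eq_in_R; ring).
rewrite RInt_mult_fejer by (intro; auto_derive; exact I).
rewrite (rsum_ext _ (fun _ => 0 * 0)).
- rewrite (rsum_scal 0 (fun _ => 0)), RInt_const; unfold scal; simpl; unfold mult; simpl; eq_in_R; field.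
- intros k _; rewrite (RInt_ext _ (fun x => cos (2 * PI * INR (S k) * x))) by (intros; eq_in_R; ring).
  rewrite RInt_cos_unit by lia; ring.
Qed.

(** As sin^2(pi x) is 1/2 - cos(2 pi x)/2, only modes 0 and 1 survive, and what remains is the
    weight 1/(N + 1) that mode 1 lacks. It acts as a second moment, showing that the kernel
    concentrates at 0. *)
Lemma RInt_sin2_fejer (N : nat) : (0 < N)%nat ->
  RInt (fun x => sin (PI * x) ^ 2 * fejer N x) (- (1 / 2)) (1 / 2) = / (2 * INR (S N)).
Proof.
intro HN; assert (P : 0 < INR (S N)) by (apply lt_0_INR; lia).
assert (EX : forall f : R -> R, (forall x, ex_derive f x) -> ex_RInt f (- (1 / 2)) (1 / 2))
  by (intros; apply ex_RInt_derivable; assumption).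
assert (S2 : forall x, sin (PI * x) ^ 2 = / 2 - / 2 * cos (2 * PI * INR 1 * x)).
{ intro x; replace (2 * PI * INR 1 * x) with (2 * (PI * x)) by (simpl; ring).
  rewrite cos_2a_sin; field. }
rewrite RInt_mult_fejer by (intro; auto_derive; exact I).
destruct N as [|N]; [lia|].
assert (A : RInt (fun x => sin (PI * x) ^ 2) (- (1 / 2)) (1 / 2) = / 2).
{ rewrite (RInt_ext _ (fun x => minus (/ 2) (scal (/ 2) (cos (2 * PI * INR 1 * x))))) by (intros; apply S2).
  rewrite (RInt_minus (V := R_CompleteNormedModule)), (RInt_scal (V := R_CompleteNormedModule)), RInt_const, RInt_cos_unit; try lia.
  - unfold minus, plus, opp, scal; simpl; unfold mult; simpl; eq_in_R; field.
  - apply EX; intro; auto_derive; exact I.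
  - apply EX; intro; auto_derive; exact I.
  - apply EX; intro; unfold scal; simpl; unfold mult; simpl; auto_derive; exact I. }
assert (B : forall k, RInt (fun x => sin (PI * x) ^ 2 * cos (2 * PI * INR (S k) * x)) (- (1 / 2)) (1 / 2)
   = match k with O => - / 4 | _ => 0 end).
{ intro k.
  rewrite (RInt_ext _ (fun x => minus (scal (/ 2) (cos (2 * PI * INR (S k) * x)))
     (scal (/ 4) (plus (cos (2 * PI * INR (S (S k)) * x)) (cos (2 * PI * INR k * x)))))).
  2:{ intros x _; unfold minus, plus, opp, scal; simpl; unfold mult; simpl; eq_in_R.
      change (sin (PI * x) * (sin (PI * x) * 1)) with (sin (PI * x) ^ 2); rewrite S2.
      change (match k with O => 1 | S _ => INR k + 1 end) with (INR (S k)).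
      replace (2 * PI * (INR (S k) + 1) * x) with (2 * PI * INR (S k) * x + 2 * PI * INR 1 * x) by (simpl; ring).
      replace (2 * PI * INR k * x) with (2 * PI * INR (S k) * x - 2 * PI * INR 1 * x) by (rewrite S_INR; simpl; ring).
      rewrite cos_plus, cos_minus; field. }
  rewrite (RInt_minus (V := R_CompleteNormedModule)), !(RInt_scal (V := R_CompleteNormedModule)), (RInt_plus (V := R_CompleteNormedModule)), !(RInt_cos_unit (S _)) by
    (lia || (apply EX; intro; unfold scal, plus; simpl; unfold mult; simpl; auto_derive; exact I)).
  unfold minus, plus, opp, scal; simpl; unfold mult; simpl.
  destruct k as [|k].
  - rewrite (RInt_ext _ (fun _ => 1)).
    + rewrite RInt_const; unfold scal; simpl; unfold mult; simpl; eq_in_R; field.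
    + intros x _; simpl; rewrite Rmult_0_r, Rmult_0_l; apply cos_0.
  - rewrite (RInt_cos_unit (S k)) by lia; ring. }
rewrite A, (rsum_ext _ (fun k => 2 * (1 - INR (S k) / INR (S (S N))) * match k with O => - / 4 | _ => 0 end))
  by (intros k _; rewrite B; reflexivity).
rewrite rsum_Sl, (rsum_ext _ (fun _ => 0 * 0)) by (intros; ring).
rewrite rsum_scal, Rmult_0_l; change (INR 1) with 1; eq_in_R; field; lra.
Qed.

Lemma sin_ge_cubic (a : R) : 0 <= a <= 2 -> a - a ^ 3 / 6 <= sin a.
Proof.
intro Ha; destruct (SIN a) as [L _]; [lra|pose proof PI2_3_2; lra|].
assert (E : sin_lb a = a - a ^ 3 / 6 + a ^ 5 / 120 - a ^ 7 / (7 * 720)).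
{ unfold sin_lb, sin_approx, sin_term; cbn [sum_f_R0 Nat.mul Nat.add].
  change (fact 1) with 1%nat; change (fact 3) with 6%nat; change (fact 5) with 120%nat.
  replace (INR (fact 7)) with (7 * 720) by (change (fact 7) with (7 * 720)%nat; rewrite mult_INR, !INR_IZR_INZ; reflexivity).
  rewrite !INR_IZR_INZ; simpl; field. }
rewrite E in L.
assert (a ^ 7 / (7 * 720) <= a ^ 5 / 120).
{ replace (a ^ 7) with (a ^ 5 * a ^ 2) by ring.
  assert (0 <= a ^ 5) by (apply pow_le; lra).
  assert (a ^ 2 <= 4) by nra; nra. }
lra.
Qed.

Lemma abs_le_sin_PI (y : R) : - (1 / 2) <= y <= 1 / 2 -> Rabs y <= Rabs (sin (PI * y)).
Proof.
assert (H : forall y, 0 <= y <= 1 / 2 -> y <= sin (PI * y)).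
{ intros x Hx; pose proof PI_4 as P4; pose proof PI2_3_2 as P3.
  pose proof (sin_ge_cubic (PI * x) ltac:(split; nra)) as L.
  set (a := PI * x) in *.
  assert (Ha : 0 <= a <= 2) by (unfold a; split; nra).
  assert (Ha2 : 3 * x <= a) by (unfold a; nra).
  assert (a ^ 3 <= 4 * a) by (replace (a ^ 3) with (a * a ^ 2) by ring; rewrite Rmult_comm; apply Rmult_le_compat_r; nra).
  lra. }
intro Hy; destruct (Rle_dec 0 y) as [H0|H0].
- rewrite !Rabs_right; [apply H; lra| |lra]. specialize (H y ltac:(lra)); lra.
- specialize (H (- y) ltac:(lra)).
  replace (PI * - y) with (- (PI * y)) in H by ring; rewrite sin_neg in H.
  rewrite !Rabs_left1; lra.
Qed.

(** The Lipschitz bound D |y| is averaged through |y| <= eta/2 + y^2/(2 eta), with y^2 dominated by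
    sin^2(pi y). The parameter eta is free, and N may be chosen after it. *)
Lemma RInt_fejer_near (g : R -> R) (D eta : R) (N : nat) :
  (0 < N)%nat -> 0 < eta -> (forall x, ex_derive g x) ->
  (forall y, - (1 / 2) <= y <= 1 / 2 -> Rabs (g y - g 0) <= D * Rabs y) ->
  Rabs (RInt (fun y => g y * fejer N y) (- (1 / 2)) (1 / 2) - g 0)
    <= D * (eta / 2 + / (4 * eta * INR (S N))).
Proof.
intros HN He Hg HD.
assert (D0 : 0 <= D).
{ specialize (HD (1 / 2) ltac:(lra)); rewrite (Rabs_right (1 / 2)) in HD by lra.
  pose proof (Rabs_pos (g (1 / 2) - g 0)); lra. }
assert (P : 0 < INR (S N)) by (apply lt_0_INR; lia).
assert (EX : forall f : R -> R, (forall x, ex_derive f x) -> ex_RInt f (- (1 / 2)) (1 / 2))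
  by (intros; apply ex_RInt_derivable; assumption).
assert (DF := is_derive_fejer N).
assert (E1 : ex_RInt (fun y => g y * fejer N y) (- (1 / 2)) (1 / 2))
  by (apply EX; intro; auto_derive; auto).
assert (E2 : ex_RInt (fun y => (g y - g 0) * fejer N y) (- (1 / 2)) (1 / 2))
  by (apply EX; intro; auto_derive; auto).
assert (A : RInt (fun y => g y * fejer N y) (- (1 / 2)) (1 / 2) - g 0
   = RInt (fun y => (g y - g 0) * fejer N y) (- (1 / 2)) (1 / 2)).
{ rewrite (RInt_ext (fun y => (g y - g 0) * fejer N y) (fun y => minus (g y * fejer N y) (scal (g 0) (fejer N y)))).
  - rewrite (RInt_minus (V := R_CompleteNormedModule)), (RInt_scal (V := R_CompleteNormedModule)), RInt_fejer;
      [|apply EX, DF|exact E1|apply EX; intro; unfold scal; simpl; unfold mult; simpl; auto_derive; auto].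
    unfold minus, plus, opp, scal; simpl; unfold mult; simpl; eq_in_R; ring.
  - intros x _; unfold minus, plus, opp, scal; simpl; unfold mult; simpl; eq_in_R; ring. }
rewrite A; eapply Rle_trans; [apply abs_RInt_le; [lra|exact E2]|].
set (B := fun y => plus (scal (D * (eta / 2)) (fejer N y)) (scal (D * / (2 * eta)) (sin (PI * y) ^ 2 * fejer N y))).
assert (EB : ex_RInt B (- (1 / 2)) (1 / 2)).
{ apply EX; intro; unfold B, plus, scal; simpl; unfold mult; simpl; auto_derive; auto. }
replace (D * (eta / 2 + / (4 * eta * INR (S N)))) with (RInt B (- (1 / 2)) (1 / 2)).
- apply RInt_le; [lra| |exact EB|].
  + apply ex_RInt_norm, E2.
  + intros y Hy; rewrite Rabs_mult, (Rabs_right (fejer N y)) by apply Rle_ge, fejer_ge_0.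
    unfold B, plus, scal; simpl; unfold mult; simpl.
    replace (D * (eta / 2) * fejer N y + D * / (2 * eta) * (sin (PI * y) * (sin (PI * y) * 1) * fejer N y))
      with (D * (eta / 2 + sin (PI * y) ^ 2 / (2 * eta)) * fejer N y) by (simpl; field; lra).
    apply Rmult_le_compat_r; [apply fejer_ge_0|].
    eapply Rle_trans; [apply HD; lra|]; apply Rmult_le_compat_l; [exact D0|].
    eapply Rle_trans; [apply abs_le_sin_PI; lra|].
    set (s := sin (PI * y)).
    apply Rmult_le_reg_r with (2 * eta); [lra|].
    replace ((eta / 2 + s ^ 2 / (2 * eta)) * (2 * eta)) with (eta ^ 2 + s ^ 2) by (field; lra).
    rewrite <- (pow2_abs s); pose proof (Rabs_pos s).
    pose proof (pow2_ge_0 (eta - Rabs s)); nra.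
- unfold B; rewrite (RInt_plus (V := R_CompleteNormedModule)), !(RInt_scal (V := R_CompleteNormedModule)), RInt_fejer, RInt_sin2_fejer;
   try exact HN; try (apply EX; intro; unfold scal; simpl; unfold mult; simpl; auto_derive; auto).
  unfold plus, scal; simpl; unfold mult; simpl; fold (INR (S N)).
  change (match N with O => 1 | S _ => INR N + 1 end) with (INR (S N)); eq_in_R; field; lra.
Qed.

Lemma fejer_period (N m : nat) (x : R) : fejer N (x + INR m) = fejer N x.
Proof.
unfold fejer; f_equal; apply rsum_ext; intros k _; f_equal.
replace (2 * PI * INR (S k) * (x + INR m)) with (2 * PI * INR (S k) * x + 2 * INR (S k * m) * PI)
  by (rewrite mult_INR; ring).
apply cos_period.
Qed.

Lemma fejer_period_neg (N m : nat) (x : R) : fejer N (x + - INR m) = fejer N x.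
Proof. rewrite <- (fejer_period N m (x + - INR m)); f_equal; ring. Qed.

Lemma RInt_fejer_cell (f : R -> R) (D eta c : R) (N : nat) :
  (0 < N)%nat -> 0 < eta -> (forall x, ex_derive f x) ->
  (forall x, fejer N (x + c) = fejer N x) ->
  (forall y, - (1 / 2) <= y <= 1 / 2 -> Rabs (f (y + c) - f c) <= D * Rabs y) ->
  Rabs (RInt (fun y => f y * fejer N y) (c - 1 / 2) (c + 1 / 2) - f c)
    <= D * (eta / 2 + / (4 * eta * INR (S N))).
Proof.
intros HN He Hf Hc HD.
assert (Hg : forall x, ex_derive (fun y => f (y + c)) x).
{ intro x; apply (ex_derive_comp (K := R_AbsRing) (V := R_NormedModule) f (fun y => y + c)); [apply Hf|auto_derive; exact I]. }
pose proof (RInt_fejer_near (fun y => f (y + c)) D eta N HN He Hg) as K; cbv beta in K.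
rewrite Rplus_0_l in K; specialize (K HD).
replace (RInt (fun y => f y * fejer N y) (c - 1 / 2) (c + 1 / 2))
  with (RInt (fun y => f (y + c) * fejer N y) (- (1 / 2)) (1 / 2)); [exact K|].
pose proof (RInt_comp_lin (V := R_CompleteNormedModule) (fun y => f y * fejer N y) 1 c (- (1 / 2)) (1 / 2)) as L.
replace (1 * - (1 / 2) + c) with (c - 1 / 2) in L by ring.
replace (1 * (1 / 2) + c) with (c + 1 / 2) in L by ring.
rewrite <- L.
- apply RInt_ext; intros x _; unfold scal; simpl; unfold mult; simpl; eq_in_R.
  rewrite !Rmult_1_l, Hc; reflexivity.
- apply ex_RInt_derivable; intro; pose proof (is_derive_fejer N); auto_derive; auto.
Qed.

Fixpoint zsum (f : R -> R) (M : nat) : R :=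
  match M with O => f 0 | S m => zsum f m + f (INR (S m)) + f (- INR (S m)) end.

(** The interval is cut into unit cells centred at the integers. By periodicity every cell sees the
    same kernel, and the cell errors add up through the local Lipschitz constants. *)
Lemma RInt_fejer_zsum (f D : R -> R) (eta : R) (N M : nat) :
  (0 < N)%nat -> 0 < eta -> (forall x, ex_derive f x) ->
  (forall c y, - (1 / 2) <= y <= 1 / 2 -> Rabs (f (y + c) - f c) <= D c * Rabs y) ->
  Rabs (RInt (fun y => f y * fejer N y) (- (INR M + 1 / 2)) (INR M + 1 / 2) - zsum f M)
    <= zsum D M * (eta / 2 + / (4 * eta * INR (S N))).
Proof.
intros HN He Hf HD; set (e := eta / 2 + _).
assert (DF := is_derive_fejer N).
assert (EX : forall a b, ex_RInt (fun y => f y * fejer N y) a b)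
  by (intros; apply ex_RInt_derivable; intro; auto_derive; auto).
induction M as [|M IH].
- simpl zsum; simpl INR; replace (- (0 + 1 / 2)) with (0 - 1 / 2) by ring.
  apply RInt_fejer_cell; auto; intros; f_equal; ring.
- simpl zsum.
  assert (K1 := RInt_fejer_cell f (D (INR (S M))) eta (INR (S M)) N HN He Hf (fejer_period N (S M)) (HD _)).
  assert (K2 := RInt_fejer_cell f (D (- INR (S M))) eta (- INR (S M)) N HN He Hf (fejer_period_neg N (S M)) (HD _)).
  fold e in K1, K2.
  change (match M with O => 1 | S _ => INR M + 1 end) with (INR (S M)).
  rewrite <- (RInt_Chasles (V := R_CompleteNormedModule) (fun y => f y * fejer N y) (- (INR (S M) + 1 / 2)) (- (INR M + 1 / 2))) by apply EX.
  rewrite <- (RInt_Chasles (V := R_CompleteNormedModule) (fun y => f y * fejer N y) (- (INR M + 1 / 2)) (INR M + 1 / 2) (INR (S M) + 1 / 2)) by apply EX.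
  unfold plus; simpl plus; cbn [AbelianMonoid.plus].
  replace (INR (S M) - 1 / 2) with (INR M + 1 / 2) in K1 by (rewrite S_INR; field).
  replace (- INR (S M) - 1 / 2) with (- (INR (S M) + 1 / 2)) in K2 by ring.
  replace (- INR (S M) + 1 / 2) with (- (INR M + 1 / 2)) in K2 by (rewrite S_INR; field).
  set (I0 := RInt _ (- (INR M + 1 / 2)) (INR M + 1 / 2)) in *.
  set (I1 := RInt _ (INR M + 1 / 2) _) in *; set (I2 := RInt _ _ (- (INR M + 1 / 2))) in *.
  change (Rabs (I2 + (I0 + I1) - (zsum f M + f (INR (S M)) + f (- INR (S M)))) <=
    (zsum D M + D (INR (S M)) + D (- INR (S M))) * e).
  replace (I2 + (I0 + I1) - (zsum f M + f (INR (S M)) + f (- INR (S M))))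
    with ((I0 - zsum f M) + (I1 - f (INR (S M))) + (I2 - f (- INR (S M)))) by ring.
  eapply Rle_trans; [apply Rabs_triang|]; eapply Rle_trans; [apply Rplus_le_compat_r, Rabs_triang|]; lra.
Qed.

Lemma is_lim_seq_rsum (u : nat -> nat -> R) (F : nat -> R) (N : nat) :
  (forall k, is_lim_seq (u k) (F k)) -> is_lim_seq (fun M => rsum (fun k => u k M) N) (rsum F N).
Proof.
intro H; induction N as [|N IH]; simpl; [apply is_lim_seq_const|].
apply is_lim_seq_plus'; [exact IH|apply H].
Qed.

Lemma le_of_le_eps (a b c : R) : 0 <= c -> (forall e, 0 < e -> a <= b + c * e) -> a <= b.
Proof.
intros Hc H; apply Rnot_lt_le; intro L.
specialize (H ((a - b) / (2 * (c + 1)))).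
assert (P : 0 < (a - b) / (2 * (c + 1))) by (apply Rdiv_lt_0_compat; lra).
specialize (H P).
assert (E : (a - b) / (2 * (c + 1)) * (2 * (c + 1)) = a - b) by (field; lra).
nra.
Qed.

(* Poisson summation as an inequality: modes 0 and 1 against the sum of the others. *)
Lemma poisson (f D : R -> R) (Dt L B : R) (F : nat -> R) :
  (forall x, ex_derive f x) ->
  (forall c y, - (1 / 2) <= y <= 1 / 2 -> Rabs (f (y + c) - f c) <= D c * Rabs y) ->
  (forall M, zsum D M <= Dt) ->
  is_lim_seq (zsum f) L ->
  (forall k, is_lim_seq (fun M => RInt (fun x => f x * cos (2 * PI * INR k * x)) (- (INR M + 1 / 2)) (INR M + 1 / 2)) (F k)) ->
  (forall N, rsum (fun k => 2 * Rabs (F (S (S k)))) N <= B) ->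
  Rabs (L - F 0%nat - 2 * F 1%nat) <= B.
Proof.
intros Hf HD HDt HL HF HB.
(* The cutoff M goes to infinity with N fixed, so only finitely many modes pass to the limit and no
   exchange of limits is needed. *)
assert (S1 : forall N eta, 0 < eta ->
  Rabs (F 0%nat + rsum (fun k => 2 * (1 - INR (S k) / INR (S (S N))) * F (S k)) (S N) - L) <=
   Dt * (eta / 2 + / (4 * eta * INR (S (S N))))).
{ intros N eta He.
  set (u := fun M => RInt (fun y => f y * fejer (S N) y) (- (INR M + 1 / 2)) (INR M + 1 / 2) - zsum f M).
  assert (Hu : is_lim_seq u (F 0%nat + rsum (fun k => 2 * (1 - INR (S k) / INR (S (S N))) * F (S k)) (S N) - L)).
  { apply is_lim_seq_minus'; [|exact HL].
    apply is_lim_seq_ext with (fun M => RInt (fun x => f x * cos (2 * PI * INR 0 * x)) (- (INR M + 1 / 2)) (INR M + 1 / 2) +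
      rsum (fun k => 2 * (1 - INR (S k) / INR (S (S N))) * RInt (fun x => f x * cos (2 * PI * INR (S k) * x)) (- (INR M + 1 / 2)) (INR M + 1 / 2)) (S N)).
    - intro M; rewrite RInt_mult_fejer by exact Hf; f_equal.
      apply RInt_ext; intros x _; simpl; eq_in_R; rewrite Rmult_0_r, Rmult_0_l, cos_0; ring.
    - apply is_lim_seq_plus'; [apply HF|].
      apply (is_lim_seq_rsum (fun k M => 2 * (1 - INR (S k) / INR (S (S N))) * RInt (fun x => f x * cos (2 * PI * INR (S k) * x)) (- (INR M + 1 / 2)) (INR M + 1 / 2))
        (fun k => 2 * (1 - INR (S k) / INR (S (S N))) * F (S k))).
      intro k; apply is_lim_seq_mult'; [apply is_lim_seq_const|apply HF]. }
  assert (P : 0 < INR (S (S N))) by (apply lt_0_INR; lia).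
  apply is_lim_seq_abs in Hu.
  assert (K : Rbar_le (Rabs (F 0%nat + rsum (fun k => 2 * (1 - INR (S k) / INR (S (S N))) * F (S k)) (S N) - L))
     (Dt * (eta / 2 + / (4 * eta * INR (S (S N)))))).
  { apply (is_lim_seq_le (fun M => Rabs (u M)) (fun _ => Dt * (eta / 2 + / (4 * eta * INR (S (S N)))))); [|exact Hu|apply is_lim_seq_const].
    intro M; eapply Rle_trans; [apply (RInt_fejer_zsum f D eta (S N) M); auto; lia|].
    apply Rmult_le_compat_r; [|apply HDt].
    assert (0 < / (4 * eta * INR (S (S N)))) by (apply Rinv_0_lt_compat; repeat apply Rmult_lt_0_compat; lra); lra. }
  exact K. }
assert (S2 : forall N eta, 0 < eta ->
  Rabs (L - F 0%nat - 2 * F 1%nat) <= B + 2 * Rabs (F 1%nat) / INR (S (S N)) + Dt * (eta / 2 + / (4 * eta * INR (S (S N))))).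
{ intros N eta He; specialize (S1 N eta He).
  assert (P : 0 < INR (S (S N))) by (apply lt_0_INR; lia).
  rewrite rsum_Sl in S1; change (INR 1) with 1 in S1.
  set (T := rsum _ N) in S1.
  assert (HT : Rabs T <= B).
  { eapply Rle_trans; [apply rsum_abs|]; eapply Rle_trans; [|apply (HB N)].
    apply rsum_le; intros k Hk; rewrite !Rabs_mult, (Rabs_right 2) by lra.
    apply Rmult_le_compat_r; [apply Rabs_pos|].
    assert (0 <= INR (S (S k)) / INR (S (S N)) <= 1).
    { split; [apply Rmult_le_pos; [apply pos_INR|left; apply Rinv_0_lt_compat, P]|].
      apply Rmult_le_reg_r with (INR (S (S N))); [exact P|].
      unfold Rdiv; rewrite Rmult_assoc, Rinv_l, Rmult_1_r, Rmult_1_l by lra; apply le_INR; lia. }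
    rewrite Rabs_right by lra; lra. }
  set (X := F 0%nat + _ - L) in S1.
  replace (L - F 0%nat - 2 * F 1%nat) with (- X + T + - (2 * F 1%nat / INR (S (S N)))) by (unfold X; field; lra).
  eapply Rle_trans; [apply Rabs_triang|]; eapply Rle_trans; [apply Rplus_le_compat_r, Rabs_triang|].
  rewrite !Rabs_Ropp; unfold Rdiv at 1; rewrite !Rabs_mult, (Rabs_right 2), (Rabs_right (/ _)) by (try lra; left; apply Rinv_0_lt_compat, P).
  unfold Rdiv; lra. }
assert (D0 : 0 <= Dt).
{ specialize (HDt 0%nat); simpl in HDt; specialize (HD 0 (1 / 2) ltac:(lra)).
  rewrite (Rabs_right (1 / 2)) in HD by lra; pose proof (Rabs_pos (f (1 / 2 + 0) - f 0)); lra. }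
apply le_of_le_eps with (2 * Rabs (F 1%nat) + Dt); [pose proof (Rabs_pos (F 1%nat)); lra|].
intros e He.
(* With eta = e, the part 1/e takes care of the Fejer weight of mode 1 and the part 1/e^2 of the
   term with 4 eta in the denominator. *)
destruct (nfloor_ex (/ e + / (e * e))) as [N HN].
{ left; apply Rplus_lt_0_compat; apply Rinv_0_lt_compat; nra. }
specialize (S2 N e He).
assert (P : 0 < INR (S (S N))) by (apply lt_0_INR; lia).
assert (P1 : 0 < / e) by (apply Rinv_0_lt_compat, He).
assert (P2 : 0 < / (e * e)) by (apply Rinv_0_lt_compat; nra).
assert (HN2 : / e + / (e * e) <= INR (S (S N))) by (rewrite !S_INR; lra).
assert (Q1 : / INR (S (S N)) <= e).
{ rewrite <- (Rinv_inv e); apply Rinv_le_contravar; lra. }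
assert (Q2 : / (4 * e * INR (S (S N))) <= e / 4).
{ apply Rle_trans with (/ (4 * e * / (e * e))); [|right; field; lra].
  apply Rinv_le_contravar; [repeat apply Rmult_lt_0_compat; lra|apply Rmult_le_compat_l; lra]. }
eapply Rle_trans; [exact S2|].
assert (2 * Rabs (F 1%nat) / INR (S (S N)) <= 2 * Rabs (F 1%nat) * e)
  by (unfold Rdiv; apply Rmult_le_compat_l; [pose proof (Rabs_pos (F 1%nat)); lra|exact Q1]).
assert (Dt * (e / 2 + / (4 * e * INR (S (S N)))) <= Dt * e) by (apply Rmult_le_compat_l; lra).
lra.
Qed.

(** * The Euler function near q = 1 *)

(** Real part of exp(i pi nu x - (3/2) z (x + 1/6)^2). At an integer x with nu = 1 the whole
    exponential is e^(-z/24) (-1)^x q^(x(3x+1)/2), because (3/2)(x + 1/6)^2 = x(3x + 1)/2 + 1/24. *)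
Definition theta_re (z : C) (nu x : R) : R :=
  exp (- (3 / 2 * fst z * ((x + 1 / 6) * (x + 1 / 6)))) *
  cos (PI * nu * x - 3 / 2 * snd z * ((x + 1 / 6) * (x + 1 / 6))).

Definition theta_im (z : C) (nu x : R) : R :=
  exp (- (3 / 2 * fst z * ((x + 1 / 6) * (x + 1 / 6)))) *
  sin (PI * nu * x - 3 / 2 * snd z * ((x + 1 / 6) * (x + 1 / 6))).

(** The integral over the real line of [theta_re] + i [theta_im] at z = w^2. Taking w as the
    parameter fixes the branch of the square root. *)
Definition theta_hat (w : C) (nu : R) : C :=
  (sqrt (2 * PI) * (Cexp (- (PI ^ 2 * nu ^ 2 / 6)%R / (w * w) - Ci * (PI * nu / 6)%R) / (sqrt 3 * w)))%C.

(** Completing the square: the exponent is -(a x + b)^2/2 plus the constant that appears in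
    [theta_hat]. *)
Lemma theta_gauss (w : C) (nu x : R) : w <> 0 ->
  let a := (sqrt 3 * w)%C in let b := (a * (1 / 6)%R - Ci * (PI * nu)%R / a)%C in
  (theta_re (w * w) nu x, theta_im (w * w) nu x) =
  (Cexp (- (PI ^ 2 * nu ^ 2 / 6)%R / (w * w) - Ci * (PI * nu / 6)%R) / (sqrt 3 * w) *
    (gauss_re (fst a) (snd a) (fst b) (snd b) 1 x, gauss_im (fst a) (snd a) (fst b) (snd b) 1 x))%C.
Proof.
intros Hw a b.
assert (s3 : sqrt 3 * sqrt 3 = 3) by (apply sqrt_sqrt; lra).
assert (s0 : 0 < sqrt 3) by (apply sqrt_lt_R0; lra).
assert (S0 : RtoC (sqrt 3) <> 0) by (intro E; apply RtoC_inj in E; lra).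
assert (S3 : (RtoC (sqrt 3) * RtoC (sqrt 3))%C = RtoC 3) by (rewrite <- RtoC_mult, s3; reflexivity).
assert (G : (gauss_re (fst a) (snd a) (fst b) (snd b) 1 x, gauss_im (fst a) (snd a) (fst b) (snd b) 1 x)
  = (a * Cexp (- ((a * x + b) * (a * x + b)) * (1 / 2)%R))%C).
{ clearbody b; clearbody a; destruct a as [p q], b as [c d].
  unfold gauss_re, gauss_im, Cexp, Cmult, Cplus, Copp, RtoC; cbn [fst snd]; cbv zeta.
  set (X := (1 + 1 * (p - 1)) * x + 1 * c); set (Y := 1 * q * x + 1 * d).
  replace (p * x - q * 0 + c) with X by (unfold X; ring).
  replace (p * 0 + q * x + d) with Y by (unfold Y; ring).
  replace (- (X * X - Y * Y) * (1 / 2) - - (X * Y + Y * X) * 0) with (- (X * X - Y * Y) / 2) by field.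
  replace (- (X * X - Y * Y) * 0 + - (X * Y + Y * X) * (1 / 2)) with (- (X * Y)) by field.
  rewrite cos_neg, sin_neg; f_equal; ring. }
rewrite G.
assert (H : (theta_re (w * w) nu x, theta_im (w * w) nu x) =
  Cexp (- ((3 / 2)%R * (w * w) * ((x + 1 / 6) * (x + 1 / 6))%R) + Ci * (PI * nu * x)%R)).
{ generalize (w * w)%C; intros [zx zy]; unfold theta_re, theta_im, Cexp, Cmult, Cplus, Copp, RtoC, Ci; cbn [fst snd].
  f_equal; f_equal; f_equal; ring. }
rewrite H.
replace (Cexp (- (PI ^ 2 * nu ^ 2 / 6)%R / (w * w) - Ci * (PI * nu / 6)%R) / (sqrt 3 * w) *
   (a * Cexp (- ((a * x + b) * (a * x + b)) * (1 / 2)%R)))%C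
 with (Cexp (- (PI ^ 2 * nu ^ 2 / 6)%R / (w * w) - Ci * (PI * nu / 6)%R) *
    Cexp (- ((a * x + b) * (a * x + b)) * (1 / 2)%R))%C
 by (unfold a; field; split; assumption).
rewrite <- Cexp_plus; f_equal; unfold b, a.
assert (I2 : (Ci * Ci)%C = (-1)%R) by (unfold Ci, Cmult, RtoC; simpl; f_equal; ring).
replace (- ((sqrt 3 * w * x + (sqrt 3 * w * (1 / 6)%R - Ci * (PI * nu)%R / (sqrt 3 * w))) *
     (sqrt 3 * w * x + (sqrt 3 * w * (1 / 6)%R - Ci * (PI * nu)%R / (sqrt 3 * w)))) * (1 / 2)%R)%C
 with ((- ((sqrt 3 * sqrt 3) * w * w * (x + (1 / 6)%R) * (x + (1 / 6)%R)) + 2 * Ci * (PI * nu)%R * (x + (1 / 6)%R)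
   - (Ci * Ci) * (PI * nu)%R * (PI * nu)%R / ((sqrt 3 * sqrt 3) * (w * w))) * (1 / 2)%R)%C
 by (field; split; assumption).
rewrite S3, I2.
assert (N3 : RtoC 3 <> 0) by (intro E; apply RtoC_inj in E; lra).
assert (N2 : RtoC 2 <> 0) by (intro E; apply RtoC_inj in E; lra).
assert (N6 : RtoC 6 <> 0) by (intro E; apply RtoC_inj in E; lra).
unfold Rdiv; repeat rewrite ?RtoC_mult, ?RtoC_plus, ?RtoC_pow, ?RtoC_inv by lra.
assert (E6 : RtoC 6 = (2 * 3)%C) by (rewrite <- RtoC_mult; f_equal; ring).
rewrite E6; simpl Cpow; replace (RtoC (-1)) with (- (1))%C by (unfold RtoC, Copp; simpl; f_equal; ring).
field; repeat split; assumption.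
Qed.

Lemma is_lim_theta (w : C) (nu : R) : Rabs (snd w) < fst w ->
  is_lim_seq (fun M => RInt (theta_re (w * w) nu) (- (INR M + 1 / 2)) (INR M + 1 / 2)) (fst (theta_hat w nu)) /\
  is_lim_seq (fun M => RInt (theta_im (w * w) nu) (- (INR M + 1 / 2)) (INR M + 1 / 2)) (snd (theta_hat w nu)).
Proof.
intro Hw.
assert (Hp : 0 < fst w) by (pose proof (Rabs_pos (snd w)); lra).
assert (Hw0 : w <> 0) by (apply Cneq0_fst, Hp).
assert (s0 : 0 < sqrt 3) by (apply sqrt_lt_R0; lra).
pose proof (fun x => theta_gauss w nu x Hw0) as T; cbv zeta in T.
unfold theta_hat.
set (c := (Cexp (- (PI ^ 2 * nu ^ 2 / 6)%R / (w * w) - Ci * (PI * nu / 6)%R) / (sqrt 3 * w))%C) in *.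
set (a := (sqrt 3 * w)%C) in *; set (b := (a * (1 / 6)%R - Ci * (PI * nu)%R / a)%C) in *.
assert (Ha : Rabs (snd a) < fst a).
{ unfold a; destruct w as [p r]; simpl in *.
  replace (sqrt 3 * r + 0 * p) with (sqrt 3 * r) by ring; rewrite Rabs_mult, (Rabs_right (sqrt 3)) by lra; nra. }
pose proof (complex_gauss (fst a) (snd a) (fst b) (snd b) Ha) as G.
assert (L1 : is_lim_seq (fun M => RInt (gauss_re (fst a) (snd a) (fst b) (snd b) 1) (- (INR M + 1 / 2)) (INR M + 1 / 2)) (sqrt (2 * PI))).
{ apply is_lim_seq_spec; intros eps; destruct (G (eps / 2)) as [X0 [H0 HX]]; [destruct eps; simpl; lra|].
  destruct (nfloor_ex X0 ltac:(lra)) as [N HN]; exists (S N); intros n Hn.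
  assert (X0 <= INR n + 1 / 2) by (apply le_INR in Hn; rewrite S_INR in Hn; lra).
  destruct (HX _ H) as [K _]; destruct eps; simpl in *; lra. }
assert (L2 : is_lim_seq (fun M => RInt (gauss_im (fst a) (snd a) (fst b) (snd b) 1) (- (INR M + 1 / 2)) (INR M + 1 / 2)) 0).
{ apply is_lim_seq_spec; intros eps; destruct (G (eps / 2)) as [X0 [H0 HX]]; [destruct eps; simpl; lra|].
  destruct (nfloor_ex X0 ltac:(lra)) as [N HN]; exists (S N); intros n Hn.
  assert (X0 <= INR n + 1 / 2) by (apply le_INR in Hn; rewrite S_INR in Hn; lra).
  destruct (HX _ H) as [_ K]; rewrite Rminus_0_r; destruct eps; simpl in *; lra. }
assert (E1 : forall X, ex_RInt (gauss_re (fst a) (snd a) (fst b) (snd b) 1) (- X) X)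
  by (intro; apply ex_RInt_derivable; intro; unfold gauss_re; auto_derive; exact I).
assert (E2 : forall X, ex_RInt (gauss_im (fst a) (snd a) (fst b) (snd b) 1) (- X) X)
  by (intro; apply ex_RInt_derivable; intro; unfold gauss_im; auto_derive; exact I).
assert (E3 : forall X k, ex_RInt (fun x => scal k (gauss_re (fst a) (snd a) (fst b) (snd b) 1 x)) (- X) X)
  by (intros; apply (ex_RInt_scal (V := R_NormedModule)), E1).
assert (E4 : forall X k, ex_RInt (fun x => scal k (gauss_im (fst a) (snd a) (fst b) (snd b) 1 x)) (- X) X)
  by (intros; apply (ex_RInt_scal (V := R_NormedModule)), E2).
split.
- replace (Finite (fst (sqrt (2 * PI) * c)%C)) with (Finite (fst c * sqrt (2 * PI) - snd c * 0))
    by (f_equal; destruct c; simpl; ring).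
  apply is_lim_seq_ext with (fun M => fst c * RInt (gauss_re (fst a) (snd a) (fst b) (snd b) 1) (- (INR M + 1 / 2)) (INR M + 1 / 2)
    - snd c * RInt (gauss_im (fst a) (snd a) (fst b) (snd b) 1) (- (INR M + 1 / 2)) (INR M + 1 / 2)).
  + intro M; set (X := INR M + 1 / 2).
    rewrite (RInt_ext (theta_re _ _) (fun x => minus (scal (fst c) (gauss_re (fst a) (snd a) (fst b) (snd b) 1 x))
        (scal (snd c) (gauss_im (fst a) (snd a) (fst b) (snd b) 1 x)))).
    * rewrite (RInt_minus (V := R_CompleteNormedModule)), !(RInt_scal (V := R_CompleteNormedModule)) by auto; reflexivity.
    * intros x _; apply (f_equal fst (T x)).
  + apply is_lim_seq_minus'; apply is_lim_seq_mult'; auto using is_lim_seq_const.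
- replace (Finite (snd (sqrt (2 * PI) * c)%C)) with (Finite (fst c * 0 + snd c * sqrt (2 * PI)))
    by (f_equal; destruct c; simpl; ring).
  apply is_lim_seq_ext with (fun M => fst c * RInt (gauss_im (fst a) (snd a) (fst b) (snd b) 1) (- (INR M + 1 / 2)) (INR M + 1 / 2)
    + snd c * RInt (gauss_re (fst a) (snd a) (fst b) (snd b) 1) (- (INR M + 1 / 2)) (INR M + 1 / 2)).
  + intro M; set (X := INR M + 1 / 2).
    rewrite (RInt_ext (theta_im _ _) (fun x => plus (scal (fst c) (gauss_im (fst a) (snd a) (fst b) (snd b) 1 x))
        (scal (snd c) (gauss_re (fst a) (snd a) (fst b) (snd b) 1 x)))).
    * rewrite (RInt_plus (V := R_CompleteNormedModule)), !(RInt_scal (V := R_CompleteNormedModule)) by auto; reflexivity.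
    * intros x _; apply (f_equal snd (T x)).
  + apply is_lim_seq_plus'; apply is_lim_seq_mult'; auto using is_lim_seq_const.
Qed.

(** Telescoping comparison 2/(1 + n^2) <= 4/n - 4/(n + 1); what counts later is a bound independent
    of M. *)
Lemma zsum_inv_sqr (K : R) (M : nat) : 0 <= K ->
  zsum (fun c => K / (1 + c ^ 2)) M <= K * (9 - 4 / INR (S M)).
Proof.
intro HK; induction M as [|M IH].
- change (K / (1 + 0 ^ 2) <= K * (9 - 4 / 1)); replace (K / (1 + 0 ^ 2)) with K by field; lra.
- change (zsum (fun c => K / (1 + c ^ 2)) (S M)) with
    (zsum (fun c => K / (1 + c ^ 2)) M + K / (1 + INR (S M) ^ 2) + K / (1 + (- INR (S M)) ^ 2)).
  replace ((- INR (S M)) ^ 2) with (INR (S M) ^ 2) by ring.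
  set (n := INR (S M)) in *; rewrite (S_INR (S M)); fold n.
  assert (Hn : 0 < n) by (apply lt_0_INR; lia).
  assert (E : 2 / (1 + n ^ 2) <= 4 / n - 4 / (n + 1)).
  { replace (4 / n - 4 / (n + 1)) with (2 / (n * (n + 1) / 2)) by (field; lra).
    assert (Hn1 : 1 <= n) by (unfold n; rewrite S_INR; pose proof (pos_INR M); lra).
    unfold Rdiv at 1 2; apply Rmult_le_compat_l; [lra|apply Rinv_le_contravar; nra]. }
  apply (Rmult_le_compat_l K) in E; [|exact HK].
  unfold Rdiv in *; nra.
Qed.

(** Supplies the summable Lipschitz constants that [poisson] asks for: mean value theorem, then
    Gaussian decay against (1 + s^2)^2 with s = x + 1/6. The 4 in the derivative bound stands for
    pi. *)
Lemma theta_lipschitz (z : C) : 0 < fst z -> exists K, 0 <= K /\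
  forall c y, - (1 / 2) <= y <= 1 / 2 ->
    Rabs (theta_re z 1 (y + c) - theta_re z 1 c) <= K / (1 + c ^ 2) * Rabs y /\
    Rabs (theta_im z 1 (y + c) - theta_im z 1 c) <= K / (1 + c ^ 2) * Rabs y.
Proof.
intro Hz; set (c0 := 3 / 2 * fst z); assert (Hc0 : 0 < c0) by (unfold c0; lra).
destruct (pow_le_exp 2 c0 Hc0) as [K2 [HK HK2]].
set (L := 3 * fst z + 3 * Rabs (snd z) + 4).
assert (HL : 0 < L) by (unfold L; pose proof (Rabs_pos (snd z)); lra).
exists (L * 2 * (K2 * exp c0)); split.
{ pose proof (exp_pos c0); repeat apply Rmult_le_pos; lra. }
intros c y Hy.
assert (B : forall x, Rabs (x - c) <= 1 / 2 ->
  exp (- (3 / 2 * fst z * ((x + 1 / 6) * (x + 1 / 6)))) * (3 * fst z * Rabs (x + 1 / 6) + (4 + 3 * Rabs (snd z) * Rabs (x + 1 / 6)))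
    <= L * 2 * (K2 * exp c0) / (1 + c ^ 2)).
{ intros x Hx; fold c0; set (s := x + 1 / 6).
  assert (Hs : 1 + c ^ 2 <= 2 * (1 + s ^ 2)).
  { assert (Hd : - (2 / 3) <= s - c <= 2 / 3).
    { unfold Rabs in Hx; destruct (Rcase_abs (x - c)); unfold s; lra. }
    pose proof (pow2_ge_0 (2 * s - c)); nra. }
  assert (Hs1 : Rabs s <= 1 + s ^ 2) by (rewrite <- (pow2_abs s); pose proof (Rabs_pos s); nra).
  assert (Hs2 : 3 * fst z * Rabs s + (4 + 3 * Rabs (snd z) * Rabs s) <= L * (1 + s ^ 2)).
  { unfold L; pose proof (Rabs_pos (snd z)); nra. }
  specialize (HK2 (1 + s ^ 2) ltac:(nra)).
  replace (c0 * (1 + s ^ 2)) with (c0 + c0 * (s * s)) in HK2 by ring; rewrite exp_plus in HK2.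
  assert (Hc : 0 < 1 + c ^ 2) by nra.
  apply Rmult_le_reg_r with (1 + c ^ 2); [exact Hc|].
  replace (L * 2 * (K2 * exp c0) / (1 + c ^ 2) * (1 + c ^ 2)) with (L * 2 * (K2 * exp c0)) by (field; lra).
  rewrite exp_Ropp; pose proof (exp_pos (c0 * (s * s))) as P.
  apply Rmult_le_reg_r with (exp (c0 * (s * s))); [exact P|].
  replace (/ exp (c0 * (s * s)) * (3 * fst z * Rabs s + (4 + 3 * Rabs (snd z) * Rabs s)) * (1 + c ^ 2) * exp (c0 * (s * s)))
    with ((3 * fst z * Rabs s + (4 + 3 * Rabs (snd z) * Rabs s)) * (1 + c ^ 2)) by (field; lra).
  apply Rle_trans with (L * (1 + s ^ 2) * (2 * (1 + s ^ 2))).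
  - apply Rmult_le_compat; [|lra|exact Hs2|exact Hs].
    pose proof (Rabs_pos s); pose proof (Rabs_pos (snd z)); nra.
  - replace (L * (1 + s ^ 2) * (2 * (1 + s ^ 2))) with (L * 2 * (1 + s ^ 2) ^ 2) by ring.
    replace (L * 2 * (K2 * exp c0) * exp (c0 * (s * s))) with (L * 2 * (K2 * (exp c0 * exp (c0 * (s * s))))) by ring.
    apply Rmult_le_compat_l; lra. }
assert (MV : forall f df : R -> R, (forall x, is_derive f x (df x)) ->
  (forall x, Rabs (df x) <= exp (- (3 / 2 * fst z * ((x + 1 / 6) * (x + 1 / 6)))) * (3 * fst z * Rabs (x + 1 / 6) + (4 + 3 * Rabs (snd z) * Rabs (x + 1 / 6)))) ->
  Rabs (f (y + c) - f c) <= L * 2 * (K2 * exp c0) / (1 + c ^ 2) * Rabs y).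
{ intros f df Hf Hdf.
  destruct (MVT_gen f c (y + c) df) as [m [Hm1 Hm2]].
  - intros x _; apply Hf.
  - intros x _; apply continuity_pt_filterlim.
    apply (ex_derive_continuous (V := R_NormedModule) f); eexists; apply Hf.
  - rewrite Hm2; replace (y + c - c) with y by ring; rewrite Rabs_mult.
    apply Rmult_le_compat_r; [apply Rabs_pos|].
    eapply Rle_trans; [apply Hdf|apply B].
    unfold Rmin, Rmax in Hm1; destruct (Rle_dec c (y + c)); apply Rabs_le; lra. }
assert (TB : forall A C S s, Rabs C <= 1 -> Rabs S <= 1 ->
  Rabs (A * (- (3 * fst z * s) * C + (PI - 3 * snd z * s) * S)) <= Rabs A * (3 * fst z * Rabs s + (4 + 3 * Rabs (snd z) * Rabs s))).
{ intros A C S s HC HS; rewrite Rabs_mult; apply Rmult_le_compat_l; [apply Rabs_pos|].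
  eapply Rle_trans; [apply Rabs_triang|].
  assert (T1 : Rabs (- (3 * fst z * s) * C) <= 3 * fst z * Rabs s).
  { rewrite Rabs_mult, Rabs_Ropp, !Rabs_mult, (Rabs_right 3), (Rabs_right (fst z)) by lra.
    pose proof (Rabs_pos s); assert (0 <= 3 * fst z * Rabs s) by (apply Rmult_le_pos; lra); nra. }
  assert (T2 : Rabs (PI - 3 * snd z * s) <= 4 + 3 * Rabs (snd z) * Rabs s).
  { unfold Rminus; eapply Rle_trans; [apply Rabs_triang|].
    rewrite Rabs_Ropp, !Rabs_mult, (Rabs_right 3), (Rabs_right PI) by (pose proof PI_RGT_0; lra).
    pose proof PI_4; lra. }
  assert (T3 : Rabs ((PI - 3 * snd z * s) * S) <= 4 + 3 * Rabs (snd z) * Rabs s).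
  { rewrite Rabs_mult; pose proof (Rabs_pos (PI - 3 * snd z * s)); nra. }
  lra. }
split.
- apply (MV (theta_re z 1) (fun x => exp (- (3 / 2 * fst z * ((x + 1 / 6) * (x + 1 / 6)))) *
   (- (3 * fst z * (x + 1 / 6)) * cos (PI * 1 * x - 3 / 2 * snd z * ((x + 1 / 6) * (x + 1 / 6)))
    + (PI - 3 * snd z * (x + 1 / 6)) * (- sin (PI * 1 * x - 3 / 2 * snd z * ((x + 1 / 6) * (x + 1 / 6))))))).
  + intro x; unfold theta_re; auto_derive; [exact I|unfold Rminus, Rdiv; field].
  + intro x; eapply Rle_trans; [apply TB|].
    * apply Rabs_le, COS_bound.
    * rewrite Rabs_Ropp; apply Rabs_le, SIN_bound.
    * rewrite (Rabs_right (exp _)) by (left; apply exp_pos); lra.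
- apply (MV (theta_im z 1) (fun x => exp (- (3 / 2 * fst z * ((x + 1 / 6) * (x + 1 / 6)))) *
   (- (3 * fst z * (x + 1 / 6)) * sin (PI * 1 * x - 3 / 2 * snd z * ((x + 1 / 6) * (x + 1 / 6)))
    + (PI - 3 * snd z * (x + 1 / 6)) * (cos (PI * 1 * x - 3 / 2 * snd z * ((x + 1 / 6) * (x + 1 / 6))))))).
  + intro x; unfold theta_im; auto_derive; [exact I|unfold Rminus, Rdiv; field].
  + intro x; eapply Rle_trans; [apply TB|].
    * apply Rabs_le, SIN_bound.
    * apply Rabs_le, COS_bound.
    * rewrite (Rabs_right (exp _)) by (left; apply exp_pos); lra.
Qed.

Lemma cos_sin_nPI (n : nat) : cos (INR n * PI) = (-1) ^ n /\ sin (INR n * PI) = 0.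
Proof.
split; [|apply sin_INR_PI].
induction n as [|n IH]; [simpl; rewrite Rmult_0_l; apply cos_0|].
rewrite S_INR, Rmult_plus_distr_r, Rmult_1_l, neg_cos, IH; simpl; ring.
Qed.

Lemma tri_INR (n : nat) : INR (tri n) = INR n * (INR n + 1) / 2.
Proof.
induction n as [|n IH]; [simpl; field|].
change (tri (S n)) with (tri n + S n)%nat; rewrite plus_INR, IH, S_INR; field.
Qed.

Lemma Cexp_theta (z : C) (n : nat) (x : R) : Rabs x = INR n ->
  (theta_re z 1 x, theta_im z 1 x) =
  (Cexp (- (z * (1 / 24)%R)) * ((-1) ^ n * Cexp (- (z * (3 / 2 * x * x + x / 2)%R))))%C.
Proof.
intro Hx.
assert (HC : cos (PI * 1 * x) = (-1) ^ n /\ sin (PI * 1 * x) = 0).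
{ destruct (cos_sin_nPI n) as [H1 H2]; unfold Rabs in Hx; destruct (Rcase_abs x).
  - replace (PI * 1 * x) with (- (INR n * PI)) by (rewrite <- Hx; ring); rewrite cos_neg, sin_neg, H1, H2; split; ring.
  - replace (PI * 1 * x) with (INR n * PI) by (rewrite <- Hx; ring); auto. }
destruct HC as [H1 H2].
replace (RtoC (-1) ^ n)%C with (RtoC ((-1) ^ n)) by apply RtoC_pow.
rewrite Cmult_comm, <- Cmult_assoc, <- Cexp_plus.
destruct z as [a b]; unfold theta_re, theta_im; cbn [fst snd].
rewrite cos_minus, sin_minus, H1, H2.
unfold Cexp, Cmult, Cplus, Copp, RtoC; cbn [fst snd].
replace (- (a * (3 / 2 * x * x + x / 2) - b * 0) + - (a * (1 / 24) - b * 0))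
  with (- (3 / 2 * a * ((x + 1 / 6) * (x + 1 / 6)))) by field.
replace (- (a * 0 + b * (3 / 2 * x * x + x / 2)) + - (a * 0 + b * (1 / 24)))
  with (- (3 / 2 * b * ((x + 1 / 6) * (x + 1 / 6)))) by field.
rewrite cos_neg, sin_neg; f_equal; ring.
Qed.

Lemma zsum_theta (z : C) (M : nat) :
  (zsum (theta_re z 1) M, zsum (theta_im z 1) M) =
  (Cexp (- (z * (1 / 24)%R)) * pent_sum (Cexp (- z)) M)%C.
Proof.
induction M as [|M IH].
- change (zsum (theta_re z 1) 0) with (theta_re z 1 0); change (zsum (theta_im z 1) 0) with (theta_im z 1 0).
  rewrite (Cexp_theta z 0 0) by (rewrite Rabs_R0; reflexivity).
  simpl; replace (- (z * (3 / 2 * 0 * 0 + 0 / 2)%R))%C with (RtoC 0).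
  + rewrite Cexp_0; eq_in_C; ring.
  + replace (3 / 2 * 0 * 0 + 0 / 2) with 0 by field; eq_in_C; ring.
- change (zsum (theta_re z 1) (S M)) with (zsum (theta_re z 1) M + theta_re z 1 (INR (S M)) + theta_re z 1 (- INR (S M))).
  change (zsum (theta_im z 1) (S M)) with (zsum (theta_im z 1) M + theta_im z 1 (INR (S M)) + theta_im z 1 (- INR (S M))).
  transitivity ((zsum (theta_re z 1) M, zsum (theta_im z 1) M) + (theta_re z 1 (INR (S M)), theta_im z 1 (INR (S M)))
     + (theta_re z 1 (- INR (S M)), theta_im z 1 (- INR (S M))))%C; [reflexivity|].
  rewrite IH, (Cexp_theta z (S M) (INR (S M))), (Cexp_theta z (S M) (- INR (S M)));
    [|rewrite Rabs_Ropp; apply Rabs_right, Rle_ge, pos_INR|apply Rabs_right, Rle_ge, pos_INR].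
  change (pent_sum (Cexp (- z)) (S M)) with
    (pent_sum (Cexp (- z)) M + (-1) ^ S M * (Cexp (- z) ^ (S M * S M + tri M) + Cexp (- z) ^ (S M * S M + tri (S M))))%C.
  rewrite !Cexp_pow.
  replace (RtoC (INR (S M * S M + tri M)) * - z)%C
    with (- (z * (3 / 2 * - INR (S M) * - INR (S M) + - INR (S M) / 2)%R))%C.
  2:{ rewrite plus_INR, mult_INR, tri_INR, S_INR.
      replace (3 / 2 * - (INR M + 1) * - (INR M + 1) + - (INR M + 1) / 2)
        with ((INR M + 1) * (INR M + 1) + INR M * (INR M + 1) / 2) by field; ring. }
  replace (RtoC (INR (S M * S M + tri (S M))) * - z)%C
    with (- (z * (3 / 2 * INR (S M) * INR (S M) + INR (S M) / 2)%R))%C.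
  2:{ rewrite plus_INR, mult_INR, tri_INR, S_INR.
      replace (3 / 2 * (INR M + 1) * (INR M + 1) + (INR M + 1) / 2)
        with ((INR M + 1) * (INR M + 1) + (INR M + 1) * (INR M + 1 + 1) / 2) by field; ring. }
  eq_in_C; ring.
Qed.

(** Mode k of the function with frequency 1 splits into the odd frequencies 1 - 2k and 1 + 2k, so
    every Fourier integral is expressed by [theta_hat] at odd numbers. *)
Lemma RInt_theta_cos (z : C) (k : nat) (a b : R) :
  RInt (fun x => theta_re z 1 x * cos (2 * PI * INR k * x)) a b =
    / 2 * (RInt (theta_re z (1 - 2 * INR k)) a b + RInt (theta_re z (1 + 2 * INR k)) a b) /\
  RInt (fun x => theta_im z 1 x * cos (2 * PI * INR k * x)) a b =
    / 2 * (RInt (theta_im z (1 - 2 * INR k)) a b + RInt (theta_im z (1 + 2 * INR k)) a b).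
Proof.
assert (E1 : forall nu, ex_RInt (theta_re z nu) a b) by (intro; apply ex_RInt_derivable; intro; unfold theta_re; auto_derive; exact I).
assert (E2 : forall nu, ex_RInt (theta_im z nu) a b) by (intro; apply ex_RInt_derivable; intro; unfold theta_im; auto_derive; exact I).
split.
- rewrite (RInt_ext _ (fun x => scal (/ 2) (plus (theta_re z (1 - 2 * INR k) x) (theta_re z (1 + 2 * INR k) x)))).
  + rewrite (RInt_scal (V := R_CompleteNormedModule)), (RInt_plus (V := R_CompleteNormedModule)); auto.
    apply (ex_RInt_plus (V := R_NormedModule)); auto.
  + intros x _; unfold scal, plus; simpl; unfold mult; simpl; eq_in_R; unfold theta_re.
    set (u := 3 / 2 * snd z * _).
    replace (PI * (1 - 2 * INR k) * x - u) with ((PI * 1 * x - u) - 2 * PI * INR k * x) by ring.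
    replace (PI * (1 + 2 * INR k) * x - u) with ((PI * 1 * x - u) + 2 * PI * INR k * x) by ring.
    rewrite (cos_plus (PI * 1 * x - u)), (cos_minus (PI * 1 * x - u)); field.
- rewrite (RInt_ext _ (fun x => scal (/ 2) (plus (theta_im z (1 - 2 * INR k) x) (theta_im z (1 + 2 * INR k) x)))).
  + rewrite (RInt_scal (V := R_CompleteNormedModule)), (RInt_plus (V := R_CompleteNormedModule)); auto.
    apply (ex_RInt_plus (V := R_NormedModule)); auto.
  + intros x _; unfold scal, plus; simpl; unfold mult; simpl; eq_in_R; unfold theta_im.
    set (u := 3 / 2 * snd z * _).
    replace (PI * (1 - 2 * INR k) * x - u) with ((PI * 1 * x - u) - 2 * PI * INR k * x) by ring.
    replace (PI * (1 + 2 * INR k) * x - u) with ((PI * 1 * x - u) + 2 * PI * INR k * x) by ring.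
    rewrite (sin_plus (PI * 1 * x - u)), (sin_minus (PI * 1 * x - u)); field.
Qed.

Lemma Cmod_theta_hat (w : C) (nu : R) : w <> 0 ->
  Cmod (theta_hat w nu) = sqrt (2 * PI) / (sqrt 3 * Cmod w) *
    exp (- (PI ^ 2 / 6 * nu ^ 2 * (fst (w * w)%C / Cmod w ^ 4))).
Proof.
intro Hw; unfold theta_hat.
assert (s0 : 0 < sqrt 3) by (apply sqrt_lt_R0; lra).
assert (S0 : RtoC (sqrt 3) <> 0) by (intro E; apply RtoC_inj in E; lra).
assert (P : 0 < Cmod w) by (apply Cmod_gt_0, Hw).
rewrite Cmod_mult, Cmod_div, Cmod_mult, !Cmod_R, Cmod_Cexp, (Rabs_right (sqrt _)), (Rabs_right (sqrt 3)) by
  (try (apply Cmult_neq_0; assumption); apply Rle_ge, sqrt_pos).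
replace (fst (- (PI ^ 2 * nu ^ 2 / 6)%R / (w * w) - Ci * (PI * nu / 6)%R)%C)
  with (- (PI ^ 2 / 6 * nu ^ 2 * (fst (w * w)%C / Cmod w ^ 4))); [field; lra|].
replace (Cmod w ^ 4) with (Cmod (w * w) ^ 2) by (rewrite Cmod_mult; ring).
assert (P2 : 0 < Cmod (w * w) ^ 2) by (rewrite Cmod_mult; apply pow_lt, Rmult_lt_0_compat; lra).
rewrite Cmod_sqr in *; revert P2; generalize (w * w)%C; intros [x y] P2; simpl in *.
field; nra.
Qed.

(** The phases e^(-i pi/6) and e^(i pi/6) add up to 2 cos(pi/6) = sqrt 3, which cancels the sqrt 3
    left by completing the square. *)
Lemma theta_hat_main (w : C) : w <> 0 ->
  (theta_hat w 1 + theta_hat w (-1))%C = (sqrt (2 * PI) / w * Cexp (- (PI ^ 2 / 6)%R / (w * w)))%C.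
Proof.
intro Hw; unfold theta_hat.
assert (s0 : 0 < sqrt 3) by (apply sqrt_lt_R0; lra).
assert (S0 : RtoC (sqrt 3) <> 0) by (intro E; apply RtoC_inj in E; lra).
replace (PI ^ 2 * 1 ^ 2 / 6) with (PI ^ 2 / 6) by field.
replace (PI ^ 2 * (-1) ^ 2 / 6) with (PI ^ 2 / 6) by field.
replace (PI * 1 / 6) with (PI / 6) by field; replace (PI * -1 / 6) with (- (PI / 6)) by field.
unfold Cminus; rewrite !Cexp_plus.
assert (E : (Cexp (- (Ci * (PI / 6)%R)) + Cexp (- (Ci * (- (PI / 6))%R)))%C = sqrt 3).
{ unfold Cexp, Cplus, Cmult, Copp, Ci, RtoC; cbn [fst snd].
  replace (- (0 * (PI / 6) - 1 * 0)) with 0 by ring; replace (- (0 * - (PI / 6) - 1 * 0)) with 0 by ring.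
  replace (- (0 * 0 + 1 * (PI / 6))) with (- (PI / 6)) by ring; replace (- (0 * 0 + 1 * - (PI / 6))) with (PI / 6) by ring.
  rewrite cos_neg, sin_neg, cos_PI6, exp_0; f_equal; field. }
set (A := Cexp (- (PI ^ 2 / 6)%R / (w * w))) in *; set (X := Cexp (- (Ci * (PI / 6)%R))) in *; set (Y := Cexp (- (Ci * (- (PI / 6))%R))) in *.
replace (sqrt (2 * PI) * (A * X / (sqrt 3 * w)) + sqrt (2 * PI) * (A * Y / (sqrt 3 * w)))%C
  with (sqrt (2 * PI) * A * (X + Y) / (sqrt 3 * w))%C by (field; split; assumption).
rewrite E; field; split; assumption.
Qed.

(** A frequency nu contributes a term of size G rho^(nu^2). The frequencies 1 and -1 lead; all
    others have |nu| >= 3 and are smaller by rho^8, which is below e^(-1/|z|). The slope 1/5 is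
    tan(phi1/2), so w^2 has argument at most [phi1] in absolute value. *)
Lemma euler_function_estimate (w l : C) : let z := (w * w)%C in
  0 < fst w -> Rabs (snd w) <= fst w / 5 -> Cmod z <= 1 ->
  Clim (qpoch (Cexp (- z))) l ->
  Cmod (l - sqrt (2 * PI) / w * Cexp (z * (1 / 24)%R - (PI ^ 2 / 6)%R / z)) <=
    6 * exp (- / Cmod z) * Cmod (sqrt (2 * PI) / w * Cexp (z * (1 / 24)%R - (PI ^ 2 / 6)%R / z)).
Proof.
intros z Hw Hw5 Ht Hl.
assert (Hw1 : Rabs (snd w) < fst w) by lra.
assert (Hw0 : w <> 0) by (apply Cneq0_fst, Hw).
assert (Hz0 : z <> 0) by (apply Cmult_neq_0; assumption).
assert (Pw : 0 < Cmod w) by (apply Cmod_gt_0, Hw0).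
assert (Pz : 0 < Cmod z) by (apply Cmod_gt_0, Hz0).
assert (Hzre : 12 / 13 * Cmod z <= fst z).
{ unfold z; rewrite Cmod_mult; replace (Cmod w * Cmod w) with (Cmod w ^ 2) by ring; rewrite Cmod_sqr.
  assert (snd w ^ 2 <= (fst w / 5) ^ 2) by (rewrite <- (pow2_abs (snd w)); apply pow_incr; split; [apply Rabs_pos|exact Hw5]).
  replace (fst (w * w)%C) with (fst w ^ 2 - snd w ^ 2) by (destruct w; simpl; ring). nra. }
assert (Hz : 0 < fst z) by nra.
set (q := Cexp (- z)) in *.
assert (Hq : Cmod q < 1).
{ unfold q; rewrite Cmod_Cexp, <- exp_0; apply exp_increasing; destruct z; simpl in *; lra. }
set (T := (Cexp (- (z * (1 / 24)%R)) * l)%C).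
assert (HT : is_lim_seq (zsum (theta_re z 1)) (fst T) /\ is_lim_seq (zsum (theta_im z 1)) (snd T)).
{ pose proof (pentagonal q l Hq Hl) as HP.
  assert (G : forall eps : posreal, exists N, forall n, (N <= n)%nat ->
    Cmod ((zsum (theta_re z 1) n, zsum (theta_im z 1) n) - T) < eps).
  { intros eps; set (c := Cmod (Cexp (- (z * (1 / 24)%R)))).
    assert (Pc : 0 < c) by (apply Cmod_gt_0, Cexp_neq_0).
    destruct (HP (eps / (2 * c))) as [N HN].
    { apply Rdiv_lt_0_compat; [apply cond_pos|lra]. }
    exists N; intros n Hn; specialize (HN n Hn).
    rewrite zsum_theta; unfold T; fold q.
    replace (Cexp (- (z * (1 / 24)%R)) * pent_sum q n - Cexp (- (z * (1 / 24)%R)) * l)%C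
      with (Cexp (- (z * (1 / 24)%R)) * (pent_sum q n - l))%C by ring.
    rewrite Cmod_mult; fold c; apply (Rmult_le_compat_l c) in HN; [|lra].
    replace (c * (eps / (2 * c))) with (eps / 2) in HN by (field; lra).
    pose proof (cond_pos eps); lra. }
  split; apply is_lim_seq_spec; intro eps; destruct (G eps) as [N HN]; exists N; intros n Hn;
    (eapply Rle_lt_trans; [|apply (HN n Hn)]);
    [apply (abs_fst_le ((zsum (theta_re z 1) n, zsum (theta_im z 1) n) - T))
    |apply (abs_snd_le ((zsum (theta_re z 1) n, zsum (theta_im z 1) n) - T))]. }
destruct HT as [HT1 HT2].
set (G := sqrt (2 * PI) / (sqrt 3 * Cmod w)).
set (rho := exp (- (PI ^ 2 / 6 * (fst z / Cmod w ^ 4)))).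
assert (Pr : 0 < rho) by apply exp_pos.
assert (s2p : 0 < sqrt (2 * PI)) by (apply sqrt_lt_R0; pose proof PI_RGT_0; lra).
assert (s3 : 0 < sqrt 3) by (apply sqrt_lt_R0; lra).
assert (PG : 0 < G) by (apply Rdiv_lt_0_compat; [|apply Rmult_lt_0_compat]; assumption).
assert (Hzw : Cmod w ^ 4 = Cmod z ^ 2) by (unfold z; rewrite Cmod_mult; ring).
assert (Hrz : 12 / 13 * / Cmod z <= fst z / Cmod w ^ 4).
{ rewrite Hzw; apply Rmult_le_reg_r with (Cmod z ^ 2); [apply pow_lt, Pz|].
  replace (12 / 13 * / Cmod z * Cmod z ^ 2) with (12 / 13 * Cmod z) by (field; lra).
  replace (fst z / Cmod z ^ 2 * Cmod z ^ 2) with (fst z) by (field; lra); exact Hzre. }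
assert (Hiz : 1 <= / Cmod z) by (rewrite <- Rinv_1; apply Rinv_le_contravar; lra).
assert (HPI : 3 / 2 <= PI ^ 2 / 6) by (pose proof PI2_3_2; nra).
assert (Hr8 : rho ^ 8 <= exp (- / Cmod z)).
{ unfold rho; rewrite <- exp_INR_mult; apply exp_le; simpl INR; nra. }
assert (Hr2 : rho <= 1 / 2).
{ unfold rho; eapply Rle_trans; [apply exp_neg_le_inv; nra|].
  rewrite <- (Rinv_inv (1 / 2)); apply Rinv_le_contravar; [lra|]; nra. }
assert (Hhat : forall n : nat, forall nu, Rabs nu = INR n -> Cmod (theta_hat w nu) = G * rho ^ (n * n)).
{ intros n nu Hn; rewrite Cmod_theta_hat by exact Hw0; fold z G; f_equal.
  unfold rho; rewrite <- exp_INR_mult; f_equal; rewrite mult_INR, <- Hn.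
  replace (Rabs nu * Rabs nu) with (nu ^ 2) by (rewrite <- (pow2_abs nu); ring); ring. }
set (F := fun k : nat => (/ 2 * (theta_hat w (1 - 2 * INR k) + theta_hat w (1 + 2 * INR k)))%C).
assert (HF : forall k, Cmod (F (S (S k))) <= G * rho ^ 9 * (1 / 2) ^ k).
{ intro k; unfold F; rewrite Cmod_mult.
  replace (Cmod (/ 2)) with (/ 2) by (rewrite <- RtoC_inv by lra; rewrite Cmod_R, Rabs_right; lra).
  assert (B : forall n, (3 + k <= n)%nat -> rho ^ (n * n) <= rho ^ 9 * (1 / 2) ^ k).
  { intros n Hn; replace (n * n)%nat with (9 + (k + (n * n - 9 - k)))%nat by nia.
    rewrite !pow_add, <- (Rmult_1_r ((1 / 2) ^ k)).
    apply Rmult_le_compat_l; [apply pow_le; lra|].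
    apply Rmult_le_compat; try (apply pow_le; lra); [apply pow_incr; lra|].
    rewrite <- (pow1 (n * n - 9 - k)); apply pow_incr; lra. }
  assert (E1 : Cmod (theta_hat w (1 - 2 * INR (S (S k)))) = G * rho ^ ((2 * k + 3) * (2 * k + 3))).
  { apply Hhat; rewrite !S_INR, plus_INR, mult_INR, Rabs_left1; simpl; pose proof (pos_INR k); lra. }
  assert (E2 : Cmod (theta_hat w (1 + 2 * INR (S (S k)))) = G * rho ^ ((2 * k + 5) * (2 * k + 5))).
  { apply Hhat; rewrite !S_INR, plus_INR, mult_INR, Rabs_right; simpl; pose proof (pos_INR k); lra. }
  pose proof (Cmod_triangle (theta_hat w (1 - 2 * INR (S (S k)))) (theta_hat w (1 + 2 * INR (S (S k))))) as TT.
  rewrite E1, E2 in TT.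
  pose proof (B (2 * k + 3)%nat ltac:(lia)) as B1; pose proof (B (2 * k + 5)%nat ltac:(lia)) as B2.
  apply (Rmult_le_compat_l G) in B1; [|lra]; apply (Rmult_le_compat_l G) in B2; [|lra]; lra. }
assert (HS : forall f : C -> R, (forall c, Rabs (f c) <= Cmod c) ->
   forall N, rsum (fun k => 2 * Rabs (f (F (S (S k))))) N <= 4 * (G * rho ^ 9)).
{ intros f Hf N.
  assert (P9 : 0 <= G * rho ^ 9) by (apply Rmult_le_pos; [lra|apply pow_le; lra]).
  apply Rle_trans with (4 * (G * rho ^ 9) * (1 - (1 / 2) ^ N)).
  - induction N as [|N IH]; simpl; [lra|].
    specialize (Hf (F (S (S N)))); specialize (HF N).
    simpl; lra.
  - assert (0 <= (1 / 2) ^ N) by (apply pow_le; lra); nra. }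
destruct (theta_lipschitz z Hz) as [K [HK HL]].
assert (HD : forall M, zsum (fun c => K / (1 + c ^ 2)) M <= K * 9).
{ intro M; eapply Rle_trans; [apply zsum_inv_sqr, HK|]; apply Rmult_le_compat_l; [exact HK|].
  assert (0 < 4 / INR (S M)) by (apply Rdiv_lt_0_compat; [lra|apply lt_0_INR; lia]); lra. }
assert (R1 : Rabs (fst T - fst (F 0%nat) - 2 * fst (F 1%nat)) <= 4 * (G * rho ^ 9)).
{ apply (poisson (theta_re z 1) (fun c => K / (1 + c ^ 2)) (K * 9) (fst T) (4 * (G * rho ^ 9)) (fun k => fst (F k))).
  - intro; unfold theta_re; auto_derive; exact I.
  - intros c y Hy; apply (HL c y Hy).
  - exact HD.
  - exact HT1.
  - intro k; apply is_lim_seq_ext with (fun M => / 2 * (RInt (theta_re z (1 - 2 * INR k)) (- (INR M + 1 / 2)) (INR M + 1 / 2)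
      + RInt (theta_re z (1 + 2 * INR k)) (- (INR M + 1 / 2)) (INR M + 1 / 2)));
      [intro M; symmetry; exact (proj1 (RInt_theta_cos z k _ _))|].
    replace (fst (F k)) with (/ 2 * (fst (theta_hat w (1 - 2 * INR k)) + fst (theta_hat w (1 + 2 * INR k)))).
    + apply is_lim_seq_mult'; [apply is_lim_seq_const|apply is_lim_seq_plus'; exact (proj1 (is_lim_theta w _ Hw1))].
    + unfold F; rewrite <- RtoC_inv by lra; simpl; ring.
  - apply (HS fst abs_fst_le). }
assert (R2 : Rabs (snd T - snd (F 0%nat) - 2 * snd (F 1%nat)) <= 4 * (G * rho ^ 9)).
{ apply (poisson (theta_im z 1) (fun c => K / (1 + c ^ 2)) (K * 9) (snd T) (4 * (G * rho ^ 9)) (fun k => snd (F k))).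
  - intro; unfold theta_im; auto_derive; exact I.
  - intros c y Hy; apply (HL c y Hy).
  - exact HD.
  - exact HT2.
  - intro k; apply is_lim_seq_ext with (fun M => / 2 * (RInt (theta_im z (1 - 2 * INR k)) (- (INR M + 1 / 2)) (INR M + 1 / 2)
      + RInt (theta_im z (1 + 2 * INR k)) (- (INR M + 1 / 2)) (INR M + 1 / 2)));
      [intro M; symmetry; exact (proj2 (RInt_theta_cos z k _ _))|].
    replace (snd (F k)) with (/ 2 * (snd (theta_hat w (1 - 2 * INR k)) + snd (theta_hat w (1 + 2 * INR k)))).
    + apply is_lim_seq_mult'; [apply is_lim_seq_const|apply is_lim_seq_plus'; exact (proj2 (is_lim_theta w _ Hw1))].
    + unfold F; rewrite <- RtoC_inv by lra; simpl; ring.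
  - apply (HS snd abs_snd_le). }
assert (R3 : Cmod (T - F 0%nat - 2 * F 1%nat) <= 8 * (G * rho ^ 9)).
{ eapply Rle_trans; [apply Cmod_le_abs|].
  replace (fst (T - F 0%nat - 2 * F 1%nat)%C) with (fst T - fst (F 0%nat) - 2 * fst (F 1%nat)) by (simpl; ring).
  replace (snd (T - F 0%nat - 2 * F 1%nat)%C) with (snd T - snd (F 0%nat) - 2 * snd (F 1%nat)) by (simpl; ring).
  lra. }
set (M := (sqrt (2 * PI) / w * Cexp (- (PI ^ 2 / 6)%R / (w * w)))%C).
(* Mode 0 is [theta_hat w 1] and twice mode 1 is [theta_hat w (-1) + theta_hat w 3]; moving the last
   one to the error leaves the two leading frequencies. *)
assert (R4 : Cmod (T - M) <= 9 * (G * rho ^ 9)).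
{ replace (T - M)%C with ((T - F 0%nat - 2 * F 1%nat) + theta_hat w 3)%C.
  - eapply Rle_trans; [apply Cmod_triangle|].
    rewrite (Hhat 3%nat 3) by (rewrite Rabs_right; simpl; lra); change (3 * 3)%nat with 9%nat; lra.
  - unfold M; rewrite <- theta_hat_main by exact Hw0; unfold F.
    replace (1 - 2 * INR 0) with 1 by (simpl; ring); replace (1 + 2 * INR 0) with 1 by (simpl; ring).
    replace (1 - 2 * INR 1) with (-1) by (simpl; ring); replace (1 + 2 * INR 1) with 3 by (simpl; ring).
    field; intro E; apply RtoC_inj in E; lra. }
assert (EM : (sqrt (2 * PI) / w * Cexp (z * (1 / 24)%R - (PI ^ 2 / 6)%R / z))%C = (Cexp (z * (1 / 24)%R) * M)%C).
{ unfold M, Cminus; rewrite Cexp_plus; fold z.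
  replace (- ((PI ^ 2 / 6)%R / z))%C with (- (PI ^ 2 / 6)%R / z)%C by (field; exact Hz0); ring. }
assert (ET : l = (Cexp (z * (1 / 24)%R) * T)%C).
{ unfold T; rewrite Cmult_assoc, <- Cexp_plus.
  replace (z * (1 / 24)%R + - (z * (1 / 24)%R))%C with (RtoC 0) by ring; rewrite Cexp_0; ring. }
rewrite EM, ET.
replace (Cexp (z * (1 / 24)%R) * T - Cexp (z * (1 / 24)%R) * M)%C with (Cexp (z * (1 / 24)%R) * (T - M))%C by ring.
rewrite !Cmod_mult.
assert (MM : Cmod M = sqrt 3 * (G * rho)).
{ unfold M; rewrite Cmod_mult, Cmod_div, Cmod_R, Cmod_Cexp, Rabs_right by (exact Hw0 || lra).
  replace (exp (fst (- (PI ^ 2 / 6)%R / (w * w))%C)) with rho.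
  - unfold G; field; lra.
  - unfold rho; f_equal; rewrite Hzw; fold z.
    assert (P2 : 0 < Cmod z ^ 2) by apply pow_lt, Pz.
    rewrite Cmod_sqr in *; revert P2; clear; destruct z as [x y]; simpl; intro P2; field; nra. }
assert (PE : 0 < Cmod (Cexp (z * (1 / 24)%R))) by (apply Cmod_gt_0, Cexp_neq_0).
assert (s3b : 3 / 2 <= sqrt 3).
{ rewrite <- (sqrt_square (3 / 2)) by lra; apply sqrt_le_1_alt; lra. }
rewrite MM; replace (6 * exp (- / Cmod z) * (Cmod (Cexp (z * (1 / 24)%R)) * (sqrt 3 * (G * rho))))
  with (Cmod (Cexp (z * (1 / 24)%R)) * (6 * sqrt 3 * (G * rho * exp (- / Cmod z)))) by ring.
apply Rmult_le_compat_l; [lra|].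
eapply Rle_trans; [exact R4|].
replace (rho ^ 9) with (rho * rho ^ 8) by ring.
assert (0 < G * rho) by (apply Rmult_lt_0_compat; lra).
pose proof (exp_pos (- / Cmod z)).
assert (G * rho * rho ^ 8 <= G * rho * exp (- / Cmod z)) by (apply Rmult_le_compat_l; lra).
assert (0 < G * rho * exp (- / Cmod z)) by (apply Rmult_lt_0_compat; lra).
replace (G * (rho * rho ^ 8)) with (G * rho * rho ^ 8) by ring; nra.
Qed.

(** * Generating functions *)

Fixpoint nsum (f : nat -> nat) (n : nat) : nat :=
  match n with O => O | S m => (nsum f m + f m)%nat end.

(* [c j n] counts the partitions of [n] with parts at least [j]; [v j n] counts the parts
   equal to [j] in them. *)
Record spt_system (c v : nat -> nat -> nat) (a : nat -> nat) : Prop := {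
  sys_c0 : forall j, c j O = 1%nat;
  sys_c_small : forall j n, (0 < n < j)%nat -> c j n = O;
  sys_c_rec : forall j n, (1 <= j <= n)%nat -> c j n = (c j (n - j) + c (S j) n)%nat;
  sys_v_small : forall j n, (n < j)%nat -> v j n = O;
  sys_v_rec : forall j n, (1 <= j <= n)%nat -> v j n = (c j (n - j) + v j (n - j))%nat;
  sys_a : forall n, a n = nsum (fun j => v (S j) n) n
}.

Definition pser (b : nat -> nat) (q : C) (N : nat) : C := csum (fun n => RtoC (INR (b n)) * q ^ n)%C N.
Definition rser (b : nat -> nat) (r : R) (N : nat) : R := rsum (fun n => INR (b n) * r ^ n) N.

Lemma rser_incr (b : nat -> nat) (r : R) (N k : nat) : 0 <= r -> rser b r N <= rser b r (N + k).
Proof.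
intro Hr; induction k as [|k IH]; [rewrite Nat.add_0_r; lra|].
rewrite Nat.add_succ_r; unfold rser in *; simpl.
assert (0 <= INR (b (N + k)%nat) * r ^ (N + k)) by (apply Rmult_le_pos; [apply pos_INR|apply pow_le, Hr]); lra.
Qed.

Lemma pser_tail (b : nat -> nat) (q : C) (r : R) (N k : nat) : Cmod q <= r ->
  Cmod (pser b q (N + k) - pser b q N) <= rser b r (N + k) - rser b r N.
Proof.
intro Hq; pose proof (Cmod_ge_0 q) as H0; induction k as [|k IH].
- rewrite Nat.add_0_r; replace (_ - _)%C with (RtoC 0) by ring; rewrite Cmod_0; lra.
- rewrite Nat.add_succ_r; unfold pser, rser in *; simpl.
  match goal with |- Cmod (?a + ?b - ?c) <= _ => replace (a + b - c)%C with ((a - c) + b)%C by ring end.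
  eapply Rle_trans; [apply Cmod_triangle|].
  rewrite Cmod_mult, Cmod_pow, Cmod_R, Rabs_right by (apply Rle_ge, pos_INR).
  assert (INR (b (N + k)%nat) * Cmod q ^ (N + k) <= INR (b (N + k)%nat) * r ^ (N + k))
    by (apply Rmult_le_compat_l; [apply pos_INR|apply pow_incr; lra]).
  lra.
Qed.

Lemma Clim_unique (f : nat -> C) (l m : C) : Clim f l -> Clim f m -> l = m.
Proof.
intros H1 H2; apply Ceq_minus, Cmod_eq_0; apply Rle_antisym; [|apply Cmod_ge_0].
apply Rnot_lt_le; intro P.
destruct (H1 (Cmod (l - m) / 4) ltac:(lra)) as [N1 K1], (H2 (Cmod (l - m) / 4) ltac:(lra)) as [N2 K2].
specialize (K1 (N1 + N2)%nat ltac:(lia)); specialize (K2 (N1 + N2)%nat ltac:(lia)).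
pose proof (Cmod_triangle (f (N1 + N2)%nat - m) (- (f (N1 + N2)%nat - l))) as T; rewrite Cmod_opp in T.
replace (f (N1 + N2)%nat - m + - (f (N1 + N2)%nat - l))%C with (l - m)%C in T by ring; lra.
Qed.

Lemma Clim_bound (f : nat -> C) (l x : C) (B : R) :
  Clim f l -> (exists N, forall n, (N <= n)%nat -> Cmod (f n - x) <= B) -> Cmod (l - x) <= B.
Proof.
intros H [N HN]; apply Rnot_lt_le; intro P.
destruct (H ((Cmod (l - x) - B) / 2) ltac:(lra)) as [M HM].
specialize (HM (N + M)%nat ltac:(lia)); specialize (HN (N + M)%nat ltac:(lia)).
pose proof (Cmod_triangle (f (N + M)%nat - x) (- (f (N + M)%nat - l))) as T; rewrite Cmod_opp in T.
replace (f (N + M)%nat - x + - (f (N + M)%nat - l))%C with (l - x)%C in T by ring; lra.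
Qed.

Lemma Clim_ext (f g : nat -> C) (l : C) : (forall n, f n = g n) -> Clim f l -> Clim g l.
Proof. intros H K e He; destruct (K e He) as [N HN]; exists N; intros n Hn; rewrite <- H; auto. Qed.

Lemma Clim_const (l : C) : Clim (fun _ => l) l.
Proof. intros e He; exists O; intros; replace (l - l)%C with (RtoC 0) by ring; rewrite Cmod_0; lra. Qed.

Lemma Clim_plus (f g : nat -> C) (l m : C) : Clim f l -> Clim g m -> Clim (fun n => f n + g n)%C (l + m)%C.
Proof.
intros H1 H2 e He; destruct (H1 (e / 2) ltac:(lra)) as [N1 K1], (H2 (e / 2) ltac:(lra)) as [N2 K2].
exists (N1 + N2)%nat; intros n Hn; specialize (K1 n ltac:(lia)); specialize (K2 n ltac:(lia)).
replace (f n + g n - (l + m))%C with ((f n - l) + (g n - m))%C by ring.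
eapply Rle_trans; [apply Cmod_triangle|lra].
Qed.

Lemma Clim_scal (c : C) (f : nat -> C) (l : C) : Clim f l -> Clim (fun n => c * f n)%C (c * l)%C.
Proof.
intros H e He; pose proof (Cmod_ge_0 c) as Hc.
destruct (H (e / (Cmod c + 1))) as [N K]; [apply Rdiv_lt_0_compat; lra|].
exists N; intros n Hn; specialize (K n Hn).
replace (c * f n - c * l)%C with (c * (f n - l))%C by ring; rewrite Cmod_mult.
apply Rle_trans with (Cmod c * (e / (Cmod c + 1))); [apply Rmult_le_compat_l; assumption|].
replace e with ((Cmod c + 1) * (e / (Cmod c + 1))) at 2 by (field; lra).
apply Rmult_le_compat_r; [left; apply Rdiv_lt_0_compat; lra|lra].
Qed.

Lemma Clim_sub (f : nat -> C) (l : C) (k : nat) : Clim f l -> Clim (fun n => f (n - k)%nat) l.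
Proof. intros H e He; destruct (H e He) as [N K]; exists (N + k)%nat; intros; apply K; lia. Qed.

(** Absolute convergence at radius [r] dominates the whole disc: the truncation error at any q is at
    most the tail of one real series, hence uniform along the contour. *)
Lemma pser_conv (b : nat -> nat) (r B : R) : 0 <= r -> (forall N, rser b r N <= B) ->
  exists T : R, is_lim_seq (rser b r) T /\ (forall N, rser b r N <= T) /\
  forall q, Cmod q <= r -> exists l, Clim (pser b q) l /\
    forall N, Cmod (l - pser b q N) <= T - rser b r N.
Proof.
intros Hr HB.
assert (Inc : forall n, rser b r n <= rser b r (S n)).
{ intro n; replace (S n) with (n + 1)%nat by lia; apply rser_incr, Hr. }
destruct (ex_finite_lim_seq_incr (rser b r) B Inc HB) as [T HT].
assert (HT2 : forall N, rser b r N <= T).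
{ intro N; apply (is_lim_seq_incr_compare (rser b r) T HT Inc). }
exists T; split; [exact HT|split; [exact HT2|]].
intros q Hq.
assert (CS : forall f : C -> R, (forall x y, f (x - y)%C = f x - f y) -> (forall x, Rabs (f x) <= Cmod x) ->
   exists l : R, is_lim_seq (fun n => f (pser b q n)) l).
{ intros f Hf Hf2; apply ex_lim_seq_cauchy_corr; intros eps.
  apply is_lim_seq_spec in HT; destruct (HT (mkposreal (eps / 2) ltac:(destruct eps; simpl; lra))) as [N HN]; simpl in HN.
  exists N.
  assert (G : forall n m, (N <= n)%nat -> (n <= m)%nat -> Rabs (f (pser b q m) - f (pser b q n)) < eps).
  { intros n m Hn Hm; rewrite <- Hf; eapply Rle_lt_trans; [apply Hf2|].
    replace m with (n + (m - n))%nat by lia.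
    eapply Rle_lt_trans; [apply (pser_tail b q r), Hq|].
    pose proof (HT2 (n + (m - n))%nat); specialize (HN n Hn); apply Rabs_def2 in HN; destruct eps; simpl in *; lra. }
  intros n m Hn Hm; destruct (Nat.le_ge_cases n m).
  - rewrite Rabs_minus_sym; apply G; assumption.
  - apply G; assumption. }
destruct (CS fst) as [l1 H1]; [intros [] []; reflexivity|apply abs_fst_le|].
destruct (CS snd) as [l2 H2]; [intros [] []; reflexivity|apply abs_snd_le|].
assert (L : Clim (pser b q) (l1, l2)).
{ intros e He; apply is_lim_seq_spec in H1; apply is_lim_seq_spec in H2.
  destruct (H1 (mkposreal (e / 2) ltac:(lra))) as [N1 K1], (H2 (mkposreal (e / 2) ltac:(lra))) as [N2 K2]; simpl in *.
  exists (N1 + N2)%nat; intros n Hn; specialize (K1 n ltac:(lia)); specialize (K2 n ltac:(lia)).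
  eapply Rle_trans; [apply Cmod_le_abs|]; simpl; unfold Rminus in *; lra. }
exists (l1, l2); split; [exact L|].
intro N; apply Clim_bound with (pser b q); [exact L|].
exists N; intros n Hn; replace n with (N + (n - N))%nat by lia.
eapply Rle_trans; [apply (pser_tail b q r), Hq|]; apply Rplus_le_compat_r, HT2.
Qed.

Definition shiftn (j : nat) (b : nat -> nat) (n : nat) : nat := if (j <=? n)%nat then b (n - j)%nat else O.

Lemma pser_shift (j : nat) (b : nat -> nat) (q : C) (N : nat) :
  pser (shiftn j b) q N = (q ^ j * pser b q (N - j))%C.
Proof.
unfold pser; induction N as [|N IH]; [simpl; ring|].
change (csum (fun n => RtoC (INR (shiftn j b n)) * q ^ n)%C (S N)) with
  (csum (fun n => RtoC (INR (shiftn j b n)) * q ^ n)%C N + RtoC (INR (shiftn j b N)) * q ^ N)%C.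
rewrite IH; unfold shiftn; destruct (Nat.leb_spec j N) as [H|H].
- replace (S N - j)%nat with (S (N - j)) by lia; simpl csum.
  replace (q ^ N)%C with (q ^ j * q ^ (N - j))%C by (rewrite <- Cpow_add_r; f_equal; lia).
  eq_in_C; ring.
- replace (S N - j)%nat with O by lia; replace (N - j)%nat with O by lia; simpl; eq_in_C; ring.
Qed.

Lemma rser_shift (j : nat) (b : nat -> nat) (r : R) (N : nat) :
  rser (shiftn j b) r N = r ^ j * rser b r (N - j).
Proof.
unfold rser; induction N as [|N IH]; [simpl; ring|].
simpl rsum; rewrite IH; unfold shiftn; destruct (Nat.leb_spec j N) as [H|H].
- replace (S N - j)%nat with (S (N - j)) by lia.
  change (match j with O => S N | S l => (N - l)%nat end) with (S N - j)%nat; replace (S N - j)%nat with (S (N - j)) by lia; simpl rsum.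
  replace (r ^ N) with (r ^ j * r ^ (N - j)) by (rewrite <- pow_add; f_equal; lia).
  ring.
- change (match j with O => S N | S l => (N - l)%nat end) with (S N - j)%nat.
  replace (S N - j)%nat with O by lia; replace (N - j)%nat with O by lia; simpl; ring.
Qed.

Lemma pser_plus (b d e : nat -> nat) (q : C) (N : nat) :
  (forall n, (n < N)%nat -> b n = (d n + e n)%nat) -> pser b q N = (pser d q N + pser e q N)%C.
Proof.
unfold pser; induction N as [|N IH]; intro H; [simpl; ring|].
simpl csum; rewrite IH by (intros; apply H; lia); rewrite (H N) by lia.
rewrite plus_INR, RtoC_plus; eq_in_C; ring.
Qed.

Lemma rser_plus (b d e : nat -> nat) (r : R) (N : nat) :
  (forall n, (n < N)%nat -> b n = (d n + e n)%nat) -> rser b r N = rser d r N + rser e r N.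
Proof.
unfold rser; induction N as [|N IH]; intro H; [simpl; ring|].
simpl rsum; rewrite IH by (intros; apply H; lia); rewrite (H N) by lia.
rewrite plus_INR; ring.
Qed.

Lemma rser_le (b d : nat -> nat) (r : R) (N M : nat) : 0 <= r -> (N <= M)%nat ->
  (forall n, (n < N)%nat -> (b n <= d n)%nat) -> rser b r N <= rser d r M.
Proof.
intros Hr HN H; replace M with (N + (M - N))%nat by lia.
eapply Rle_trans; [|apply rser_incr, Hr].
apply rsum_le; intros i Hi; apply Rmult_le_compat_r; [apply pow_le, Hr|apply le_INR, H, Hi].
Qed.

(** For n < j the counts at j and j + 1 agree, so the recurrence holds for every n and becomes an
    identity of power series. *)
Lemma sys_c_shift (c v : nat -> nat -> nat) (a : nat -> nat) : spt_system c v a ->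
  forall j n, (1 <= j)%nat -> c j n = (shiftn j (c j) n + c (S j) n)%nat.
Proof.
intros Hs j n Hj; unfold shiftn; destruct (Nat.leb_spec j n) as [H|H].
- apply (sys_c_rec _ _ _ Hs); lia.
- destruct n as [|n].
  + rewrite !(sys_c0 _ _ _ Hs); reflexivity.
  + rewrite !(sys_c_small _ _ _ Hs) by lia; reflexivity.
Qed.

Lemma sys_v_shift (c v : nat -> nat -> nat) (a : nat -> nat) : spt_system c v a ->
  forall j n, (1 <= j)%nat -> v j n = (shiftn j (c j) n + shiftn j (v j) n)%nat.
Proof.
intros Hs j n Hj; unfold shiftn; destruct (Nat.leb_spec j n) as [H|H].
- apply (sys_v_rec _ _ _ Hs); lia.
- apply (sys_v_small _ _ _ Hs), H.
Qed.

Lemma inv_one_minus_le_exp (r : R) (j : nat) : 0 <= r < 1 -> (1 <= j)%nat ->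
  / (1 - r ^ j) <= exp (r ^ j / (1 - r)).
Proof.
intros Hr Hj.
assert (H : 0 <= r ^ j <= r).
{ split; [apply pow_le; lra|]; destruct j as [|j]; [lia|]; simpl.
  assert (r ^ j <= 1) by (rewrite <- (pow1 j); apply pow_incr; lra). nra. }
apply Rle_trans with (1 + r ^ j / (1 - r ^ j)); [right; field; lra|].
eapply Rle_trans; [apply exp_ineq|]; apply exp_le; unfold Rdiv; apply Rmult_le_compat_l; [lra|].
apply Rinv_le_contravar; lra.
Qed.

(** Convergence a priori, before the product formula is known. Partial sums satisfy C_j <=
    exp(r^j/(1 - r)) C_(j+1); iterating up to j = N + 1 leaves only the empty partition in degrees
    below N. *)
Lemma sys_c_bound (c v : nat -> nat -> nat) (a : nat -> nat) (r : R) : spt_system c v a -> 0 <= r < 1 ->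
  forall j N, (1 <= j)%nat -> rser (c j) r N <= exp (/ (1 - r) ^ 2).
Proof.
intros Hs Hr.
assert (Hc : forall j n, (1 <= j)%nat -> (c j n <= c 1%nat n)%nat).
{ intros j n Hj; induction j as [|j IH]; [lia|]; destruct j as [|j]; [lia|].
  pose proof (sys_c_shift _ _ _ Hs (S j) n ltac:(lia)); specialize (IH ltac:(lia)); lia. }
assert (St : forall j N, (1 <= j)%nat -> rser (c j) r N <= exp (r ^ j / (1 - r)) * rser (c (S j)) r N).
{ intros j N Hj.
  pose proof (pow_lt_1 r j Hr ltac:(lia)) as P1; pose proof (pow_le r j (proj1 Hr)) as P0.
  assert (E : (1 - r ^ j) * rser (c j) r N <= rser (c (S j)) r N).
  { rewrite (rser_plus (c j) (shiftn j (c j)) (c (S j)) r N) at 1 by (intros; apply (sys_c_shift _ _ _ Hs), Hj).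
    assert (r ^ j * rser (c j) r (N - j) <= r ^ j * rser (c j) r N)
      by (apply Rmult_le_compat_l; [exact P0|apply rser_le; [lra|lia|auto]]).
    rewrite rser_shift.
    assert (rser (c j) r N = r ^ j * rser (c j) r (N - j) + rser (c (S j)) r N).
    { rewrite <- rser_shift; apply rser_plus; intros; apply (sys_c_shift _ _ _ Hs), Hj. }
    nra. }
  assert (Q : 0 <= rser (c (S j)) r N) by (apply (rser_incr (c (S j)) r 0 N); lra).
  apply Rle_trans with (/ (1 - r ^ j) * rser (c (S j)) r N).
  - apply Rmult_le_reg_l with (1 - r ^ j); [lra|]; rewrite <- Rmult_assoc, Rinv_r, Rmult_1_l by lra; exact E.
  - apply Rmult_le_compat_r; [exact Q|apply inv_one_minus_le_exp; assumption]. }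
intros j N Hj.
apply Rle_trans with (rser (c 1%nat) r N).
{ apply rser_le; [lra|lia|intros; apply Hc, Hj]. }
assert (It : forall k, rser (c 1%nat) r N <= exp ((r - r ^ S k) / (1 - r) / (1 - r)) * rser (c (S k)) r N).
{ induction k as [|k IH].
  - replace ((r - r ^ 1) / (1 - r) / (1 - r)) with 0 by (simpl; field; lra); rewrite exp_0; lra.
  - eapply Rle_trans; [exact IH|].
    replace ((r - r ^ S (S k)) / (1 - r) / (1 - r)) with ((r - r ^ S k) / (1 - r) / (1 - r) + r ^ S k / (1 - r)) by (simpl; field; lra).
    rewrite exp_plus, Rmult_assoc; apply Rmult_le_compat_l; [left; apply exp_pos|apply St; lia]. }
eapply Rle_trans; [apply (It N)|].
assert (C1 : rser (c (S N)) r N <= 1).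
{ assert (G : forall m, (m <= N)%nat -> rser (c (S N)) r m <= 1).
  { induction m as [|m IH]; intro Hm; [unfold rser; simpl; lra|].
    unfold rser in *; simpl; destruct m as [|m].
    - simpl; rewrite (sys_c0 _ _ _ Hs); simpl; lra.
    - rewrite (sys_c_small _ _ _ Hs (S N) (S m)) by lia; simpl INR.
      specialize (IH ltac:(lia)); lra. }
  apply G; lia. }
pose proof (exp_pos ((r - r ^ S N) / (1 - r) / (1 - r))) as P.
apply Rle_trans with (exp ((r - r ^ S N) / (1 - r) / (1 - r))); [nra|].
apply exp_le.
replace (/ (1 - r) ^ 2) with (1 / (1 - r) / (1 - r)) by (field; lra).
assert (0 <= r ^ S N) by (apply pow_le; lra).
unfold Rdiv; apply Rmult_le_compat_r; [left; apply Rinv_0_lt_compat; lra|].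
apply Rmult_le_compat_r; [left; apply Rinv_0_lt_compat; lra|lra].
Qed.

Lemma sys_v_bound (c v : nat -> nat -> nat) (a : nat -> nat) (r : R) : spt_system c v a -> 0 <= r < 1 ->
  forall j N, (1 <= j)%nat -> rser (v j) r N <= r ^ j * (exp (/ (1 - r) ^ 2) / (1 - r)).
Proof.
intros Hs Hr j N Hj.
pose proof (pow_le r j (proj1 Hr)) as P0.
assert (P1 : r ^ j <= r).
{ destruct j as [|j]; [lia|]; simpl. assert (r ^ j <= 1) by (rewrite <- (pow1 j); apply pow_incr; lra). nra. }
assert (E : rser (v j) r N = r ^ j * rser (c j) r (N - j) + r ^ j * rser (v j) r (N - j)).
{ rewrite <- !rser_shift; apply rser_plus; intros; apply (sys_v_shift _ _ _ Hs), Hj. }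
pose proof (sys_c_bound c v a r Hs Hr j (N - j) Hj) as B.
assert (M : rser (v j) r (N - j) <= rser (v j) r N) by (apply rser_le; [lra|lia|auto]).
assert (Q : 0 <= rser (v j) r N) by (apply (rser_incr (v j) r 0 N); lra).
apply Rmult_le_reg_r with (1 - r); [lra|].
replace (r ^ j * (exp (/ (1 - r) ^ 2) / (1 - r)) * (1 - r)) with (r ^ j * exp (/ (1 - r) ^ 2)) by (field; lra).
assert (r ^ j * rser (c j) r (N - j) <= r ^ j * exp (/ (1 - r) ^ 2)) by (apply Rmult_le_compat_l; lra).
assert (r ^ j * rser (v j) r (N - j) <= r * rser (v j) r N) by nra.
lra.
Qed.

Lemma nsum_le (f : nat -> nat) (m n : nat) : (m <= n)%nat -> (nsum f m <= nsum f n)%nat.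
Proof. intro H; induction H; simpl; lia. Qed.

Lemma sys_nsum (c v : nat -> nat -> nat) (a : nat -> nat) : spt_system c v a ->
  forall n J, (nsum (fun j => v (S j) n) J <= a n)%nat /\ ((n <= J)%nat -> nsum (fun j => v (S j) n) J = a n).
Proof.
intros Hs n J; rewrite (sys_a _ _ _ Hs).
assert (E : (n <= J)%nat -> nsum (fun j => v (S j) n) J = nsum (fun j => v (S j) n) n).
{ intro H; induction H as [|m H IH]; [reflexivity|]; simpl.
  rewrite IH, (sys_v_small _ _ _ Hs (S m) n) by lia; lia. }
split; [|exact E].
destruct (Nat.le_ge_cases n J) as [H|H]; [rewrite E by exact H; lia|apply nsum_le, H].
Qed.

Lemma rser_nsum (v : nat -> nat -> nat) (r : R) (J N : nat) :
  rser (fun n => nsum (fun j => v (S j) n) J) r N = rsum (fun j => rser (v (S j)) r N) J.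
Proof.
induction J as [|J IH].
- unfold rser; simpl; induction N as [|N IH]; simpl; [reflexivity|rewrite IH; ring].
- simpl rsum; rewrite <- IH; apply rser_plus; intros; reflexivity.
Qed.

Lemma pser_nsum (v : nat -> nat -> nat) (q : C) (J N : nat) :
  pser (fun n => nsum (fun j => v (S j) n) J) q N = csum (fun j => pser (v (S j)) q N) J.
Proof.
induction J as [|J IH].
- unfold pser; simpl; induction N as [|N IH]; simpl; [reflexivity|rewrite IH; eq_in_C; ring].
- simpl csum; rewrite <- IH; apply pser_plus; intros; reflexivity.
Qed.

Lemma sys_a_bound (c v : nat -> nat -> nat) (a : nat -> nat) (r : R) : spt_system c v a -> 0 <= r < 1 ->
  forall N, rser a r N <= exp (/ (1 - r) ^ 2) / (1 - r) / (1 - r).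
Proof.
intros Hs Hr N.
apply Rle_trans with (rser (fun n => nsum (fun j => v (S j) n) N) r N).
{ apply rsum_le; intros n Hn; rewrite (proj2 (sys_nsum c v a Hs n N)) by lia; lra. }
rewrite rser_nsum; set (B := exp (/ (1 - r) ^ 2) / (1 - r)).
assert (HB : 0 <= B) by (apply Rmult_le_pos; [left; apply exp_pos|left; apply Rinv_0_lt_compat; lra]).
apply Rle_trans with (rsum (fun j => r ^ S j * B) N).
{ apply rsum_le; intros j _; apply (sys_v_bound c v a r Hs Hr); lia. }
apply Rle_trans with (B * ((r - r ^ S N) / (1 - r))).
- induction N as [|N IH]; [simpl; right; field; lra|].
  simpl rsum; replace (B * ((r - r ^ S (S N)) / (1 - r))) with (B * ((r - r ^ S N) / (1 - r)) + r ^ S N * B) by (simpl; field; lra).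
  apply Rplus_le_compat_r, IH.
- unfold Rdiv; rewrite <- Rmult_assoc; apply Rmult_le_compat_r; [left; apply Rinv_0_lt_compat; lra|].
  assert (0 <= r ^ S N) by (apply pow_le; lra); nra.
Qed.

Lemma Clim_Cmod (f : nat -> C) (l : C) : Clim f l -> is_lim_seq (fun n => Cmod (f n)) (Cmod l).
Proof.
intro H; apply is_lim_seq_spec; intro eps.
destruct (H (eps / 2)) as [N K]; [destruct eps; simpl; lra|].
exists N; intros n Hn; specialize (K n Hn).
assert (Rabs (Cmod (f n) - Cmod l) <= Cmod (f n - l)).
{ apply Rabs_le; split.
  - pose proof (Cmod_triangle (f n) (- (f n - l))) as T; rewrite Cmod_opp in T.
    replace (f n + - (f n - l))%C with l in T by ring; lra.
  - pose proof (Cmod_triangle l (f n - l)) as T.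
    replace (l + (f n - l))%C with (f n) in T by ring; lra. }
destruct eps as [e He]; simpl in *; lra.
Qed.

Lemma rser_tail_le (b d : nat -> nat) (r : R) (N k : nat) : 0 <= r -> (forall n, (b n <= d n)%nat) ->
  rser b r (N + k) - rser b r N <= rser d r (N + k) - rser d r N.
Proof.
intros Hr H; induction k as [|k IH]; [rewrite Nat.add_0_r; lra|].
rewrite Nat.add_succ_r; unfold rser in *; simpl.
assert (INR (b (N + k)%nat) * r ^ (N + k) <= INR (d (N + k)%nat) * r ^ (N + k))
  by (apply Rmult_le_compat_r; [apply pow_le, Hr|apply le_INR, H]).
match goal with |- ?x + ?y - ?z <= ?u + ?w - ?t => replace (x + y - z) with ((x - z) + y) by ring; replace (u + w - t) with ((u - t) + w) by ring end.
apply Rplus_le_compat; assumption.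
Qed.

Lemma qpoch_split (q : C) (j k : nat) : qpoch q (j + k) = (qpoch q j * qprod_from q j k)%C.
Proof.
induction k as [|k IH]; [rewrite Nat.add_0_r; simpl; ring|].
rewrite Nat.add_succ_r; change (qpoch q (S (j + k))) with (qpoch q (j + k) * (1 - q ^ S (j + k)))%C.
change (qprod_from q j (S k)) with (qprod_from q j k * (1 - q ^ (j + S k)))%C.
rewrite IH; replace (j + S k)%nat with (S (j + k)) by lia; ring.
Qed.

(** [P] is 1/(q;q)_oo. The recurrence reads (1 - q^j) C_j = C_(j+1), and C_(J+1) tends to 1 because
    its coefficients vanish in degrees 1 to J and are dominated by those of C_1. *)
Lemma sys_c_limits (c v : nat -> nat -> nat) (a : nat -> nat) (q : C) : spt_system c v a -> Cmod q < 1 ->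
  exists P, (forall j, Clim (pser (c (S j)) q) (P * qpoch q j)%C) /\ Clim (fun J => P * qpoch q J)%C 1.
Proof.
intros Hs Hq; set (r := Cmod q); assert (Hr : 0 <= r < 1) by (split; [apply Cmod_ge_0|exact Hq]).
destruct (pser_conv (c 1%nat) r _ (proj1 Hr) (fun N => sys_c_bound c v a r Hs Hr 1 N (le_n 1))) as [T [HT [HT2 HT3]]].
destruct (HT3 q (Rle_refl _)) as [P [HP _]].
assert (L : forall j, Clim (pser (c (S j)) q) (P * qpoch q j)%C).
{ induction j as [|j IH].
  - simpl; replace (P * 1)%C with P by ring; exact HP.
  - apply Clim_ext with (fun N => pser (c (S j)) q N + - (q ^ S j) * pser (c (S j)) q (N - S j))%C.
    + intro N; rewrite (pser_plus (c (S j)) (shiftn (S j) (c (S j))) (c (S (S j))) q N) at 1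
        by (intros; apply (sys_c_shift _ _ _ Hs); lia).
      rewrite pser_shift; ring.
    + replace (P * qpoch q (S j))%C with (P * qpoch q j + - (q ^ S j) * (P * qpoch q j))%C by (change (qpoch q (S j)) with (qpoch q j * (1 - q ^ S j))%C; ring).
      apply Clim_plus; [exact IH|apply Clim_scal, Clim_sub, IH]. }
exists P; split; [exact L|].
assert (Hc : forall j n, (c (S j) n <= c 1%nat n)%nat).
{ intros j n; induction j as [|j IH]; [lia|].
  pose proof (sys_c_shift _ _ _ Hs (S j) n ltac:(lia)); lia. }
intros e He; apply is_lim_seq_spec in HT; destruct (HT (mkposreal e He)) as [N HN]; simpl in HN.
exists N; intros J HJ.
apply Clim_bound with (pser (c (S J)) q); [apply L|].
exists (S J); intros n Hn; replace n with (S J + (n - S J))%nat by lia.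
assert (E1 : pser (c (S J)) q (S J) = 1).
{ assert (G : forall m, (m <= J)%nat -> pser (c (S J)) q (S m) = 1).
  { induction m as [|m IH]; intro Hm.
    - unfold pser; simpl; rewrite (sys_c0 _ _ _ Hs); simpl; eq_in_C; ring.
    - unfold pser in *; change (csum (fun n => RtoC (INR (c (S J) n)) * q ^ n)%C (S (S m)))
        with (csum (fun n => RtoC (INR (c (S J) n)) * q ^ n)%C (S m) + RtoC (INR (c (S J) (S m))) * q ^ S m)%C.
      rewrite IH by lia; rewrite (sys_c_small _ _ _ Hs (S J) (S m)) by lia; simpl INR; eq_in_C; ring. }
  apply G; lia. }
rewrite <- E1; eapply Rle_trans; [apply (pser_tail _ q r), Rle_refl|].
eapply Rle_trans; [apply (rser_tail_le _ (c 1%nat)); [apply Hr|apply Hc]|].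
specialize (HN (S J) ltac:(lia)); pose proof (HT2 (S J + (n - S J))%nat) as K.
apply Rabs_def2 in HN; destruct HN as [_ HN].
set (x := rser (c 1%nat) r (S J + (n - S J))) in *; set (y := rser (c 1%nat) r (S J)) in *; lra.
Qed.

(** The recurrence for multiplicities is the linear equation V = q^(j+1) (C + V) for the limit V. *)
Lemma sys_v_limits (c v : nat -> nat -> nat) (a : nat -> nat) (q P : C) (j : nat) : spt_system c v a -> Cmod q < 1 ->
  Clim (pser (c (S j)) q) (P * qpoch q j)%C -> Clim (pser (v (S j)) q) (P * spt_quot q j)%C.
Proof.
intros Hs Hq HL; set (r := Cmod q); assert (Hr : 0 <= r < 1) by (split; [apply Cmod_ge_0|exact Hq]).
destruct (pser_conv (v (S j)) r _ (proj1 Hr) (fun N => sys_v_bound c v a r Hs Hr (S j) N ltac:(lia))) as [T [_ [_ HT]]].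
destruct (HT q (Rle_refl _)) as [V [HV _]].
assert (E : V = (q ^ S j * (P * qpoch q j) + q ^ S j * V)%C).
{ apply Clim_unique with (pser (v (S j)) q); [exact HV|].
  apply Clim_ext with (fun N => q ^ S j * pser (c (S j)) q (N - S j) + q ^ S j * pser (v (S j)) q (N - S j))%C.
  - intro N; rewrite <- !pser_shift; symmetry; apply pser_plus; intros; apply (sys_v_shift _ _ _ Hs); lia.
  - apply Clim_plus; apply Clim_scal; [apply Clim_sub, HL|apply Clim_sub, HV]. }
assert (N1 := one_minus_Cpow_neq_0 q (S j) Hq ltac:(lia)).
replace (P * spt_quot q j)%C with V; [exact HV|].
unfold spt_quot; set (Q := (q ^ S j)%C) in *.
transitivity ((V - Q * V) / (1 - Q))%C; [field; exact N1|].
rewrite E at 1; field; exact N1.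
Qed.

(** Exchange of the sums over part size and over n. Restricting to parts of size at most J leaves
    the coefficients with n <= J unchanged, so the difference is bounded by a tail of the majorant
    series. *)
Lemma sys_a_limits (c v : nat -> nat -> nat) (a : nat -> nat) (r : R) : spt_system c v a -> 0 <= r < 1 ->
  exists T : R, is_lim_seq (rser a r) T /\ forall q, Cmod q <= r -> exists S,
    Clim (pser a q) S /\ (forall N, Cmod (S - pser a q N) <= T - rser a r N) /\
    forall P, (forall j, Clim (pser (c (Datatypes.S j)) q) (P * qpoch q j)%C) ->
      Clim (fun J => P * csum (spt_quot q) J)%C S.
Proof.
intros Hs Hr.
destruct (pser_conv a r _ (proj1 Hr) (sys_a_bound c v a r Hs Hr)) as [T [HT [HT2 HT3]]].
exists T; split; [exact HT|]; intros q Hq; destruct (HT3 q Hq) as [L [HL HL2]].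
exists L; split; [exact HL|split; [exact HL2|]].
intros P HP.
assert (HV : forall J, Clim (fun N => csum (fun j => pser (v (S j)) q N) J) (P * csum (spt_quot q) J)%C).
{ induction J as [|J IH].
  - simpl; replace (P * 0)%C with (RtoC 0) by ring; apply Clim_const.
  - simpl csum; replace (P * (csum (spt_quot q) J + spt_quot q J))%C
      with (P * csum (spt_quot q) J + P * spt_quot q J)%C by ring.
    apply (Clim_plus (fun N => csum (fun j => pser (v (S j)) q N) J)); [exact IH|].
    apply (sys_v_limits c v a); [exact Hs|lra|apply HP]. }
intros e He; apply is_lim_seq_spec in HT; destruct (HT (mkposreal e He)) as [N HN]; simpl in HN.
exists N; intros J HJ.
replace (P * csum (spt_quot q) J - L)%C with (- (L + (-1) * (P * csum (spt_quot q) J) - 0))%C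
  by (replace (RtoC (-1)) with (- (1))%C by (unfold RtoC, Copp; simpl; f_equal; ring); ring).
rewrite Cmod_opp.
apply Clim_bound with (fun M => pser a q M + (-1) * csum (fun j => pser (v (S j)) q M) J)%C.
{ apply Clim_plus; [exact HL|apply (Clim_scal (-1)), HV]. }
exists (S J); intros M HM.
rewrite <- pser_nsum.
set (b := fun n => nsum (fun j => v (S j) n) J).
assert (Eb : forall n, (n <= J)%nat -> b n = a n) by (intros; apply (sys_nsum c v a Hs); assumption).
assert (Lb : forall n, (b n <= a n)%nat) by (intros; apply (sys_nsum c v a Hs)).
set (d := fun n => (a n - b n)%nat).
assert (Ed : (pser a q M + (-1) * pser b q M - 0)%C = pser d q M).
{ rewrite (pser_plus a b d q M) by (intros n _; unfold d; specialize (Lb n); lia).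
  replace (RtoC (-1)) with (- (1))%C by (unfold RtoC, Copp; simpl; f_equal; ring); ring. }
rewrite Ed.
assert (E0 : pser d q (S J) = 0).
{ assert (G : forall m, (m <= S J)%nat -> pser d q m = 0).
  { induction m as [|m IH]; intro Hm; [reflexivity|].
    unfold pser in *; simpl csum; rewrite IH by lia; unfold d at 1; rewrite Eb, Nat.sub_diag by lia; simpl INR; eq_in_C; ring. }
  apply G; lia. }
replace (pser d q M) with (pser d q (S J + (M - S J)) - pser d q (S J))%C
  by (rewrite E0; replace (S J + (M - S J))%nat with M by lia; ring).
eapply Rle_trans; [apply (pser_tail d q r _ _ Hq)|].
eapply Rle_trans; [apply (rser_tail_le d a); [apply Hr|intro; unfold d; lia]|].
specialize (HN (S J) ltac:(lia)); pose proof (HT2 (S J + (M - S J))%nat) as K.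
apply Rabs_def2 in HN; destruct HN as [_ HN].
set (x := rser a r (S J + (M - S J))) in *; set (y := rser a r (S J)) in *; lra.
Qed.

(** * Smallness of the generating function away from the positive real axis *)

Lemma exp_half_le (d : R) : 0 <= d <= 2 -> exp (d / 2) <= 1 + 2 * d.
Proof.
intro Hd; set (x := d / 2); assert (Hx : 0 <= x <= 1) by (unfold x; lra).
assert (E : exp (x / 2) <= / (1 - x / 2)).
{ rewrite <- (Rinv_inv (exp (x / 2))), <- exp_Ropp; apply Rinv_le_contravar; [lra|].
  pose proof (exp_ineq (- (x / 2))); lra. }
replace x with (x / 2 + x / 2) by field; rewrite exp_plus.
pose proof (exp_pos (x / 2)).
apply Rle_trans with (/ (1 - x / 2) * / (1 - x / 2)); [apply Rmult_le_compat; lra|].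
rewrite <- Rinv_mult; apply Rmult_le_reg_r with ((1 - x / 2) * (1 - x / 2)); [nra|].
rewrite Rinv_l by nra; replace d with (2 * x) by (unfold x; field); nra.
Qed.

(** Compared with the real point of the same modulus, |1 - z|^2 grows by 2(|z| - Re z). In
    exponential form the gains of the successive powers of q simply add up. *)
Lemma one_minus_gain (z : C) : Cmod z < 1 ->
  (1 - Cmod z) * exp ((Cmod z - fst z) / 4) <= Cmod (1 - z).
Proof.
intro Hz; set (p := Cmod z) in *; set (d := p - fst z).
pose proof (Cmod_ge_0 z) as H0; fold p in H0.
assert (Hd : 0 <= d <= 2).
{ pose proof (abs_fst_le z) as A; fold p in A; unfold d, Rabs in *; destruct (Rcase_abs (fst z)); lra. }
pose proof (exp_half_le d Hd) as E.
assert (S : Cmod (1 - z) ^ 2 = (1 - p) ^ 2 + 2 * d).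
{ rewrite Cmod_sqr; pose proof (Cmod_sqr z) as Sz; fold p in Sz.
  unfold d; destruct z as [x y]; simpl in *; nra. }
apply Rsqr_incr_0_var; [|apply Cmod_ge_0]; rewrite !Rsqr_pow2, S, Rpow_mult_distr.
replace (exp (d / 4) ^ 2) with (exp (d / 2)) by (rewrite <- exp_INR_mult; f_equal; simpl; field).
assert (0 <= (1 - p) ^ 2 <= 1) by nra; nra.
Qed.

(** A product starting after [j] is compared with the full real product: the first j real factors
    may be thrown in because each of them, even multiplied by its gain, is at most 1. *)
Lemma qprod_from_gain (q : C) (j k : nat) : Cmod q < 1 ->
  Cmod (qpoch (Cmod q) (j + k)) * exp (rsum (fun i => (Cmod q ^ S i - fst (q ^ S i)%C) / 4) (j + k))
    <= Cmod (qprod_from q j k).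
Proof.
intro Hq; pose proof (Cmod_ge_0 q) as H0.
assert (F : forall m, Cmod (1 - RtoC (Cmod q) ^ S m) = 1 - Cmod q ^ S m).
{ intro m; rewrite <- RtoC_pow, <- RtoC_minus, Cmod_R, Rabs_right; [reflexivity|].
  pose proof (pow_lt_1 (Cmod q) (S m) (conj H0 Hq) ltac:(lia)); lra. }
induction k as [|k IH].
- rewrite Nat.add_0_r; simpl (qprod_from q j 0); rewrite Cmod_1; induction j as [|j IH].
  + simpl; rewrite Cmod_1, exp_0; lra.
  + change (qpoch (Cmod q) (S j)) with (qpoch (Cmod q) j * (1 - RtoC (Cmod q) ^ S j))%C.
    rewrite Cmod_mult, F, rsum_S, exp_plus.
    set (p := Cmod q ^ S j).
    assert (P : 0 <= p < 1) by (split; [apply pow_le, H0|apply pow_lt_1; [lra|lia]]).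
    assert (E : (1 - p) * exp ((p - fst (q ^ S j)%C) / 4) <= 1).
    { assert (exp ((p - fst (q ^ S j)%C) / 4) <= exp p).
      { apply exp_le; pose proof (abs_fst_le (q ^ S j)) as A; rewrite Cmod_pow in A; fold p in A.
        unfold Rabs in A; destruct (Rcase_abs (fst (q ^ S j)%C)); lra. }
      pose proof (exp_ineq (- p)) as E2; rewrite exp_Ropp in E2; pose proof (exp_pos p).
      apply Rle_trans with (/ exp p * exp p); [apply Rmult_le_compat; try lra; left; apply exp_pos|rewrite Rinv_l; lra]. }
    pose proof (exp_pos ((p - fst (q ^ S j)%C) / 4)).
    pose proof (exp_pos (rsum (fun i => (Cmod q ^ S i - fst (q ^ S i)%C) / 4) j)).
    pose proof (Cmod_ge_0 (qpoch (Cmod q) j)).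
    match goal with |- ?x * (1 - p) * (?y * ?w) <= 1 => replace (x * (1 - p) * (y * w)) with ((x * y) * ((1 - p) * w)) by ring end.
    apply Rle_trans with (1 * 1); [|lra].
    apply Rmult_le_compat; try assumption; apply Rmult_le_pos; lra.
- rewrite Nat.add_succ_r.
  change (qpoch (Cmod q) (S (j + k))) with (qpoch (Cmod q) (j + k) * (1 - RtoC (Cmod q) ^ S (j + k)))%C.
  change (qprod_from q j (S k)) with (qprod_from q j k * (1 - q ^ (j + S k)))%C.
  rewrite Nat.add_succ_r, !Cmod_mult, F, rsum_S, exp_plus.
  assert (G := one_minus_gain (q ^ S (j + k))); rewrite Cmod_pow in G.
  specialize (G (pow_lt_1 (Cmod q) (S (j + k)) (conj H0 Hq) ltac:(lia))).
  pose proof (pow_lt_1 (Cmod q) (S (j + k)) (conj H0 Hq) ltac:(lia)).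
  set (p := Cmod q ^ S (j + k)) in *.
  match goal with |- ?x * (1 - p) * (?y * ?w) <= _ => replace (x * (1 - p) * (y * w)) with ((x * y) * ((1 - p) * w)) by ring end.
  apply Rmult_le_compat; [|apply Rmult_le_pos; [lra|left; apply exp_pos]|exact IH|exact G].
  apply Rmult_le_pos; [apply Cmod_ge_0|left; apply exp_pos].
Qed.

Lemma csum_geom (q : C) (J : nat) : (1 - q)%C <> 0 ->
  csum (fun i => q ^ S i)%C J = (q * (1 - q ^ J) / (1 - q))%C.
Proof.
intro H; induction J as [|J IH]; [simpl; field; exact H|].
rewrite csum_S, IH; simpl Cpow; field; exact H.
Qed.

(** The total gain is a difference of geometric series at |q| and at q. The real part of the latter
    is estimated by its modulus; stopping at J costs the subtracted term. *)
Lemma gain_lower (q : C) (J : nat) : Cmod q < 1 ->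
  (Cmod q / (1 - Cmod q) - Cmod q / Cmod (1 - q)) / 4 - Cmod q ^ J / (1 - Cmod q) <=
    rsum (fun i => (Cmod q ^ S i - fst (q ^ S i)%C) / 4) J.
Proof.
intro Hq; pose proof (Cmod_ge_0 q) as H0; set (r := Cmod q) in *.
assert (G := Cmod_one_minus_pow_ge q 0 Hq); fold r in G; replace (q ^ 1)%C with q in G by (simpl; ring).
assert (N1 : (1 - q)%C <> 0) by (intro E; rewrite E, Cmod_0 in G; lra).
assert (E : rsum (fun i => (r ^ S i - fst (q ^ S i)%C) / 4) J =
  (r * (1 - r ^ J) / (1 - r) - fst (csum (fun i => q ^ S i)%C J)) / 4).
{ induction J as [|J IH]; [simpl; field; lra|].
  rewrite rsum_S, IH, csum_S.
  change (fst (csum (fun i => q ^ S i)%C J + q ^ S J)%C) with (fst (csum (fun i => q ^ S i)%C J) + fst (q ^ S J)%C).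
  simpl pow; field; lra. }
rewrite E, csum_geom by exact N1.
pose proof (fst_le_Cmod (q * (1 - q ^ J) / (1 - q))) as F.
rewrite Cmod_div, Cmod_mult in F by exact N1; fold r in F.
assert (F2 : Cmod (1 - q ^ J) <= 1 + r ^ J).
{ unfold Cminus; eapply Rle_trans; [apply Cmod_triangle|]; rewrite Cmod_1, Cmod_opp, Cmod_pow; fold r; lra. }
assert (PJ : 0 <= r ^ J) by apply pow_le, H0.
set (m := Cmod (1 - q)) in *.
assert (F3 : r * Cmod (1 - q ^ J) / m <= r * (1 + r ^ J) / m).
{ unfold Rdiv; apply Rmult_le_compat_r; [left; apply Rinv_0_lt_compat; lra|apply Rmult_le_compat_l; lra]. }
assert (F4 : r * r ^ J / m <= r ^ J / (1 - r)).
{ unfold Rdiv; apply Rmult_le_compat; [nra|left; apply Rinv_0_lt_compat; lra|nra|apply Rinv_le_contravar; lra]. }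
assert (F5 : r * r ^ J / (1 - r) <= r ^ J / (1 - r)).
{ unfold Rdiv; apply Rmult_le_compat_r; [left; apply Rinv_0_lt_compat; lra|nra]. }
replace (r * (1 - r ^ J) / (1 - r)) with (r / (1 - r) - r * r ^ J / (1 - r)) by (field; lra).
replace (r * (1 + r ^ J) / m) with (r / m + r * r ^ J / m) in F3 by (field; lra).
assert (0 <= r ^ J / (1 - r)) by (apply Rmult_le_pos; [exact PJ|left; apply Rinv_0_lt_compat; lra]).
lra.
Qed.

(** [P0] is 1/(r;r)_oo at r = |q|. The two factors of the generating function are not separated:
    each term contains P (q)_j, the inverse of the product of 1 - q^i over i > j, to which the gain
    over the real point applies directly. *)
Lemma minor_arc_bound (c v : nat -> nat -> nat) (a : nat -> nat) (q P0 S0 : C) : spt_system c v a -> Cmod q < 1 ->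
  Clim (fun J => P0 * qpoch (Cmod q) J)%C 1 -> Clim (pser a q) S0 ->
  Cmod S0 <= Cmod P0 * exp (- ((Cmod q / (1 - Cmod q) - Cmod q / Cmod (1 - q)) / 4)) / (1 - Cmod q) ^ 2.
Proof.
intros Hs Hq HP0 HS0; pose proof (Cmod_ge_0 q) as H0; set (r := Cmod q) in *.
set (g := (r / (1 - r) - r / Cmod (1 - q)) / 4).
destruct (sys_c_limits c v a q Hs Hq) as [P [HP HP1]].
assert (B : forall j, Cmod (P * qpoch q j) <= Cmod P0 * exp (- g)).
{ intro j; set (X := Cmod (P * qpoch q j)).
  (* Finite form, to be sent to the limit in k: P (q)_(j+k) and P0 (r)_(j+k) tend to 1, and the
     truncation cost of the gain disappears. *)
  assert (I1 : forall k, X * Cmod (qpoch r (j + k)) * exp g <= Cmod (P * qpoch q (j + k)) * exp (r ^ (j + k) / (1 - r))).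
  { intro k; pose proof (qprod_from_gain q j k Hq) as Q; fold r in Q.
    pose proof (gain_lower q (j + k) Hq) as L; fold r in L; fold g in L.
    rewrite (qpoch_split q j k), Cmult_assoc, Cmod_mult; fold X.
    assert (E : exp g <= exp (rsum (fun i => (r ^ S i - fst (q ^ S i)%C) / 4) (j + k)) * exp (r ^ (j + k) / (1 - r))).
    { rewrite <- exp_plus; apply exp_le; set (u := r ^ (j + k) / (1 - r)) in *; lra. }
    pose proof (Cmod_ge_0 (qpoch r (j + k))) as C0; pose proof (Cmod_ge_0 (P * qpoch q j)) as C1; fold X in C1.
    apply Rle_trans with (X * Cmod (qpoch r (j + k)) * (exp (rsum (fun i => (r ^ S i - fst (q ^ S i)%C) / 4) (j + k)) * exp (r ^ (j + k) / (1 - r)))).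
    - apply Rmult_le_compat_l; [apply Rmult_le_pos; assumption|exact E].
    - match goal with |- X * ?x * (?y * ?w) <= X * ?t * _ => replace (X * x * (y * w)) with ((X * (x * y)) * w) by ring end.
      apply Rmult_le_compat_r; [left; apply exp_pos|apply Rmult_le_compat_l; assumption]. }
  assert (Hpow : is_lim_seq (fun k => r ^ (j + k) / (1 - r)) (0 / (1 - r))).
  { apply is_lim_seq_ext with (fun k => r ^ (k + j) / (1 - r)); [intro; rewrite Nat.add_comm; reflexivity|].
    apply is_lim_seq_div'; [|apply is_lim_seq_const|lra].
    apply (is_lim_seq_incr_n (fun k => r ^ k) j), is_lim_seq_geom; rewrite Rabs_right; lra. }
  assert (R1 : is_lim_seq (fun k => Cmod P0 * (Cmod (P * qpoch q (j + k)) * exp (r ^ (j + k) / (1 - r)))) (Cmod P0 * (1 * exp (0 / (1 - r))))).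
  { apply is_lim_seq_mult'; [apply is_lim_seq_const|apply is_lim_seq_mult'].
    - apply is_lim_seq_ext with (fun k => Cmod (P * qpoch q (k + j))); [intro; rewrite Nat.add_comm; reflexivity|].
      apply (is_lim_seq_incr_n (fun k => Cmod (P * qpoch q k)) j).
      rewrite <- Cmod_1; apply (Clim_Cmod (fun k => P * qpoch q k)%C), HP1.
    - apply is_lim_seq_continuous; [apply derivable_continuous_pt, derivable_pt_exp|exact Hpow]. }
  assert (R2 : is_lim_seq (fun k => X * exp g * Cmod (P0 * qpoch r (j + k))) (X * exp g * 1)).
  { apply is_lim_seq_mult'; [apply is_lim_seq_const|].
    apply is_lim_seq_ext with (fun k => Cmod (P0 * qpoch r (k + j))); [intro; rewrite Nat.add_comm; reflexivity|].
    apply (is_lim_seq_incr_n (fun k => Cmod (P0 * qpoch r k)) j).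
    rewrite <- Cmod_1; apply (Clim_Cmod (fun k => P0 * qpoch r k)%C), HP0. }
  assert (K : Rbar_le (X * exp g * 1) (Cmod P0 * (1 * exp (0 / (1 - r))))).
  { eapply is_lim_seq_le; [|exact R2|exact R1].
    intro k; cbv beta; rewrite Cmod_mult; specialize (I1 k).
    apply (Rmult_le_compat_l (Cmod P0)) in I1; [|apply Cmod_ge_0].
    eapply Rle_trans; [|exact I1]; right; ring. }
  simpl in K; replace (0 / (1 - r)) with 0 in K by (field; lra); rewrite exp_0 in K.
  rewrite exp_Ropp; pose proof (exp_pos g).
  apply Rmult_le_reg_r with (exp g); [assumption|].
  rewrite Rmult_assoc, Rinv_l by lra; lra. }
destruct (sys_a_limits c v a r Hs (conj H0 Hq)) as [T [_ HT]].
destruct (HT q (Rle_refl _)) as [S1 [HS1 [_ HS2]]].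
rewrite (Clim_unique _ _ _ HS0 HS1); specialize (HS2 P HP).
replace S1 with (S1 - 0)%C by ring.
apply Clim_bound with (1 := HS2); exists O; intros J _.
set (M := Cmod P0 * exp (- g)) in *.
assert (M0 : 0 <= M) by (apply Rmult_le_pos; [apply Cmod_ge_0|left; apply exp_pos]).
apply Rle_trans with (M / (1 - r) * ((1 - r ^ J) / (1 - r))).
- induction J as [|J IH].
  + simpl; replace (P * 0 - 0)%C with (RtoC 0) by ring; rewrite Cmod_0; right; field; lra.
  + simpl csum; replace (P * (csum (spt_quot q) J + spt_quot q J) - 0)%C
      with ((P * csum (spt_quot q) J - 0) + P * spt_quot q J)%C by ring.
    eapply Rle_trans; [apply Cmod_triangle|].
    replace (M / (1 - r) * ((1 - r ^ S J) / (1 - r))) with (M / (1 - r) * ((1 - r ^ J) / (1 - r)) + M * r ^ J * / (1 - r))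
      by (simpl; field; lra).
    apply Rplus_le_compat; [exact IH|].
    unfold spt_quot; replace (P * (qpoch q J * q ^ S J / (1 - q ^ S J)))%C
      with ((P * qpoch q J) * q ^ S J / (1 - q ^ S J))%C by (field; apply one_minus_Cpow_neq_0; [exact Hq|lia]).
    rewrite Cmod_div, Cmod_mult, Cmod_pow by (apply one_minus_Cpow_neq_0; [exact Hq|lia]); fold r.
    pose proof (Cmod_one_minus_pow_ge q J Hq) as G; fold r in G.
    unfold Rdiv; apply Rmult_le_compat.
    * apply Rmult_le_pos; [apply Cmod_ge_0|apply pow_le, H0].
    * left; apply Rinv_0_lt_compat; lra.
    * apply Rmult_le_compat; [apply Cmod_ge_0|apply pow_le, H0|apply B|].
      simpl; rewrite <- (Rmult_1_l (r ^ J)) at 2; apply Rmult_le_compat_r; [apply pow_le, H0|lra].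
    * apply Rinv_le_contravar; lra.
- assert (0 <= r ^ J) by apply pow_le, H0.
  replace (M / (1 - r) ^ 2) with (M / (1 - r) * (1 / (1 - r))) by (field; lra).
  apply Rmult_le_compat_l; [apply Rmult_le_pos; [exact M0|left; apply Rinv_0_lt_compat; lra]|].
  unfold Rdiv; apply Rmult_le_compat_r; [left; apply Rinv_0_lt_compat; lra|lra].
Qed.

(** * Behaviour on the contour *)

(** The main term in terms of w with tau = w^2, so that no branch of tau^(-1/2) has to be chosen. *)
Definition spt_main (w : C) : C :=
  (/ (sqrt (2 * PI) * w) * Cexp ((PI ^ 2 / 6)%R / (w * w) - w * w * (1 / 24)%R))%C.

Lemma Clim_div (f : nat -> C) (P : C) : Clim (fun J => P * f J)%C 1 -> P <> 0 /\ Clim f (/ P)%C.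
Proof.
intro H; assert (N : P <> 0).
{ intro E; subst P; assert (Z : RtoC 0 = RtoC 1).
  - apply Clim_unique with (fun J => 0 * f J)%C; [|exact H].
    apply Clim_ext with (fun _ => RtoC 0); [intro; ring|apply Clim_const].
  - apply RtoC_inj in Z; lra. }
split; [exact N|].
apply (Clim_scal (/ P)%C) in H; rewrite Cmult_1_r in H.
apply Clim_ext with (2 := H); intro n; field; exact N.
Qed.

(** A slope of at most 1/5 for w gives the square a cosine of at least (1 - 1/25)/(1 + 1/25) =
    12/13. *)
Lemma sector_square (w : C) : 0 < fst w -> Rabs (snd w) <= fst w / 5 ->
  12 / 13 * Cmod (w * w) <= fst (w * w)%C.
Proof.
intros Hw H; rewrite Cmod_mult; replace (Cmod w * Cmod w) with (Cmod w ^ 2) by ring; rewrite Cmod_sqr.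
assert (snd w ^ 2 <= (fst w / 5) ^ 2) by (rewrite <- (pow2_abs (snd w)); apply pow_incr; split; [apply Rabs_pos|exact H]).
replace (fst (w * w)%C) with (fst w ^ 2 - snd w ^ 2) by (destruct w; simpl; ring). nra.
Qed.

Lemma exp_neg_inv_le (t : R) : 0 < t -> exp (- / t) <= t.
Proof.
intro Ht; assert (0 < / t) by (apply Rinv_0_lt_compat, Ht).
eapply Rle_trans; [apply exp_neg_le_inv; lra|].
rewrite <- (Rinv_inv t) at 2; apply Rinv_le_contravar; lra.
Qed.

(** The generating function is P A, with A close to 1/z and 1/P close to the estimate [E0] of
    (q;q)_oo. The cap 1/12 makes the relative error 6 e^(-1/t) at most 1/2, so that 1/P stays
    comparable with [E0]. *)
Lemma arc_estimate : exists K, 0 < K /\ forall c v a, spt_system c v a -> forall (w S0 : C),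
  0 < fst w -> Rabs (snd w) <= fst w / 5 -> Cmod (w * w) <= 1 / 12 ->
  Clim (pser a (Cexp (- (w * w)))) S0 ->
  Cmod (S0 - spt_main w) <= K * exp (- (2 / 5) / Cmod (w * w)) * Cmod (spt_main w).
Proof.
destruct spt_quot_series_estimate as [K1 [HK1 HA]].
exists (2 * (K1 + 6)); split; [lra|].
intros c v a Hs w S0 Hw Hw5 Ht HS.
assert (Hw0 : w <> 0) by (apply Cneq0_fst, Hw).
pose proof (sector_square w Hw Hw5) as Hz; set (z := (w * w)%C) in *.
assert (Hz0 : z <> 0) by (apply Cmult_neq_0; assumption).
assert (Pz : 0 < Cmod z) by (apply Cmod_gt_0, Hz0).
set (q := Cexp (- z)) in *.
assert (Hq : Cmod q < 1).
{ unfold q; rewrite Cmod_Cexp, <- exp_0; apply exp_increasing; replace (fst (- z)%C) with (- fst z) by (destruct z; reflexivity); lra. }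
destruct (sys_c_limits c v a q Hs Hq) as [P [HP HP1]].
destruct (Clim_div _ _ HP1) as [P0 HL].
pose proof (euler_function_estimate w (/ P)%C Hw Hw5 ltac:(fold z; lra) HL) as HE; fold z in HE.
destruct (sys_a_limits c v a (Cmod q) Hs (conj (Cmod_ge_0 q) Hq)) as [T [_ HT]].
destruct (HT q (Rle_refl _)) as [S1 [HS1 [_ HS2]]].
assert (ES : S0 = S1) by (apply Clim_unique with (pser a q); assumption); subst S1.
specialize (HS2 P HP).
assert (HA2 : Clim (csum (spt_quot q)) (S0 / P)%C).
{ apply (Clim_scal (/ P)%C) in HS2.
  replace (S0 / P)%C with (/ P * S0)%C by (unfold Cdiv; ring).
  apply Clim_ext with (2 := HS2); intro n; field; exact P0. }
specialize (HA z (S0 / P)%C ltac:(lra) Hz HA2).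
set (E0 := (sqrt (2 * PI) / w * Cexp (z * (1 / 24)%R - (PI ^ 2 / 6)%R / z))%C) in *.
assert (S2P : RtoC (sqrt (2 * PI)) <> 0).
{ intro E; apply RtoC_inj in E; assert (0 < sqrt (2 * PI)) by (apply sqrt_lt_R0; pose proof PI_RGT_0; lra); lra. }
assert (EM : spt_main w = (/ (z * E0))%C).
{ unfold spt_main, E0; fold z.
  replace ((PI ^ 2 / 6)%R / z - z * (1 / 24)%R)%C with (- (z * (1 / 24)%R - (PI ^ 2 / 6)%R / z))%C by ring.
  rewrite Cexp_opp; set (X := Cexp _); assert (X <> 0) by apply Cexp_neq_0.
  unfold z; field; repeat split; assumption. }
assert (NE0 : E0 <> 0).
{ unfold E0, Cdiv; apply Cmult_neq_0; [|apply Cexp_neq_0].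
  apply Cmult_neq_0; [exact S2P|]. intro E; apply (f_equal (fun x => x * w)%C) in E.
  rewrite Cinv_l, Cmult_0_l in E by exact Hw0; apply RtoC_inj in E; lra. }
set (M := spt_main w) in *.
set (t := Cmod z) in *.
assert (Ee : exp (- / t) <= 1 / 12) by (eapply Rle_trans; [apply exp_neg_inv_le, Pz|lra]).
assert (PE0 : 0 < Cmod E0) by (apply Cmod_gt_0, NE0).
assert (HPm : Cmod P * Cmod E0 <= 2).
{ pose proof (Cmod_triangle (/ P) (- (/ P - E0))) as TT; rewrite Cmod_opp in TT.
  replace (/ P + - (/ P - E0))%C with E0 in TT by ring.
  assert (6 * exp (- / t) * Cmod E0 <= 1 / 2 * Cmod E0) by (apply Rmult_le_compat_r; lra).
  assert (Cmod E0 <= 2 * Cmod (/ P)) by lra.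
  rewrite Cmod_inv in * by exact P0.
  assert (PP : 0 < Cmod P) by (apply Cmod_gt_0, P0).
  apply Rle_trans with (Cmod P * (2 * / Cmod P)); [apply Rmult_le_compat_l; lra|right; field; lra]. }
(* The relative error of the quotient is the difference of the two relative errors, up to the
   bounded factor P E0. *)
assert (D : (S0 - M)%C = (P * E0 * ((z * (S0 / P) - 1) - (/ P - E0) / E0) * M)%C).
{ rewrite EM; field; repeat split; assumption. }
rewrite D, !Cmod_mult.
apply Rmult_le_compat_r; [apply Cmod_ge_0|].
apply Rle_trans with (2 * (K1 * exp (- (2 / 5) / t) + 6 * exp (- (2 / 5) / t))); [|lra].
apply Rmult_le_compat; [apply Rmult_le_pos; apply Cmod_ge_0|apply Cmod_ge_0|exact HPm|].
unfold Cminus at 1; eapply Rle_trans; [apply Cmod_triangle|]; rewrite Cmod_opp.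
apply Rplus_le_compat; [exact HA|].
rewrite Cmod_div by exact NE0.
apply Rle_trans with (6 * exp (- / t)).
- apply Rmult_le_reg_r with (Cmod E0); [exact PE0|].
  unfold Rdiv at 1; rewrite Rmult_assoc, Rinv_l, Rmult_1_r by lra; exact HE.
- apply Rmult_le_compat_l; [lra|apply exp_le].
  assert (0 < / t) by (apply Rinv_0_lt_compat, Pz); unfold Rdiv; lra.
Qed.

(** Half of the leading term already exceeds e^(-pi^2/(6t)), so the prefactor and the relative error
    are absorbed without a constant. *)
Lemma real_euler_bound (c v : nat -> nat -> nat) (a : nat -> nat) (t : R) (P0 : C) :
  0 < t <= 1 / 12 -> Clim (fun J => P0 * qpoch (exp (- t)) J)%C 1 -> Cmod P0 <= exp (PI ^ 2 / 6 / t).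
Proof.
intros Ht HP; destruct (Clim_div _ _ HP) as [N0 HL].
assert (st : 0 < sqrt t) by (apply sqrt_lt_R0; lra).
assert (ss : sqrt t * sqrt t = t) by (apply sqrt_sqrt; lra).
assert (Ew : (RtoC (sqrt t) * RtoC (sqrt t))%C = RtoC t) by (rewrite <- RtoC_mult, ss; reflexivity).
pose proof (euler_function_estimate (sqrt t) (/ P0)%C) as HE; cbv zeta in HE; rewrite Ew in HE.
assert (Ct : Cmod t = t) by (rewrite Cmod_R, Rabs_right; lra).
rewrite Ct in HE; simpl fst in HE; simpl snd in HE; rewrite Rabs_R0 in HE.
assert (Eq : Cexp (- RtoC t) = RtoC (exp (- t))) by (rewrite <- RtoC_opp; apply Cexp_RtoC).
rewrite Eq in HE; specialize (HE st ltac:(lra) ltac:(lra) HL).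
assert (EE : (sqrt (2 * PI) / sqrt t * Cexp (t * (1 / 24)%R - (PI ^ 2 / 6)%R / t))%C
  = RtoC (sqrt (2 * PI) / sqrt t * exp (t * (1 / 24) - PI ^ 2 / 6 / t))).
{ rewrite <- !RtoC_div, <- RtoC_mult, <- RtoC_minus, Cexp_RtoC, <- RtoC_mult by lra; reflexivity. }
rewrite EE in HE; set (E0 := sqrt (2 * PI) / sqrt t * exp (t * (1 / 24) - PI ^ 2 / 6 / t)) in *.
assert (s2 : 2 <= sqrt (2 * PI)).
{ rewrite <- (sqrt_square 2) at 1 by lra; apply sqrt_le_1_alt; pose proof PI2_3_2; lra. }
assert (st1 : sqrt t <= 1) by (rewrite <- sqrt_1; apply sqrt_le_1_alt; lra).
assert (B : 2 * exp (- (PI ^ 2 / 6 / t)) <= E0).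
{ unfold E0; apply Rmult_le_compat; [lra|left; apply exp_pos| |apply exp_le; lra].
  apply Rmult_le_reg_r with (sqrt t); [exact st|]; unfold Rdiv; rewrite Rmult_assoc, Rinv_l by lra; lra. }
pose proof (exp_pos (- (PI ^ 2 / 6 / t))) as PE.
assert (Ee : exp (- / t) <= 1 / 12) by (eapply Rle_trans; [apply exp_neg_inv_le|]; lra).
rewrite Cmod_R, Rabs_right in HE by lra.
pose proof (Cmod_triangle (/ P0) (- (/ P0 - E0))) as TT; rewrite Cmod_opp in TT.
replace (/ P0 + - (/ P0 - E0))%C with (RtoC E0) in TT by ring.
rewrite Cmod_R, Rabs_right in TT by lra.
assert (6 * exp (- / t) * E0 <= 1 / 2 * E0) by (apply Rmult_le_compat_r; lra).
rewrite Cmod_inv in TT by exact N0.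
assert (PP : 0 < Cmod P0) by (apply Cmod_gt_0, N0).
assert (F : exp (- (PI ^ 2 / 6 / t)) <= / Cmod P0) by lra.
rewrite exp_Ropp in F.
pose proof (exp_pos (PI ^ 2 / 6 / t)).
rewrite <- (Rinv_inv (Cmod P0)), <- (Rinv_inv (exp (PI ^ 2 / 6 / t))).
apply Rinv_le_contravar; [apply Rinv_0_lt_compat; lra|exact F].
Qed.

(** At the real point |q|/(1 - |q|) is near 13/(12t), whereas |q|/|1 - q| is at most about 1/t
    because |tau| >= t on the segment. A quarter of the difference is 1/(48t), up to a bounded
    amount. *)
Lemma line_estimate (c v : nat -> nat -> nat) (a : nat -> nat) : spt_system c v a ->
  forall (t th : R) (S0 : C), 0 < t <= 1 / 12 -> 5 / 13 * t <= th <= PI ->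
  Clim (pser a (Cexp (- (12 / 13 * t, th)))) S0 ->
  Cmod S0 <= 9 / t ^ 2 * exp 1 * exp (PI ^ 2 / 6 * (13 / 12) / t - 1 / (48 * t)).
Proof.
intros Hs t th S0 Ht Hth HS.
set (t1 := 12 / 13 * t) in *; set (q := Cexp (- (t1, th))) in *.
assert (Hr : Cmod q = exp (- t1)) by (unfold q; rewrite Cmod_Cexp; reflexivity).
assert (Ht1 : 0 < t1 <= 1 / 12) by (unfold t1; lra).
assert (Hq : Cmod q < 1) by (rewrite Hr, <- exp_0; apply exp_increasing; lra).
assert (Hr0 : Cmod (Cmod q) < 1) by (rewrite Cmod_R, Rabs_right; [exact Hq|apply Rle_ge, Cmod_ge_0]).
destruct (sys_c_limits c v a (Cmod q) Hs Hr0) as [P [_ HP1]].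
assert (HPb : Cmod P <= exp (PI ^ 2 / 6 / t1)).
{ apply (real_euler_bound c v a); [exact Ht1|]. rewrite <- Hr; exact HP1. }
eapply Rle_trans; [apply (minor_arc_bound c v a q P S0 Hs Hq HP1 HS)|].
set (g := (Cmod q / (1 - Cmod q) - Cmod q / Cmod (1 - q)) / 4).
assert (Hg : 1 / (48 * t) - 1 / 2 <= g).
{ assert (G1 : / t1 - 1 <= Cmod q / (1 - Cmod q)).
  { rewrite Hr; pose proof (exp_ineq (- t1)) as E; pose proof (exp_pos (- t1)).
    assert (L : exp (- t1) < 1) by (rewrite <- exp_0; apply exp_increasing; lra).
    replace (exp (- t1) / (1 - exp (- t1))) with (/ (1 - exp (- t1)) - 1) by (field; lra).
    assert (/ t1 <= / (1 - exp (- t1))) by (apply Rinv_le_contravar; lra); lra. }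
  assert (G2 : Cmod q / Cmod (1 - q) <= / t + 1).
  { assert (N1 : 0 < Cmod (1 - q)) by (pose proof (Cmod_one_minus_pow_ge q 0 Hq) as X; replace (q ^ 1)%C with q in X by (simpl; ring); lra).
    assert (Q : Cmod (1 - q) ^ 2 = (1 - exp (- t1)) ^ 2 + 2 * exp (- t1) * (1 - cos th)).
    { rewrite Cmod_sqr; unfold q, Cexp; simpl; rewrite cos_neg, sin_neg.
      pose proof (sin2_cos2 th) as SC; unfold Rsqr in SC.
      replace (_ + _) with ((1 - exp (- t1)) ^ 2 + 2 * exp (- t1) * (1 - cos th) + exp (- t1) ^ 2 * (sin th * sin th + cos th * cos th - 1)) by ring.
      rewrite SC; simpl; ring. }
    set (e := exp (- t1)) in *; assert (Pe : 0 < e) by apply exp_pos.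
    assert (E1 : e * (1 + t1) <= 1).
    { unfold e; pose proof (exp_neg_le_inv t1 ltac:(lra)) as X; apply Rle_trans with (/ (1 + t1) * (1 + t1)); [apply Rmult_le_compat_r; lra|right; field; lra]. }
    assert (L : e <= 1) by nra.
    (* The worst case is th = 5t/13, the corner where the segment leaves the arc; 25/169 is the
       square of 5/13, and the half-angle y turns 1 - cos into a squared sine. *)
    assert (C : t ^ 2 * (25 / 169) * (1 - t ^ 2 / 12) <= 2 * (1 - cos th)).
    { set (y := 5 / 26 * t); assert (Hc : cos th <= cos (2 * y)).
      { apply cos_decr_1; unfold y; pose proof PI2_3_2; lra. }
      rewrite cos_2a_sin in Hc.
      pose proof (sin_ge_cubic y ltac:(unfold y; lra)) as Sy.
      assert (Y0 : 0 <= y - y ^ 3 / 6) by (assert (y ^ 3 <= y) by (unfold y; nra); assert (0 <= y) by (unfold y; lra); lra).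
      assert (S2 : (y - y ^ 3 / 6) ^ 2 <= sin y ^ 2) by (apply pow_incr; lra).
      assert (S3 : y ^ 2 * (1 - y ^ 2 / 3) <= (y - y ^ 3 / 6) ^ 2) by (replace ((y - y ^ 3 / 6) ^ 2) with (y ^ 2 * (1 - y ^ 2 / 3) + (y ^ 3 / 6) ^ 2) by field; nra).
      assert (S4 : t ^ 2 * (25 / 169) * (1 - t ^ 2 / 12) <= 4 * (y ^ 2 * (1 - y ^ 2 / 3))).
      { unfold y; replace (4 * ((5 / 26 * t) ^ 2 * (1 - (5 / 26 * t) ^ 2 / 3))) with (t ^ 2 * (25 / 169) * (1 - t ^ 2 * (25 / 2028))) by field.
        apply Rmult_le_compat_l; nra. }
      nra. }
    assert (Q2 : (e * (t / (1 + t))) ^ 2 <= Cmod (1 - q) ^ 2).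
    { rewrite Q, Rpow_mult_distr.
      assert (A1 : (e * t1) ^ 2 <= (1 - e) ^ 2) by (apply pow_incr; nra).
      assert (A2 : e ^ 2 * (2 * (1 - cos th)) <= 2 * e * (1 - cos th)) 
        by (pose proof (COS_bound th); assert (0 <= e * (1 - cos th)) by (apply Rmult_le_pos; lra); nra).
      (* Since (12/13)^2 + 25/169 = 1, the right side is t^2 up to fourth order, which leaves room
         for (t/(1 + t))^2. *)
      assert (A3 : (t / (1 + t)) ^ 2 <= t1 ^ 2 + t ^ 2 * (25 / 169) * (1 - t ^ 2 / 12)).
      { unfold t1; replace ((t / (1 + t)) ^ 2) with (t ^ 2 * (/ (1 + t)) ^ 2) by (field; lra).
        replace ((12 / 13 * t) ^ 2 + t ^ 2 * (25 / 169) * (1 - t ^ 2 / 12)) with (t ^ 2 * (1 - 25 / 2028 * t ^ 2)) by field.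
        apply Rmult_le_compat_l; [nra|].
        apply Rmult_le_reg_r with ((1 + t) ^ 2); [nra|].
        replace ((/ (1 + t)) ^ 2 * (1 + t) ^ 2) with 1 by (field; lra).
        assert (0 <= t ^ 2 <= t) by nra. nra. }
      assert (e ^ 2 * (t / (1 + t)) ^ 2 <= e ^ 2 * (t1 ^ 2 + 2 * (1 - cos th))) by (apply Rmult_le_compat_l; [nra|lra]).
      nra. }
    assert (Q3 : e * (t / (1 + t)) <= Cmod (1 - q)).
    { apply Rsqr_incr_0_var; [rewrite !Rsqr_pow2; exact Q2|lra]. }
    rewrite Hr; apply Rmult_le_reg_r with (Cmod (1 - q)); [exact N1|].
    unfold Rdiv at 1; rewrite Rmult_assoc, Rinv_l, Rmult_1_r by lra.
    apply Rle_trans with ((/ t + 1) * (e * (t / (1 + t)))); [right; field; lra|].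
    apply Rmult_le_compat_l; [|exact Q3].
    assert (0 < / t) by (apply Rinv_0_lt_compat; lra); lra. }
  unfold g; replace (/ t1) with (13 / 12 * / t) in G1 by (unfold t1; field; lra).
  replace (1 / (48 * t)) with (1 / 48 * / t) by (field; lra); lra. }
assert (Hi : 0 < / (1 - Cmod q) <= 3 / t).
{ split; [apply Rinv_0_lt_compat; lra|]; rewrite Hr; eapply Rle_trans; [apply one_minus_exp_inv_le; lra|].
  replace (/ t1) with (13 / 12 * / t) by (unfold t1; field; lra).
  assert (1 <= / t) by (rewrite <- Rinv_1; apply Rinv_le_contravar; lra); unfold Rdiv; lra. }
replace (9 / t ^ 2 * exp 1 * exp (PI ^ 2 / 6 * (13 / 12) / t - 1 / (48 * t)))
  with (exp (PI ^ 2 / 6 / t1) * (exp 1 * exp (- (1 / (48 * t)))) * (3 / t) ^ 2).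
2:{ replace (PI ^ 2 / 6 * (13 / 12) / t - 1 / (48 * t)) with (PI ^ 2 / 6 / t1 + - (1 / (48 * t))) by (unfold t1; field; lra).
    rewrite exp_plus; field; lra. }
replace (Cmod P * exp (- g) / (1 - Cmod q) ^ 2) with (Cmod P * exp (- g) * (/ (1 - Cmod q)) ^ 2) by (field; lra).
apply Rmult_le_compat.
- apply Rmult_le_pos; [apply Cmod_ge_0|left; apply exp_pos].
- apply pow_le; lra.
- apply Rmult_le_compat; [apply Cmod_ge_0|left; apply exp_pos|exact HPb|].
  rewrite <- exp_plus; apply exp_le; lra.
- apply pow_incr; lra.
Qed.

(** * Extraction of the coefficient *)

(** Re(e^(k tau) tau) at tau = t e^(i phi). As d tau = i tau d phi on the arc, this is the imaginary
    part of e^(k tau) d tau per unit of phi. *)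
Definition arc_term (t k phi : R) : R := exp (k * t * cos phi) * (t * cos (k * t * sin phi + phi)).
Definition line_term (t1 k th : R) : R := exp (k * t1) * cos (k * th).
(** Smaller acute angle of the 5-12-13 triangle: sine and cosine are rational, and tan(phi1/2) =
    1/5. *)
Definition phi1 : R := atan (5 / 12).

Lemma cos_phi1 : cos phi1 = 12 / 13.
Proof.
unfold phi1; rewrite cos_atan.
replace (1 + (5 / 12)²) with (13 / 12 * (13 / 12)) by (unfold Rsqr; field).
rewrite sqrt_square by lra; field.
Qed.

Lemma sin_phi1 : sin phi1 = 5 / 13.
Proof.
unfold phi1; rewrite sin_atan.
replace (1 + (5 / 12)²) with (13 / 12 * (13 / 12)) by (unfold Rsqr; field).
rewrite sqrt_square by lra; field.
Qed.

Lemma phi1_bounds : 0 < phi1 < PI / 2.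
Proof.
unfold phi1; split; [|apply atan_bound].
rewrite <- atan_0; apply atan_increasing; lra.
Qed.

(** Both pieces have the primitive Im e^(k tau)/k. Its values match at the corner (12t/13, 5t/13)
    and vanish on the real axis and at Im tau = pi. For k = 0 the primitive is Im tau, which rises
    from 0 to pi. *)
Lemma is_RInt_arc_line (t k : R) : sin (k * PI) = 0 -> exists I J,
  is_RInt (arc_term t k) 0 phi1 I /\ is_RInt (line_term (12 / 13 * t) k) (5 / 13 * t) PI J /\
  I + J = if Req_dec_T k 0 then PI else 0.
Proof.
intro Hk; destruct (Req_dec_T k 0) as [->|Hk0].
- exists (minus (t * sin phi1) (t * sin 0)), (minus PI (5 / 13 * t)); repeat split.
  + apply (is_RInt_ext (fun phi => t * cos phi)).
    * intros x _; unfold arc_term; rewrite !Rmult_0_l, exp_0, Rplus_0_l; eq_in_R; ring.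
    * apply (is_RInt_derive (V := R_CompleteNormedModule) (fun phi => t * sin phi)).
      -- intros x _; auto_derive; [exact I|ring].
      -- intros x _; apply (ex_derive_continuous (V := R_NormedModule)); auto_derive; exact I.
  + apply (is_RInt_ext (fun _ => 1)).
    * intros x _; unfold line_term; rewrite !Rmult_0_l, exp_0, cos_0; eq_in_R; ring.
    * apply (is_RInt_derive (V := R_CompleteNormedModule) (fun x => x)).
      -- intros x _; auto_derive; [exact I|ring].
      -- intros x _; apply continuous_const.
  + rewrite sin_phi1, sin_0; unfold minus, plus, opp; simpl; field.
- exists (minus (exp (k * t * cos phi1) * sin (k * t * sin phi1) / k) (exp (k * t * cos 0) * sin (k * t * sin 0) / k)),
    (minus (exp (k * (12 / 13 * t)) * sin (k * PI) / k) (exp (k * (12 / 13 * t)) * sin (k * (5 / 13 * t)) / k)); repeat split.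
  + apply (is_RInt_derive (V := R_CompleteNormedModule) (fun phi => exp (k * t * cos phi) * sin (k * t * sin phi) / k)).
    * intros x _; unfold arc_term; rewrite cos_plus; auto_derive; [exact I|field; exact Hk0].
    * intros x _; apply (ex_derive_continuous (V := R_NormedModule)); unfold arc_term; auto_derive; exact I.
  + apply (is_RInt_derive (V := R_CompleteNormedModule) (fun th => exp (k * (12 / 13 * t)) * sin (k * th) / k)).
    * intros x _; unfold line_term; auto_derive; [exact I|field; exact Hk0].
    * intros x _; apply (ex_derive_continuous (V := R_NormedModule)); unfold line_term; auto_derive; exact I.
  + rewrite cos_phi1, sin_phi1, sin_0, Rmult_0_r, sin_0, Hk; unfold minus, plus, opp; simpl.
    replace (k * (12 / 13 * t)) with (k * t * (12 / 13)) by ring.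
    replace (k * (5 / 13 * t)) with (k * t * (5 / 13)) by ring; field; exact Hk0.
Qed.

Lemma fst_pser_mult (a : nat -> nat) (q c : C) (M : nat) :
  fst (pser a q M * c)%C = rsum (fun m => INR (a m) * fst (q ^ m * c)%C) M.
Proof.
induction M as [|M IH].
- unfold pser; simpl; ring.
- unfold pser in *; rewrite csum_S, rsum_S, <- IH; destruct c as [x y], (q ^ M)%C as [u v];
    destruct (csum (fun n => RtoC (INR (a n)) * q ^ n)%C M) as [e f]; simpl; ring.
Qed.

Lemma Cexp_quotient (n m : nat) (z : C) : (Cexp (- z) ^ m * Cexp (INR n * z))%C = Cexp ((INR n - INR m)%R * z).
Proof. rewrite Cexp_pow, <- Cexp_plus; f_equal; rewrite RtoC_minus; ring. Qed.

Lemma sin_diff_PI (n m : nat) : sin ((INR n - INR m) * PI) = 0.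
Proof.
rewrite Rmult_minus_distr_r, sin_minus, !sin_INR_PI; ring.
Qed.

Definition line_pt (t th : R) : C := (12 / 13 * t, th).

Definition arc_pt (t phi : R) : C := (t * cos phi, t * sin phi).

(** For a polynomial in q, linearity over monomials takes the place of Cauchy's theorem. Real parts
    account for the conjugate lower half of the contour, hence PI and not 2 PI. *)
Lemma contour (a : nat -> nat) (n M : nat) (t : R) : (n < M)%nat -> exists I J,
  is_RInt (fun phi => fst (pser a (Cexp (- arc_pt t phi)) M * (Cexp (INR n * arc_pt t phi) * arc_pt t phi))%C) 0 phi1 I /\
  is_RInt (fun th => fst (pser a (Cexp (- line_pt t th)) M * Cexp (INR n * line_pt t th))%C) (5 / 13 * t) PI J /\
  I + J = PI * INR (a n).
Proof.
intro HM.
assert (H : forall N, exists I J,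
  is_RInt (fun phi => rsum (fun m => INR (a m) * arc_term t (INR n - INR m) phi) N) 0 phi1 I /\
  is_RInt (fun th => rsum (fun m => INR (a m) * line_term (12 / 13 * t) (INR n - INR m) th) N) (5 / 13 * t) PI J /\
  I + J = if (n <? N)%nat then PI * INR (a n) else 0).
{ induction N as [|N [I [J [HI [HJ E]]]]].
  - exists 0, 0; simpl; repeat split; [| |ring].
    + evar_last; [apply (is_RInt_const (V := R_NormedModule))|unfold scal; simpl; unfold mult; simpl; ring].
    + evar_last; [apply (is_RInt_const (V := R_NormedModule))|unfold scal; simpl; unfold mult; simpl; ring].
  - destruct (is_RInt_arc_line t (INR n - INR N) (sin_diff_PI n N)) as [I' [J' [HI' [HJ' E']]]].
    exists (plus I (scal (INR (a N)) I')), (plus J (scal (INR (a N)) J')); repeat split.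
    + apply (is_RInt_plus (V := R_NormedModule)); [exact HI|apply (is_RInt_scal (V := R_NormedModule)), HI'].
    + apply (is_RInt_plus (V := R_NormedModule)); [exact HJ|apply (is_RInt_scal (V := R_NormedModule)), HJ'].
    + unfold plus, scal; simpl; unfold mult; simpl.
      replace (I + INR (a N) * I' + (J + INR (a N) * J')) with ((I + J) + INR (a N) * (I' + J')) by ring.
      rewrite E, E'; destruct (Req_dec_T (INR n - INR N) 0) as [Z|Z].
      * assert (n = N) by (apply INR_eq; lra); subst N.
        rewrite Nat.ltb_irrefl; destruct (Nat.ltb_spec n (S n)); [ring|lia].
      * assert (n <> N) by (intro; subst; apply Z; ring).
        destruct (Nat.ltb_spec n N), (Nat.ltb_spec n (S N)); try lia; ring. }
destruct (H M) as [I [J [HI [HJ E]]]]; exists I, J; repeat split.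
- apply is_RInt_ext with (2 := HI); intros phi _; rewrite fst_pser_mult; apply rsum_ext; intros m _; f_equal.
  rewrite Cmult_assoc, Cexp_quotient; unfold arc_term, arc_pt, Cexp; simpl.
  set (k := INR n - INR m).
  replace (k * (t * cos phi) - 0 * (t * sin phi)) with (k * t * cos phi) by ring.
  replace (k * (t * sin phi) + 0 * (t * cos phi)) with (k * t * sin phi) by ring.
  rewrite cos_plus; ring.
- apply is_RInt_ext with (2 := HJ); intros th _; rewrite fst_pser_mult; apply rsum_ext; intros m _; f_equal.
  rewrite Cexp_quotient; unfold line_term, line_pt, Cexp; simpl.
  set (k := INR n - INR m).
  replace (k * (12 / 13 * t) - 0 * th) with (k * (12 / 13 * t)) by ring.
  replace (k * th + 0 * (12 / 13 * t)) with (k * th) by ring; reflexivity.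
- rewrite E; destruct (Nat.ltb_spec n M); [reflexivity|lia].
Qed.

Definition arc_root (t phi : R) : C := (sqrt t * cos (phi / 2), sqrt t * sin (phi / 2)).

Lemma arc_root_sqr (t phi : R) : 0 < t -> (arc_root t phi * arc_root t phi)%C = arc_pt t phi.
Proof.
intro Ht; assert (s : sqrt t * sqrt t = t) by (apply sqrt_sqrt; lra).
unfold arc_root, arc_pt, Cmult; simpl.
assert (C : cos phi = cos (phi / 2) * cos (phi / 2) - sin (phi / 2) * sin (phi / 2))
  by (rewrite <- cos_2a; f_equal; field).
assert (S : sin phi = 2 * sin (phi / 2) * cos (phi / 2)) by (rewrite <- sin_2a; f_equal; field).
set (A := cos (phi / 2)) in *; set (B := sin (phi / 2)) in *; rewrite C, S.
f_equal.
- transitivity (sqrt t * sqrt t * (A * A - B * B)); [ring|rewrite s; reflexivity].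
- transitivity (sqrt t * sqrt t * (2 * B * A)); [ring|rewrite s; reflexivity].
Qed.

Lemma cos_arc_ge (phi : R) : 0 <= phi <= phi1 -> 12 / 13 <= cos phi.
Proof.
intro H; rewrite <- cos_phi1; pose proof phi1_bounds; apply cos_decr_1; lra.
Qed.

(** From cos phi >= 12/13 follow sin^2(phi/2) <= 1/26 and cos^2(phi/2) >= 25/26. *)
Lemma arc_root_sector (t phi : R) : 0 < t -> 0 <= phi <= phi1 ->
  0 < fst (arc_root t phi) /\ Rabs (snd (arc_root t phi)) <= fst (arc_root t phi) / 5.
Proof.
intros Ht Hp; pose proof phi1_bounds as B; pose proof (cos_arc_ge phi Hp) as C.
assert (st : 0 < sqrt t) by (apply sqrt_lt_R0; lra).
assert (C2 : 0 < cos (phi / 2)) by (apply cos_gt_0; lra).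
assert (S2 : 0 <= sin (phi / 2)) by (apply sin_ge_0; lra).
replace phi with (2 * (phi / 2)) in C by field.
pose proof (sin2_cos2 (phi / 2)) as Q; unfold Rsqr in Q.
rewrite cos_2a_sin in C.
assert (S3 : sin (phi / 2) <= cos (phi / 2) / 5).
{ apply Rsqr_incr_0_var; [unfold Rsqr; nra|lra]. }
unfold arc_root; simpl; split; [apply Rmult_lt_0_compat; assumption|].
rewrite Rabs_right by (apply Rle_ge, Rmult_le_pos; lra); nra.
Qed.

(** The choice x t = pi^2/(6t) makes pi^2/(6 tau) equal to x times the conjugate of tau on the arc,
    so that pi^2/(6 tau) + x tau = 2xt cos phi is real; n = x + 1/24 absorbs the factor
    e^(-tau/24). *)
Lemma spt_main_arc (x t phi : R) (n : nat) : 0 < t -> x * t = PI ^ 2 / 6 / t -> INR n = x + 1 / 24 ->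
  (spt_main (arc_root t phi) * (Cexp (INR n * arc_pt t phi) * arc_pt t phi))%C =
  (arc_root t phi * (exp (2 * (x * t) * cos phi) / sqrt (2 * PI))%R)%C.
Proof.
intros Ht Hx Hn; pose proof (arc_root_sqr t phi Ht) as E.
assert (SC : cos phi * cos phi + sin phi * sin phi = 1) by (pose proof (sin2_cos2 phi) as Q; unfold Rsqr in Q; lra).
assert (S2P : 0 < sqrt (2 * PI)) by (apply sqrt_lt_R0; pose proof PI_RGT_0; lra).
assert (S2P' : RtoC (sqrt (2 * PI)) <> 0) by (intro Z; apply RtoC_inj in Z; lra).
assert (N : arc_root t phi <> 0).
{ intro Z; rewrite Z, Cmult_0_l in E; unfold arc_pt in E; injection E as E1 E2.
  assert (cos phi = 0) by nra; assert (sin phi = 0) by nra; nra. }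
unfold spt_main; rewrite E.
assert (EE : ((PI ^ 2 / 6)%R / arc_pt t phi - arc_pt t phi * (1 / 24)%R + INR n * arc_pt t phi)%C = RtoC (2 * (x * t) * cos phi)).
{ rewrite Hn; replace (PI ^ 2 / 6) with (x * t * t) by (rewrite Hx; field; lra).
  set (cj := ((x * t * cos phi)%R, (- (x * t * sin phi))%R) : C).
  assert (I : (RtoC (x * t * t) / arc_pt t phi)%C = cj).
  { assert (NA : arc_pt t phi <> 0) by (rewrite <- E; apply Cmult_neq_0; exact N).
    transitivity (cj * arc_pt t phi / arc_pt t phi)%C; [|field; exact NA].
    f_equal; unfold cj, arc_pt, Cmult, RtoC; simpl; f_equal; [|ring].
    replace (x * t * cos phi * (t * cos phi) - - (x * t * sin phi) * (t * sin phi)) with (x * t * t * (cos phi * cos phi + sin phi * sin phi)) by ring.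
    rewrite SC; ring. }
  rewrite I; unfold cj, arc_pt, Cplus, Cminus, Copp, Cmult, RtoC; simpl; f_equal; field. }
transitivity (/ (sqrt (2 * PI) * arc_root t phi) * (arc_root t phi * arc_root t phi) *
  Cexp ((PI ^ 2 / 6)%R / arc_pt t phi - arc_pt t phi * (1 / 24)%R + INR n * arc_pt t phi))%C.
- rewrite Cexp_plus, E; ring.
- rewrite EE, Cexp_RtoC, RtoC_div by lra; field; split; assumption.
Qed.

(** Substitute v = 2 sqrt(xt) sin(phi/2): cos phi = 1 - 2 sin^2(phi/2) yields e^(2xt) e^(-v^2), and
    the factor cos(phi/2), which comes from the square root of tau, is dv up to a constant. Nothing
    is approximated. *)
Lemma is_RInt_main (x t : R) : 0 < x -> 0 < t ->
  is_RInt (fun phi => sqrt t * cos (phi / 2) * (exp (2 * (x * t) * cos phi) / sqrt (2 * PI))) 0 phi1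
   (exp (2 * (x * t)) / (sqrt (2 * PI) * sqrt x) * gauss_int (2 * sqrt (x * t) * sin (phi1 / 2))).
Proof.
intros Hx Ht.
assert (S2P : 0 < sqrt (2 * PI)) by (apply sqrt_lt_R0; pose proof PI_RGT_0; lra).
assert (sx : 0 < sqrt x) by (apply sqrt_lt_R0; lra).
assert (st : 0 < sqrt t) by (apply sqrt_lt_R0; lra).
assert (L : sqrt (x * t) = sqrt x * sqrt t) by (apply sqrt_mult; lra).
assert (LL : sqrt (x * t) * sqrt (x * t) = x * t) by (apply sqrt_sqrt; nra).
set (K := exp (2 * (x * t)) / (sqrt (2 * PI) * sqrt x)).
replace (K * gauss_int (2 * sqrt (x * t) * sin (phi1 / 2)))
  with (minus (K * gauss_int (2 * sqrt (x * t) * sin (phi1 / 2))) (K * gauss_int (2 * sqrt (x * t) * sin (0 / 2)))).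
2:{ replace (0 / 2) with 0 by field; rewrite sin_0, Rmult_0_r; unfold gauss_int at 2; rewrite RInt_point.
    unfold minus, plus, opp, zero; simpl; ring. }
apply (is_RInt_derive (V := R_CompleteNormedModule) (fun phi => K * gauss_int (2 * sqrt (x * t) * sin (phi / 2)))).
- intros phi _; evar_last.
  + apply (is_derive_scal (fun phi => gauss_int (2 * sqrt (x * t) * sin (phi / 2)))).
    apply (is_derive_comp (K := R_AbsRing) (V := R_NormedModule) gauss_int (fun phi => 2 * sqrt (x * t) * sin (phi / 2))); [apply is_derive_gauss_int|].
    instantiate (1 := sqrt (x * t) * cos (phi / 2)); auto_derive; [exact I|unfold Rdiv; field].
  + unfold scal; simpl; unfold mult; simpl.
    replace (cos phi) with (1 - 2 * sin (phi / 2) * sin (phi / 2)) by (rewrite <- cos_2a_sin; f_equal; field).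
    replace (- (2 * sqrt (x * t) * sin (phi / 2) * (2 * sqrt (x * t) * sin (phi / 2))))
      with (- (4 * (sqrt (x * t) * sqrt (x * t)) * (sin (phi / 2) * sin (phi / 2)))) by ring.
    rewrite LL.
    replace (2 * (x * t) * (1 - 2 * sin (phi / 2) * sin (phi / 2)))
      with (2 * (x * t) + - (4 * (x * t) * (sin (phi / 2) * sin (phi / 2)))) by ring.
    rewrite exp_plus; unfold K; rewrite L; field; split; lra.
- intros phi _; apply (ex_derive_continuous (V := R_NormedModule)); auto_derive; exact I.
Qed.

Definition spt_approx (n : nat) : R :=
  sqrt 3 / (PI * sqrt (24 * INR n - 1)) * exp (PI * sqrt (24 * INR n - 1) / 6).

(** Two errors are added: truncation of the series, amplified by |e^(n tau)|, and the relative error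
    on the arc, applied to a main term of size at most e^(2xt). *)
Lemma arc_difference (K : R) (c v : nat -> nat -> nat) (a : nat -> nat) : 0 < K -> spt_system c v a ->
  (forall (w S0 : C), 0 < fst w -> Rabs (snd w) <= fst w / 5 -> Cmod (w * w) <= 1 / 12 ->
    Clim (pser a (Cexp (- (w * w)))) S0 ->
    Cmod (S0 - spt_main w) <= K * exp (- (2 / 5) / Cmod (w * w)) * Cmod (spt_main w)) ->
  forall (x t phi eta : R) (n M : nat) (S0 : C), 0 < t <= 1 / 12 -> x * t = PI ^ 2 / 6 / t -> INR n = x + 1 / 24 ->
  0 <= phi <= phi1 -> Clim (pser a (Cexp (- arc_pt t phi))) S0 ->
  Cmod (S0 - pser a (Cexp (- arc_pt t phi)) M) <= eta ->
  Rabs (fst (pser a (Cexp (- arc_pt t phi)) M * (Cexp (INR n * arc_pt t phi) * arc_pt t phi))%C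
    - sqrt t * cos (phi / 2) * (exp (2 * (x * t) * cos phi) / sqrt (2 * PI)))
  <= eta * exp (INR n * t) + K * exp (- (2 / 5) / t) * exp (2 * (x * t)).
Proof.
intros HK Hs Harc x t phi eta n M S0 Ht Hx Hn Hphi HS HM.
destruct (arc_root_sector t phi ltac:(lra) Hphi) as [W1 W2].
pose proof (arc_root_sqr t phi ltac:(lra)) as E.
set (w := arc_root t phi) in *; set (z := arc_pt t phi) in *.
set (c1 := (Cexp (INR n * z) * z)%C).
assert (SC : Rsqr (sin phi) + Rsqr (cos phi) = 1) by apply sin2_cos2; unfold Rsqr in SC.
assert (Cz : Cmod z = t).
{ apply Rsqr_inj; [apply Cmod_ge_0|lra|]; rewrite !Rsqr_pow2, Cmod_sqr; unfold z, arc_pt; simpl.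
  replace (t * cos phi * (t * cos phi * 1) + t * sin phi * (t * sin phi * 1))
    with (t * t * (sin phi * sin phi + cos phi * cos phi)) by ring; rewrite SC; ring. }
specialize (Harc w S0 W1 W2); rewrite E, Cz in Harc; specialize (Harc ltac:(lra) HS).
pose proof (spt_main_arc x t phi n ltac:(lra) Hx Hn) as SM; fold w z c1 in SM.
assert (S2P : 1 <= sqrt (2 * PI)).
{ rewrite <- sqrt_1; apply sqrt_le_1_alt; pose proof PI2_3_2; lra. }
assert (st : 0 < sqrt t <= 1).
{ split; [apply sqrt_lt_R0; lra|rewrite <- sqrt_1; apply sqrt_le_1_alt; lra]. }
assert (Cw : Cmod w = sqrt t).
{ apply Rsqr_inj; [apply Cmod_ge_0|lra|]; rewrite !Rsqr_pow2.
  replace (Cmod w ^ 2) with (Cmod (w * w)) by (rewrite Cmod_mult; ring); rewrite E, Cz.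
  rewrite pow2_sqrt; lra. }
assert (F1 : fst (spt_main w * c1)%C = sqrt t * cos (phi / 2) * (exp (2 * (x * t) * cos phi) / sqrt (2 * PI))).
{ rewrite SM; unfold w, arc_root; simpl; ring. }
rewrite <- F1.
assert (B1 : Cmod (spt_main w) * Cmod c1 <= exp (2 * (x * t))).
{ rewrite <- Cmod_mult, SM, Cmod_mult, Cw, Cmod_R.
  assert (P : 0 < exp (2 * (x * t) * cos phi)) by apply exp_pos.
  assert (Q : exp (2 * (x * t) * cos phi) <= exp (2 * (x * t))).
  { apply exp_le; assert (0 <= x * t) by (rewrite Hx; apply Rmult_le_pos; [pose proof PI_RGT_0; nra|left; apply Rinv_0_lt_compat; lra]).
    pose proof (COS_bound phi); nra. }
  assert (Q2 : exp (2 * (x * t) * cos phi) / sqrt (2 * PI) <= exp (2 * (x * t) * cos phi)).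
  { rewrite <- (Rmult_1_r (exp _)) at 2; apply Rmult_le_compat_l; [lra|].
    rewrite <- Rinv_1; apply Rinv_le_contravar; lra. }
  rewrite Rabs_right by (apply Rle_ge, Rmult_le_pos; [lra|left; apply Rinv_0_lt_compat; lra]).
  assert (0 <= exp (2 * (x * t) * cos phi) / sqrt (2 * PI)) by (apply Rmult_le_pos; [lra|left; apply Rinv_0_lt_compat; lra]).
  nra. }
assert (B2 : Cmod c1 <= exp (INR n * t)).
{ unfold c1; rewrite Cmod_mult, Cmod_Cexp, Cz.
  assert (exp (fst (INR n * z)%C) <= exp (INR n * t)).
  { apply exp_le; unfold z, arc_pt; simpl; pose proof (COS_bound phi); pose proof (pos_INR n).
    assert (INR n * (t * cos phi) <= INR n * t) by (apply Rmult_le_compat_l; nra); lra. }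
  pose proof (exp_pos (fst (INR n * z)%C)); nra. }
set (pm := pser a (Cexp (- z)) M) in *.
replace (fst (pm * c1)%C - fst (spt_main w * c1)%C) with (fst ((pm - S0) * c1 + (S0 - spt_main w) * c1)%C)
  by (destruct pm, c1, S0, (spt_main w); simpl; ring).
eapply Rle_trans; [apply abs_fst_le|]; eapply Rle_trans; [apply Cmod_triangle|]; rewrite !Cmod_mult.
replace (Cmod (pm - S0)) with (Cmod (S0 - pm)) by (rewrite <- Cmod_opp; f_equal; ring).
apply Rplus_le_compat.
- apply Rmult_le_compat; try apply Cmod_ge_0; assumption.
- apply Rle_trans with (K * exp (- (2 / 5) / t) * Cmod (spt_main w) * Cmod c1).
  + apply Rmult_le_compat_r; [apply Cmod_ge_0|exact Harc].
  + rewrite Rmult_assoc; apply Rmult_le_compat_l; [|exact B1].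
    apply Rmult_le_pos; [lra|left; apply exp_pos].
Qed.

Lemma line_difference (c v : nat -> nat -> nat) (a : nat -> nat) : spt_system c v a ->
  forall (x t th eta : R) (n M : nat) (S0 : C), 0 < t <= 1 / 12 -> x * t = PI ^ 2 / 6 / t -> INR n = x + 1 / 24 ->
  5 / 13 * t <= th <= PI -> Clim (pser a (Cexp (- line_pt t th))) S0 ->
  Cmod (S0 - pser a (Cexp (- line_pt t th)) M) <= eta ->
  Rabs (fst (pser a (Cexp (- line_pt t th)) M * Cexp (INR n * line_pt t th))%C)
  <= eta * exp (INR n * t) + 9 / t ^ 2 * exp 2 * exp (2 * (x * t)) * exp (- (1 / 300) / t).
Proof.
intros Hs x t th eta n M S0 Ht Hx Hn Hth HS HM.
pose proof (line_estimate c v a Hs t th S0 Ht Hth HS) as L.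
set (pm := pser a (Cexp (- line_pt t th)) M) in *.
eapply Rle_trans; [apply abs_fst_le|]; rewrite Cmod_mult, Cmod_Cexp.
replace (fst (INR n * line_pt t th)%C) with (INR n * (12 / 13 * t)) by (unfold line_pt; simpl; ring).
assert (Pm : Cmod pm <= eta + Cmod S0).
{ pose proof (Cmod_triangle (- (S0 - pm)) S0) as T; rewrite Cmod_opp in T.
  replace (- (S0 - pm) + S0)%C with pm in T by ring; lra. }
pose proof (pos_INR n) as Pn; pose proof (Cmod_ge_0 (S0 - pm)).
apply Rle_trans with ((eta + Cmod S0) * exp (INR n * (12 / 13 * t))).
{ apply Rmult_le_compat_r; [left; apply exp_pos|exact Pm]. }
rewrite Rmult_plus_distr_r; apply Rplus_le_compat.
- apply Rmult_le_compat_l; [lra|apply exp_le; nra].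
- eapply Rle_trans; [apply Rmult_le_compat_r; [left; apply exp_pos|exact L]|].
  assert (it : 0 < / t) by (apply Rinv_0_lt_compat; lra).
  assert (i2 : 0 < / t ^ 2) by (apply Rinv_0_lt_compat; nra).
  replace (exp 2) with (exp 1 * exp 1) by (rewrite <- exp_plus; f_equal; ring).
  replace (9 / t ^ 2 * exp 1 * exp (PI ^ 2 / 6 * (13 / 12) / t - 1 / (48 * t)) * exp (INR n * (12 / 13 * t)))
    with (9 * / t ^ 2 * exp 1 * (exp (PI ^ 2 / 6 * (13 / 12) / t - 1 / (48 * t) + INR n * (12 / 13 * t))))
    by (rewrite exp_plus; unfold Rdiv; ring).
  replace (9 / t ^ 2 * (exp 1 * exp 1) * exp (2 * (x * t)) * exp (- (1 / 300) / t))
    with (9 * / t ^ 2 * exp 1 * exp (1 + 2 * (x * t) + - (1 / 300) / t))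
    by (rewrite !exp_plus; unfold Rdiv; ring).
  apply Rmult_le_compat_l.
  { pose proof (exp_pos 1); apply Rmult_le_pos; [apply Rmult_le_pos; lra|lra]. }
  apply exp_le; rewrite Hn.
  assert (EL : PI ^ 2 / 6 * (13 / 12) / t = 13 / 12 * (x * t)) by (rewrite Hx; field; lra).
  rewrite EL; replace ((x + 1 / 24) * (12 / 13 * t)) with (12 / 13 * (x * t) + 1 / 26 * t) by field.
  (* Exponent budget: 13/12 + 12/13 = 2 + 1/156 and x t <= 8/(3t), so the excess over 2xt is at most
     2/(117t), and the gain 1/(48t) beats it by more than 1/(300t). The leftover t/26 goes into the
     second factor e of [exp 2]. *)
  assert (PB : PI ^ 2 / 6 <= 8 / 3) by (pose proof PI_4; pose proof PI_RGT_0; nra).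
  assert (XB : x * t <= 8 / 3 * / t) by (rewrite Hx; unfold Rdiv at 1; apply Rmult_le_compat_r; lra).
  replace (1 / (48 * t)) with (1 / 48 * / t) by (field; lra); unfold Rdiv in *; lra.
Qed.

(** Arc, segments and missing Gaussian tail each err by at most e^(2xt) e^(-1/(300t)) up to a
    multiple of t^(-2); comparing e^(2xt) with the main term costs one more 1/t. *)
Lemma sys_asymptotic : exists K, 0 < K /\ exists n0 : nat, forall c v a, spt_system c v a ->
  forall n, (n0 <= n)%nat ->
  Rabs (INR (a n) - spt_approx n) <= K * exp (- (sqrt (INR n) / 1200)) * spt_approx n.
Proof.
destruct arc_estimate as [K1 [HK1 Harc]].
(* 1/300 - 1/1200 = 1/400: a quarter of the rate pays for t^(-3), and 1/t >= sqrt(n)/3 then turns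
   1/(400t) into sqrt(n)/1200. *)
destruct (pow_le_exp 3 (1 / 1200) ltac:(lra)) as [K2 [HK2 HP2]].
pose proof (exp_pos 2) as Pe2.
set (K3 := 6 + 2 * K1 + 36 * exp 2).
exists (6 * K3 * K2); split; [unfold K3; repeat apply Rmult_lt_0_compat; lra|].
(* Large enough for t <= 1/12, as t^2 = pi^2/(6x) and pi <= 4. *)
exists 1000%nat; intros c v a Hs n Hn0.
specialize (Harc c v a Hs).
assert (Hn1 : 1000 <= INR n) by (apply le_INR in Hn0; rewrite INR_IZR_INZ in Hn0; exact Hn0).
set (x := INR n - 1 / 24); assert (Hx : 999 <= x) by (unfold x; lra).
assert (HPI : 3 / 2 <= PI ^ 2 / 6 <= 8 / 3) by (pose proof PI2_3_2; pose proof PI_4; pose proof PI_RGT_0; split; nra).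
set (t := PI / sqrt (6 * x)).
assert (s6 : 0 < sqrt (6 * x)) by (apply sqrt_lt_R0; lra).
assert (s6s : sqrt (6 * x) * sqrt (6 * x) = 6 * x) by (apply sqrt_sqrt; lra).
assert (Ht0 : 0 < t) by (apply Rdiv_lt_0_compat; [apply PI_RGT_0|exact s6]).
assert (Htx : t ^ 2 = PI ^ 2 / 6 / x).
{ unfold t; replace ((PI / sqrt (6 * x)) ^ 2) with (PI ^ 2 / (sqrt (6 * x) * sqrt (6 * x))) by (field; lra).
  rewrite s6s; field; lra. }
assert (HL : x * t = PI ^ 2 / 6 / t).
{ replace (PI ^ 2 / 6) with (t ^ 2 * x) by (rewrite Htx; field; lra); field; lra. }
assert (Ht : 0 < t <= 1 / 12).
{ split; [exact Ht0|]; apply Rsqr_incr_0_var; [|lra]; rewrite !Rsqr_pow2, Htx.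
  apply Rmult_le_reg_r with x; [lra|]; unfold Rdiv at 1; rewrite Rmult_assoc, Rinv_l by lra; lra. }
assert (it : 12 <= / t) by (replace 12 with (/ (1 / 12)) by field; apply Rinv_le_contravar; lra).
assert (Hn : INR n = x + 1 / 24) by (unfold x; ring).
set (r := exp (- (12 / 13 * t))).
assert (Hr : 0 <= r < 1) by (split; [left; apply exp_pos|unfold r; rewrite <- exp_0; apply exp_increasing; lra]).
destruct (sys_a_limits c v a r Hs Hr) as [T [HT HTq]].
(* Truncation is so fine that, multiplied by e^(nt), it does not exceed the order of the error
   already present on the arc. *)
set (eta := exp (2 * (x * t)) * exp (- (2 / 5) / t) * exp (- (INR n * t))).
assert (Peta : 0 < eta) by (unfold eta; repeat apply Rmult_lt_0_compat; apply exp_pos).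
assert (Eeta : eta * exp (INR n * t) = exp (2 * (x * t)) * exp (- (2 / 5) / t)).
{ unfold eta; rewrite (exp_Ropp (INR n * t)); field; apply Rgt_not_eq, exp_pos. }
apply is_lim_seq_spec in HT; destruct (HT (mkposreal eta Peta)) as [N HN]; simpl in HN.
set (M := (N + S n)%nat).
assert (HM : T - rser a r M <= eta).
{ specialize (HN M ltac:(unfold M; lia)); apply Rabs_def2 in HN; set (y := rser a r M) in *; lra. }
assert (Hq : forall z : C, 12 / 13 * t <= fst z -> exists S0, Clim (pser a (Cexp (- z))) S0 /\ Cmod (S0 - pser a (Cexp (- z)) M) <= eta).
{ intros z Hz; destruct (HTq (Cexp (- z))) as [S0 [H1 [H2 _]]].
  - rewrite Cmod_Cexp; unfold r; apply exp_le; destruct z; simpl in *; lra.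
  - exists S0; split; [exact H1|]; specialize (H2 M); lra. }
destruct (contour a n M t ltac:(unfold M; lia)) as [I [J [HI [HJ EIJ]]]].
pose proof (is_RInt_main x t ltac:(lra) Ht0) as HM2.
set (G := gauss_int (2 * sqrt (x * t) * sin (phi1 / 2))) in *.
pose proof phi1_bounds as Bphi; pose proof PI_4 as P4; pose proof PI_RGT_0 as P0; pose proof PI2_3_2 as P3.
set (L := exp (2 * (x * t))) in *; assert (PL : 0 < L) by apply exp_pos.
set (I0 := L / (sqrt (2 * PI) * sqrt x) * G) in *.
assert (D1 : Rabs (I - I0) <= (phi1 - 0) * (L * exp (- (2 / 5) / t) + K1 * exp (- (2 / 5) / t) * L)).
{ apply (is_RInt_abs_le _ 0 phi1 _ _ ltac:(lra) (is_RInt_minus _ _ _ _ _ _ HI HM2)).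
  intros phi Hphi.
  destruct (Hq (arc_pt t phi)) as [S0 [HS0 HS1]].
  { unfold arc_pt; simpl; pose proof (cos_arc_ge phi Hphi); nra. }
  pose proof (arc_difference K1 c v a HK1 Hs Harc x t phi eta n M S0 Ht HL Hn Hphi HS0 HS1) as A.
  rewrite Eeta in A; exact A. }
assert (D2 : Rabs J <= (PI - 5 / 13 * t) * (L * exp (- (2 / 5) / t) + 9 / t ^ 2 * exp 2 * L * exp (- (1 / 300) / t))).
{ apply (is_RInt_abs_le _ (5 / 13 * t) PI _ _ ltac:(lra) HJ).
  intros th Hth; destruct (Hq (line_pt t th)) as [S0 [HS0 HS1]]; [unfold line_pt; simpl; lra|].
  pose proof (line_difference c v a Hs x t th eta n M S0 Ht HL Hn Hth HS0 HS1) as A.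
  rewrite Eeta in A; exact A. }
set (d := exp (- (1 / 300) / t)) in *; assert (Pd : 0 < d) by apply exp_pos.
assert (d25 : exp (- (2 / 5) / t) <= d) by (apply exp_le; unfold Rdiv; nra).
assert (d26 : exp (- (1 / 5) / t) <= d) by (apply exp_le; unfold Rdiv; nra).
assert (sx : 0 < sqrt x) by (apply sqrt_lt_R0; lra).
assert (sxs : sqrt x * sqrt x = x) by (apply sqrt_sqrt; lra).
assert (s2p : 2 <= sqrt (2 * PI)).
{ rewrite <- (sqrt_square 2) at 1 by lra; apply sqrt_le_1_alt; pose proof PI2_3_2; lra. }
assert (sx1 : 1 <= sqrt x) by (rewrite <- sqrt_1; apply sqrt_le_1_alt; lra).
set (I1 := L / (sqrt (2 * PI) * sqrt x) * (sqrt PI / 2)).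
assert (D3 : Rabs (I0 - I1) <= L * d).
(* The Gaussian is cut off at v^2 = 4xt/26, which is at least 1/(5t) because x t >= 3/(2t). *)
{ assert (S2 : sin (phi1 / 2) ^ 2 = 1 / 26).
  { pose proof cos_phi1 as C; replace phi1 with (2 * (phi1 / 2)) in C by field; rewrite cos_2a_sin in C; simpl; lra. }
  assert (S0 : 0 <= sin (phi1 / 2)) by (apply sin_ge_0; lra).
  assert (sxt : 0 <= sqrt (x * t)) by apply sqrt_pos.
  assert (sxts : sqrt (x * t) * sqrt (x * t) = x * t) by (apply sqrt_sqrt; nra).
  destruct (gauss_int_bounds (2 * sqrt (x * t) * sin (phi1 / 2))) as [G1 G2].
  { apply Rmult_le_pos; lra. }
  fold G in G1, G2.
  replace (2 * sqrt (x * t) * sin (phi1 / 2) * (2 * sqrt (x * t) * sin (phi1 / 2)))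
    with (4 * (sqrt (x * t) * sqrt (x * t)) * sin (phi1 / 2) ^ 2) in G2 by ring.
  rewrite sxts, S2 in G2.
  assert (G3 : exp (- (4 * (x * t) * (1 / 26))) <= d).
  { eapply Rle_trans; [|exact d26]; apply exp_le.
    assert (3 / 2 * / t <= x * t) by (rewrite HL; apply Rmult_le_compat_r; lra); unfold Rdiv; lra. }
  unfold I0, I1; replace (L / (sqrt (2 * PI) * sqrt x) * G - L / (sqrt (2 * PI) * sqrt x) * (sqrt PI / 2))
    with (- (L * ((sqrt PI / 2 - G) * / (sqrt (2 * PI) * sqrt x)))) by (field; lra).
  assert (Q : 0 < / (sqrt (2 * PI) * sqrt x) <= / 2).
  { split; [apply Rinv_0_lt_compat; nra|apply Rinv_le_contravar; nra]. }
  rewrite Rabs_Ropp, Rabs_right by (apply Rle_ge, Rmult_le_pos; [lra|apply Rmult_le_pos; lra]).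
  apply Rmult_le_compat_l; [lra|].
  apply Rle_trans with (2 * d * / 2); [apply Rmult_le_compat; lra|lra]. }
(* The complete Gaussian is exactly pi times the claimed main term, since 2xt is lambda(n). *)
assert (EW : PI * spt_approx n = I1).
{ unfold spt_approx, I1; rewrite Hn.
  replace (24 * (x + 1 / 24) - 1) with (24 * x) by field.
  assert (s24 : sqrt (24 * x) = 2 * sqrt (6 * x)).
  { replace (24 * x) with (2 * 2 * (6 * x)) by ring; rewrite sqrt_mult, sqrt_square by lra; reflexivity. }
  assert (EL : PI * sqrt (24 * x) / 6 = 2 * (x * t)).
  { rewrite s24; unfold t; apply Rmult_eq_reg_r with (sqrt (6 * x)); [|lra].
    replace (PI * (2 * sqrt (6 * x)) / 6 * sqrt (6 * x)) with (PI * 2 * (sqrt (6 * x) * sqrt (6 * x)) / 6) by field.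
    rewrite s6s; field; lra. }
  rewrite EL; fold L; rewrite s24.
  rewrite (sqrt_mult 6 x), (sqrt_mult 2 PI) by lra.
  replace 6 with (2 * 3) by ring; rewrite (sqrt_mult 2 3) by lra.
  assert (0 < sqrt 2) by (apply sqrt_lt_R0; lra); assert (0 < sqrt 3) by (apply sqrt_lt_R0; lra).
  assert (0 < sqrt PI) by (apply sqrt_lt_R0; lra).
  field; repeat split; lra. }
assert (i2 : / t ^ 2 = (/ t) ^ 2) by (field; lra).
assert (D : PI * Rabs (INR (a n) - spt_approx n) <= L * d * (K3 * (/ t) ^ 2)).
{ assert (T1 : PI * Rabs (INR (a n) - spt_approx n) = Rabs ((I - I0) + J + (I0 - I1))).
  { rewrite <- (Rabs_right PI) at 1 by lra; rewrite <- Rabs_mult; f_equal.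
    rewrite Rmult_minus_distr_l, EW, <- EIJ; ring. }
  rewrite T1.
  eapply Rle_trans; [apply Rabs_triang|]; eapply Rle_trans; [apply Rplus_le_compat_r, Rabs_triang|].
  assert (D1' : Rabs (I - I0) <= L * d * (2 * (1 + K1))).
  { eapply Rle_trans; [exact D1|].
    replace (L * exp (- (2 / 5) / t) + K1 * exp (- (2 / 5) / t) * L) with (L * exp (- (2 / 5) / t) * (1 + K1)) by ring.
    apply Rle_trans with (2 * (L * d * (1 + K1))); [|right; ring].
    apply Rmult_le_compat; [lra| |lra|].
    - pose proof (exp_pos (- (2 / 5) / t)); repeat apply Rmult_le_pos; lra.
    - apply Rmult_le_compat_r; [lra|apply Rmult_le_compat_l; lra]. }
  assert (D2' : Rabs J <= L * d * (4 * (1 + 9 * (/ t) ^ 2 * exp 2))).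
  { eapply Rle_trans; [exact D2|]; unfold Rdiv at 4; rewrite i2.
    apply Rle_trans with (4 * (L * d * (1 + 9 * (/ t) ^ 2 * exp 2))); [|right; ring].
    assert (Z : 0 <= 9 * (/ t) ^ 2 * exp 2) by (apply Rmult_le_pos; [nra|lra]).
    pose proof (exp_pos (- (2 / 5) / t)).
    apply Rmult_le_compat; [lra| |lra|].
    - apply Rplus_le_le_0_compat; repeat apply Rmult_le_pos; try lra; nra.
    - apply Rle_trans with (L * d + 9 * (/ t) ^ 2 * exp 2 * L * d); [|right; ring].
      apply Rplus_le_compat_r, Rmult_le_compat_l; lra. }
  assert (PLd : 0 < L * d) by (apply Rmult_lt_0_compat; lra).
  assert (i3 : 1 <= (/ t) ^ 2) by nra.
  apply Rle_trans with (L * d * (2 * (1 + K1) + 4 * (1 + 9 * (/ t) ^ 2 * exp 2) + 1)); [lra|].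
  apply Rmult_le_compat_l; [lra|]; unfold K3.
  replace (4 * (1 + 9 * (/ t) ^ 2 * exp 2)) with (4 + 36 * exp 2 * (/ t) ^ 2) by ring.
  assert (0 <= 6 + 2 * K1) by lra. assert ((6 + 2 * K1) <= (6 + 2 * K1) * (/ t) ^ 2) by nra.
  assert (1 <= 3 * (/ t) ^ 2) by lra.
  assert (7 + 2 * K1 <= (6 + 2 * K1) * (/ t) ^ 2) by nra.
  lra. }
assert (EI1 : I1 = L / (2 * sqrt 2 * sqrt x)).
{ unfold I1; rewrite (sqrt_mult 2 PI) by lra.
  assert (0 < sqrt 2) by (apply sqrt_lt_R0; lra); assert (0 < sqrt PI) by (apply sqrt_lt_R0; lra).
  field; repeat split; lra. }
assert (xt : sqrt x <= 2 * / t).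
{ apply Rsqr_incr_0_var; [|lra]; rewrite !Rsqr_pow2; replace (sqrt x ^ 2) with x by (rewrite <- sxs at 1; ring).
  replace x with (PI ^ 2 / 6 * (/ t) ^ 2) by (rewrite <- i2, Htx; field; split; [lra|nra]).
  nra. }
assert (s22 : 0 < sqrt 2 <= 3 / 2).
{ split; [apply sqrt_lt_R0; lra|]; rewrite <- (sqrt_square (3 / 2)) by lra; apply sqrt_le_1_alt; lra. }
assert (LI : L <= I1 * (6 * / t)).
{ rewrite EI1; apply Rle_trans with (L / (2 * sqrt 2 * sqrt x) * (2 * sqrt 2 * sqrt x)); [right; field; split; lra|].
  apply Rmult_le_compat_l; [left; apply Rdiv_lt_0_compat; [lra|nra]|]. nra. }
assert (Hd : d * (/ t) ^ 3 <= K2 * exp (- (1 / 400) / t)).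
{ specialize (HP2 (/ t) ltac:(lra)).
  replace (- (1 / 400) / t) with (1 / 1200 * / t + - (1 / 300) / t) by (field; lra).
  rewrite exp_plus; fold d.
  replace (K2 * (exp (1 / 1200 * / t) * d)) with (d * (K2 * exp (1 / 1200 * / t))) by ring.
  apply Rmult_le_compat_l; lra. }
assert (tn : sqrt (INR n) / 3 <= / t).
{ apply Rsqr_incr_0_var; [|lra]; rewrite !Rsqr_pow2.
  replace ((sqrt (INR n) / 3) ^ 2) with (sqrt (INR n) ^ 2 / 9) by field; rewrite pow2_sqrt by lra.
  rewrite <- i2, Htx.
  replace (/ (PI ^ 2 / 6 / x)) with (x / (PI ^ 2 / 6)) by (field; split; lra).
  apply Rmult_le_reg_r with (PI ^ 2 / 6); [lra|].
  unfold Rdiv at 3; rewrite Rmult_assoc, Rinv_l by lra; nra. }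
assert (Hd2 : exp (- (1 / 400) / t) <= exp (- (sqrt (INR n) / 1200))) by (apply exp_le; unfold Rdiv in *; lra).
apply Rmult_le_reg_l with PI; [lra|].
eapply Rle_trans; [exact D|].
replace (PI * (6 * K3 * K2 * exp (- (sqrt (INR n) / 1200)) * spt_approx n))
  with (6 * K3 * K2 * exp (- (sqrt (INR n) / 1200)) * (PI * spt_approx n)) by ring.
rewrite EW.
assert (PK3 : 0 < K3) by (unfold K3; lra).
assert (PI1 : 0 < I1) by (rewrite EI1; apply Rdiv_lt_0_compat; [lra|nra]).
apply Rle_trans with (I1 * (6 * / t) * d * (K3 * (/ t) ^ 2)).
{ apply Rmult_le_compat_r; [apply Rmult_le_pos; [lra|nra]|apply Rmult_le_compat_r; lra]. }
replace (I1 * (6 * / t) * d * (K3 * (/ t) ^ 2)) with (6 * K3 * I1 * (d * (/ t) ^ 3)) by ring.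
replace (6 * K3 * K2 * exp (- (sqrt (INR n) / 1200)) * I1) with (6 * K3 * I1 * (K2 * exp (- (sqrt (INR n) / 1200)))) by ring.
apply Rmult_le_compat_l; [apply Rmult_le_pos; [apply Rmult_le_pos; lra|lra]|].
eapply Rle_trans; [exact Hd|apply Rmult_le_compat_l; lra].
Qed.

(** With y = n^(1/4) and s = alpha + k + 1 every factor is below an exponential: K < e^K, alpha <=
    e^s, n^k <= e^(4ky). The available exponent is y^2/1200, so it suffices that y exceeds a fixed
    multiple of s; hence the fourth power. *)
Lemma spt_threshold (K : R) (n0 : nat) : 0 < K -> exists D : nat, (0 < D)%nat /\ (n0 <= D)%nat /\
  forall al k n : nat, (0 < al)%nat ->
  INR D * (INR al + INR k + 1) ^ 4 <= INR n ->
  K * exp (- (sqrt (INR n) / 1200)) < 1 / (INR al * INR n ^ k).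
Proof.
intro HK.
destruct (nfloor_ex K ltac:(lra)) as [N HN].
(* The product 7272 exceeds 6 times 1200: K and s use one share y^2/7272 each, and 4ky uses four.
   The other summands make d exceed K and [n0]. *)
set (d := (72 * 101 + n0 + S N)%nat).
assert (Hd : 7272 + K <= INR d).
{ unfold d; rewrite !plus_INR, mult_INR, (S_INR N); pose proof (pos_INR n0).
  replace (INR 72) with 72 by (rewrite INR_IZR_INZ; reflexivity).
  replace (INR 101) with 101 by (rewrite INR_IZR_INZ; reflexivity); lra. }
assert (Hn0 : (n0 <= d)%nat) by (unfold d; lia).
assert (Hd1 : (1 <= d)%nat) by (unfold d; lia).
clearbody d.
assert (Hdd : (d <= d * d)%nat) by nia.
assert (Hd4 : (d * d <= d * d * (d * d))%nat) by nia.
exists (d * d * (d * d))%nat; split; [lia|split; [lia|]].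
intros al k n Hal Hn.
assert (Ha : 1 <= INR al) by (change 1 with (INR 1); apply le_INR; lia).
pose proof (pos_INR k) as Hk.
set (s := INR al + INR k + 1) in *.
set (y := sqrt (sqrt (INR n))).
assert (Hy0 : 0 <= y) by apply sqrt_pos.
assert (Hy2 : y * y = sqrt (INR n)) by (apply sqrt_sqrt, sqrt_pos).
assert (Hy4 : y * y * (y * y) = INR n) by (rewrite Hy2; apply sqrt_sqrt, pos_INR).
assert (Hy : INR d * s <= y).
{ apply Rnot_lt_le; intro H.
  assert (0 <= INR d * s) by nra.
  assert (y * y < INR d * s * (INR d * s)) by nra.
  assert (0 <= y * y) by nra.
  assert (y * y * (y * y) < INR d * s * (INR d * s) * (INR d * s * (INR d * s))) by nra.
  rewrite !mult_INR in Hn; rewrite Hy4 in H3.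
  replace (INR d * s * (INR d * s) * (INR d * s * (INR d * s))) with (INR d * INR d * (INR d * INR d) * s ^ 4) in H3 by ring; lra. }
assert (Hs : 2 <= s) by (unfold s; lra).
assert (Y1 : 7272 * s <= y) by nra.
assert (Y2 : K <= y) by nra.
assert (Py : 0 < y) by lra.
assert (E1 : INR al <= exp s) by (pose proof (exp_ineq s); unfold s in *; lra).
assert (E2 : INR n ^ k <= exp (4 * INR k * y)).
{ replace (4 * INR k * y) with (INR k * (4 * y)) by ring; rewrite exp_INR_mult; apply pow_incr; split; [apply pos_INR|].
  rewrite <- Hy4; replace (4 * y) with (INR 4 * y) by (simpl; ring); rewrite exp_INR_mult.
  pose proof (exp_ineq y); replace (y * y * (y * y)) with (y ^ 4) by ring; apply pow_incr; lra. }
assert (E3 : K < exp K) by (pose proof (exp_ineq K); lra).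
assert (E4 : K + s + 4 * INR k * y <= y * y / 1200).
{ assert (INR k <= s) by (unfold s; lra).
  assert (7272 * (s * y) <= y * y) by nra.
  assert (INR k * y <= s * y) by (apply Rmult_le_compat_r; lra).
  assert (s <= s * y) by nra.
  assert (7272 * K <= y * y) by nra.
  replace (4 * INR k * y) with (4 * (INR k * y)) by ring.
  set (u := INR k * y) in *; set (sy := s * y) in *; set (yy := y * y) in *; lra. }
assert (Pn : 0 < INR n) by (rewrite <- Hy4; apply Rmult_lt_0_compat; apply Rmult_lt_0_compat; exact Py).
assert (Pk : 0 < INR n ^ k) by (apply pow_lt, Pn).
rewrite <- Hy2; apply exp_le in E4; rewrite !exp_plus in E4.
rewrite exp_Ropp; set (X := exp (y * y / 1200)) in *; assert (PX : 0 < X) by apply exp_pos.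
assert (Pp : 0 < INR al * INR n ^ k) by (apply Rmult_lt_0_compat; lra).
apply Rmult_lt_reg_r with (X * (INR al * INR n ^ k)); [apply Rmult_lt_0_compat; assumption|].
replace (K * / X * (X * (INR al * INR n ^ k))) with (K * INR al * INR n ^ k) by (field; lra).
replace (1 / (INR al * INR n ^ k) * (X * (INR al * INR n ^ k))) with X by (field; split; lra).
apply Rlt_le_trans with (exp K * INR al * INR n ^ k).
- apply Rmult_lt_compat_r; [exact Pk|apply Rmult_lt_compat_r; lra].
- eapply Rle_trans; [|exact E4].
  pose proof (exp_pos K); pose proof (exp_pos s).
  apply Rmult_le_compat; [apply Rmult_le_pos; lra|lra| |exact E2].
  apply Rmult_le_compat_l; lra.
Qed.

Close Scope R_scope.

From mathcomp Require Import all_boot zify.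

(** * Partitions *)

(** A partition with parts at least j either ends in j or has all parts above j; as lists decrease,
    the smallest part is appended on the right. The recursion is structural in neither j nor n,
    whence the fuel [f]. *)
Fixpoint penum (f j n : nat) : seq (seq nat) :=
  match f with
  | 0 => [::]
  | f'.+1 => if n == 0 then [:: [::]] else
      if j <= n then [seq rcons s j | s <- penum f' j (n - j)] ++ penum f' j.+1 n else [::]
  end.

(** The measure n + (n + 1 - j) decreases in both calls: removing a part lowers n, skipping j lowers
    n + 1 - j. *)
Lemma penum_fuel (f g j n : nat) : 0 < j -> n + (n.+1 - j) < f -> n + (n.+1 - j) < g ->
  penum f j n = penum g j n.
Proof.
elim: f g j n => [|f IH] [|g] j n // j0 Hf Hg /=.
case: eqP => // n0; case: leqP => // jn.
by rewrite (IH g j (n - j)) ?(IH g j.+1 n) //; lia.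
Qed.

Lemma sorted_geq_rcons (s : seq nat) (x : nat) :
  sorted geq (rcons s x) = sorted geq s && all (leq x) s.
Proof.
rewrite -[rcons s x]revK rev_sorted rev_rcons /= (path_sortedE leq_trans) all_rev andbC.
by rewrite rev_sorted.
Qed.

Lemma is_partition_rcons (n j : nat) (s : seq nat) : 0 < j ->
  is_partition n (rcons s j) = [&& j <= n, is_partition (n - j) s & all (leq j) s].
Proof.
move=> j0; rewrite /is_partition sorted_geq_rcons mem_rcons inE sumn_rcons negb_or.
rewrite (ltn_eqF j0) /=.
case: (sorted geq s) => /=; last by rewrite andbF.
case: (0 \notin s) => /=; last by rewrite !andbF.
case: (all (leq j) s) => /=; last by rewrite !andbF.
rewrite andbT; apply/eqP/andP => [<-|[jn /eqP ->]]; last by rewrite subnK.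
by rewrite leq_addl addnK.
Qed.

Lemma sumn_geq (j : nat) (s : seq nat) : all (leq j) s -> s != [::] -> j <= sumn s.
Proof. by case: s => [|x s] //= /andP [jx _] _; rewrite (leq_trans jx) // leq_addr. Qed.

Lemma mem_penum (f j n : nat) (s : seq nat) : 0 < j -> n + (n.+1 - j) < f ->
  (s \in penum f j n) = is_partition n s && all (leq j) s.
Proof.
elim: f j n s => [|f IH] j n s j0 Hf //=.
case: eqP => [->|n0].
  rewrite inE; case: s => [|x s] //=; rewrite /is_partition inE /=.
  by case: x => [|x] //=; rewrite ?andbF // addSn /= !andbF.
case: leqP => jn; last first.
  rewrite in_nil; apply/esym/negP => /andP [/and3P [_ _ /eqP sn] js].
  have := sumn_geq _ _ js; rewrite sn; case: s sn js => [|x s] sn js; first by case: n0.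
  by move=> /(_ isT); lia.
rewrite mem_cat IH; [|lia|lia].
case: (lastP s) => [|t x].
  rewrite /is_partition /= (ltn_eqF (_ : 0 < n)) ?orbF; last by lia.
  by apply/negbTE/mapP => -[t _]; case: t.
rewrite all_rcons.
have -> : (rcons t x \in [seq rcons s0 j | s0 <- penum f j (n - j)]) = (x == j) && (t \in penum f j (n - j)).
  apply/mapP/andP => [[u Hu /rcons_inj [-> ->]]|[/eqP -> Ht]]; first by rewrite eqxx.
  by exists t.
rewrite IH; [|lia|lia].
case: eqP => [->|/eqP xj] /=.
  by rewrite ltnn andbF orbF is_partition_rcons // jn all_rcons leqnn /= -andbA andbb.
rewrite all_rcons; case: (boolP (j < x)) => jx /=; last first.
  have -> : (j <= x) = false by lia.
  by rewrite !andbF.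
rewrite is_partition_rcons; last by lia.
rewrite (ltnW jx) /=.
case: (boolP (all (leq x) t)) => Ht; last by rewrite !andbF.
have -> : all (leq j.+1) t by apply: sub_all Ht => y; lia.
by have -> : all (leq j) t by apply: sub_all Ht => y; lia.
Qed.

Lemma penum_uniq (f j n : nat) : 0 < j -> n + (n.+1 - j) < f -> uniq (penum f j n).
Proof.
elim: f j n => [|f IH] j n j0 Hf //=.
case: eqP => // n0; case: leqP => // jn.
rewrite cat_uniq map_inj_uniq; last by move=> x y /rcons_inj [].
rewrite !IH ?andbT /=; try lia.
apply/hasPn => s; rewrite mem_penum; [|lia|lia] => /andP [_ sj].
apply/mapP => -[t _ E]; move: sj; rewrite E all_rcons.
by case/andP; rewrite ltnn.
Qed.

Definition fuel (j n : nat) : nat := (n + (n.+1 - j)).+1.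
Definition part_count (j n : nat) : nat := size (penum (fuel j n) j n).
Definition part_mult (j n : nat) : nat := \sum_(s <- penum (fuel j n) j n) count_mem j s.

Lemma penum_split (j n : nat) : 0 < j -> j <= n ->
  penum (fuel j n) j n =
  [seq rcons s j | s <- penum (fuel j (n - j)) j (n - j)] ++ penum (fuel j.+1 n) j.+1 n.
Proof.
move=> j0 jn.
have E1 : penum (n + (n.+1 - j)) j (n - j) = penum (fuel j (n - j)) j (n - j).
  by apply: penum_fuel => //; lia.
have E2 : penum (n + (n.+1 - j)) j.+1 n = penum (fuel j.+1 n) j.+1 n.
  by apply: penum_fuel => //; lia.
rewrite {1}/fuel -E1 -E2 /= jn.
by have -> : (n == 0) = false by lia.
Qed.

Lemma count_mem_penum_S (j n : nat) : \sum_(s <- penum (fuel j.+1 n) j.+1 n) count_mem j s = 0.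
Proof.
rewrite big_seq big1 // => s; rewrite mem_penum // => /andP [_ /allP sj].
by apply/count_memPn/negP => /sj; rewrite ltnn.
Qed.

Lemma sum_mult_rcons (j n : nat) : 0 < j -> j <= n ->
  \sum_(s <- [seq rcons s j | s <- penum (fuel j (n - j)) j (n - j)]) count_mem j s =
  part_count j (n - j) + part_mult j (n - j).
Proof.
move=> j0 jn; rewrite big_map /part_count /part_mult -sum1_size -big_split /=.
by apply: eq_bigr => s _; rewrite -cats1 count_cat /= eqxx addn0 addnC.
Qed.

(** Partitions are classed by smallest part: those ending in j contribute their multiplicity of j,
    the others form the same sum at j + 1. For n > 0 nothing is left at j = n + 1. *)
Lemma sum_last_penum (k j n : nat) : 0 < j -> k + j = n.+1 -> 0 < n ->
  \sum_(s <- penum (fuel j n) j n) count_mem (last 0 s) s = nsum (fun i => part_mult (j + i) n) k.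
Proof.
have nsumS f m : nsum f m.+1 = f 0 + nsum (fun i => f i.+1) m.
  elim: m => [|m IH]; first by rewrite /= addn0.
  by rewrite -[LHS]/(nsum f m.+1 + f m.+1) IH /= addnA.
elim: k j => [|k IH] j j0 kj n0.
  rewrite /fuel /=; have -> : (n == 0) = false by lia.
  have -> : (j <= n) = false by lia.
  by rewrite big_nil.
have jn : j <= n by lia.
rewrite nsumS penum_split // big_cat /= IH //; last by lia.
congr (_ + _).
  rewrite addn0 [in RHS]/part_mult penum_split // big_cat /= count_mem_penum_S addn0.
  by rewrite !big_map; apply: eq_bigr => s _; rewrite last_rcons.
elim: k {IH kj} => //= k ->; by rewrite addSnnS.
Qed.

(** Both sides list the same partitions without repetition: a partition of n has at most n parts,
    each at most n, so it fits into a bounded sequence over ordinals. *)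
Lemma spt_penum (n : nat) :
  spt n = \sum_(s <- penum (fuel 1 n) 1 n) count_mem (last 0 s) s.
Proof.
rewrite /spt.
transitivity (\sum_(s <- [seq map val (bseqval t) | t : n.-bseq 'I_n.+1 <-
    [seq t : n.-bseq 'I_n.+1 <- index_enum _ | is_partition n (map val (bseqval t))]])
  count_mem (last 0 s) s); first by rewrite big_map big_filter.
apply: perm_big; apply: uniq_perm.
- rewrite map_inj_uniq ?filter_uniq ?index_enum_uniq // => s t E.
  by apply/val_inj/(inj_map val_inj).
- by apply: penum_uniq; rewrite // /fuel.
- move=> s; rewrite mem_penum; [|by []|by rewrite /fuel].
  apply/mapP/idP => [[t]|/andP [Hs _]].
    rewrite mem_filter => /andP [Ht _] ->; rewrite Ht /=.
    move: Ht => /and3P [_ /negP t0 _]; apply/allP => x Hx.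
    by case: x Hx => // Hx; case: t0.
  have /and3P [_ s0 /eqP sn] := Hs.
  have pos : all (leq 1) s by apply/allP => -[|x] Hx //; rewrite Hx in s0.
  have le_n : all (fun x => x <= n) s.
    rewrite -sn; apply/allP => x; elim: (s) => //= y t IH.
    by rewrite inE => /orP [/eqP ->|/IH]; lia.
  have sz : size [seq inord x : 'I_n.+1 | x <- s] <= n.
    rewrite size_map -sn; elim: (s) pos => //= y t IH /andP [y1 /IH]; lia.
  have E : map val (Bseq sz) = s.
    rewrite /= -map_comp -[RHS]map_id; apply/eq_in_map => x /(allP le_n) Hx /=.
    by rewrite inordK.
  exists (Bseq sz); last by rewrite E.
  by rewrite mem_filter mem_index_enum E Hs.
Qed.

(** The only bridge between combinatorics and analysis: the analytic part knows partitions through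
    these recurrences alone. *)
Lemma spt_is_system : spt_system part_count part_mult spt.
Proof.
split.
- by [].
- move=> j [|n] /= [H1 H2]; first by lia.
  rewrite /part_count /fuel /=; have -> : (j <= n.+1) = false by lia.
  by [].
- move=> j n [H1 H2]; rewrite /part_count penum_split; [|lia|lia].
  by rewrite size_cat size_map.
- move=> j [|n] H; first by rewrite /part_mult /= big_seq1.
  rewrite /part_mult /fuel /=; have -> : (j <= n.+1) = false by lia.
  by rewrite big_nil.
- move=> j n [H1 H2]; rewrite /part_mult penum_split; [|lia|lia].
  rewrite big_cat /= count_mem_penum_S sum_mult_rcons; [|lia|lia].
  by rewrite addn0.
- move=> n; rewrite spt_penum; case: n => [|n]; first by rewrite /= big_seq1.
  by rewrite (@sum_last_penum n.+1 1 n.+1) // addn1.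
Qed.

(** * Computability of the threshold *)

Definition computes (n : nat) (F : n.-tuple nat -> nat) : Prop :=
  exists c : murec n, forall v, eval c v (F v).

Lemma computes_proj (n : nat) (i : 'I_n) : computes n (fun v => tnth v i).
Proof. by exists (MProj i). Qed.

Lemma computes_succ (n : nat) (F : n.-tuple nat -> nat) : computes n F -> computes n (fun v => (F v).+1).
Proof.
move=> [c Hc]; exists (MComp MSucc (fun _ : 'I_1 => c)) => v /=.
by exists [tuple F v] => // i; rewrite (ord1 i).
Qed.

Lemma computes_const (n d : nat) : computes n (fun=> d).
Proof.
elim: d => [|d IH]; first by exists (MZero n).
exact: computes_succ.
Qed.

Lemma computes_op2 (n : nat) (op : nat -> nat -> nat) (F G : n.-tuple nat -> nat) :
  computes 2 (fun v => op (tnth v ord0) (tnth v ord_max)) ->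
  computes n F -> computes n G -> computes n (fun v => op (F v) (G v)).
Proof.
move=> [c Hc] [f Hf] [g Hg].
exists (MComp c (fun i : 'I_2 => if i == ord0 then f else g)) => v /=.
exists [tuple F v; G v]; last exact: (Hc [tuple F v; G v]).
by case=> [[|[|i]] Hi].
Qed.

Lemma computes_add2 : computes 2 (fun v => tnth v ord0 + tnth v ord_max).
Proof.
(* Recursion on the first argument: the step function sees (i, h i, v), and projection 1 picks the
   previous value. *)
exists (MPrim (MProj (ord0 : 'I_1)) (MComp MSucc (fun _ : 'I_1 => MProj (@Ordinal 3 1 isT)))) => v /=.
exists (fun i => i + tnth v ord_max); split=> //.
- rewrite add0n; case: v => [[|a [|b [|]]]] //= Hv.
- move=> i _; exists [tuple i + tnth v ord_max]; last by [].
  by move=> k; rewrite (ord1 k) /= (tnth_nth 0).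
Qed.

Lemma computes_mul2 : computes 2 (fun v => tnth v ord0 * tnth v ord_max).
Proof.
have [f Hf] := computes_op2 3 addn _ _ computes_add2
  (computes_proj 3 (@Ordinal 3 1 isT)) (computes_proj 3 (@Ordinal 3 2 isT)).
(* Here [f] adds the second argument, projection 2, to the previous value, projection 1. *)
exists (MPrim (MZero 1) f) => v /=.
exists (fun i => i * tnth v ord_max); split=> //.
move=> i _; have := Hf [tuple of i :: i * tnth v ord_max :: behead v].
rewrite !(tnth_nth 0) /= mulSn addnC.
by case: v => [[|a [|b [|]]]].
Qed.

(** [D] is one fixed number, so computability concerns only the dependence on the two arguments; the
    fourth power is spelled out as products. *)
Lemma computable2_poly (D : nat) :
  computable2 (fun a b => D * ((a + b).+1 * (a + b).+1 * ((a + b).+1 * (a + b).+1))).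
Proof.
have add n F G := computes_op2 n addn F G computes_add2.
have mul n F G := computes_op2 n muln F G computes_mul2.
have s : computes 2 (fun v => (tnth v ord0 + tnth v ord_max).+1).
  by apply: computes_succ; apply: add; apply: computes_proj.
have [c Hc] := mul _ _ _ (computes_const 2 D) (mul _ _ _ (mul _ _ _ s s) (mul _ _ _ s s)).
by exists c => a b; apply: (Hc [tuple a; b]).
Qed.

Local Open Scope R_scope.

Theorem theorem4p3 :
  exists B : nat -> nat -> nat,
    computable2 B /\
    forall alpha k : nat, (0 < alpha)%N -> (0 < k)%N ->
      (0 < B alpha k)%N /\
      forall n : nat, (B alpha k <= n)%N ->
        sqrt 3 / (PI * sqrt (24 * INR n - 1)) *
            (1 - 1 / (INR alpha * INR n ^ k)) * exp (lambda n)
          < INR (spt n)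
          < sqrt 3 / (PI * sqrt (24 * INR n - 1)) *
              (1 + 1 / (INR alpha * INR n ^ k)) * exp (lambda n).
Proof.
destruct sys_asymptotic as [K [HK [n0 Hspt]]].
specialize (Hspt _ _ _ spt_is_system).
destruct (spt_threshold K n0 HK) as [D [D1 [D2 HD]]].
(* The factor [D] is itself at least [n0], so the asymptotic estimate applies to every n above this
   threshold. *)
exists (fun a b => (D * ((a + b).+1 * (a + b).+1 * ((a + b).+1 * (a + b).+1)))%N).
split; [exact (computable2_poly D)|].
intros al k Hal Hk.
set (m := (al + k).+1).
assert (Hm : (1 <= m)%coq_nat) by (unfold m; lia).
split.
{ rewrite !muln_gt0; apply/andP; split; [apply/ltP; exact D1|reflexivity]. }
intros n Hn.
assert (Hn' : (D * (m * m * (m * m)) <= n)%coq_nat) by (apply/leP; exact Hn).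
assert (Hn2 : INR D * (INR al + INR k + 1) ^ 4 <= INR n).
{ apply Rle_trans with (INR (D * (m * m * (m * m)))%coq_nat); [|apply le_INR, Hn'].
  rewrite !mult_INR /m S_INR -plusE plus_INR; right; ring. }
specialize (HD al k n ltac:(apply/ltP; exact Hal) Hn2).
assert (Hmm : (1 <= m * m * (m * m))%coq_nat) by (clear - Hm; clearbody m; nia).
assert (HDm : (D <= D * (m * m * (m * m)))%coq_nat) by (clear - Hmm; revert Hmm; generalize (m * m * (m * m))%coq_nat; intros u Hu; nia).
assert (Hn3 : (n0 <= n)%coq_nat) by (clear - D2 Hn' HDm; lia).
specialize (Hspt n Hn3).
assert (Hn1 : (1 <= n)%coq_nat) by (clear - D1 Hn' HDm; lia).
apply le_INR in Hn1; change (INR 1) with 1 in Hn1.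
set (W := spt_approx n) in *.
assert (PW : 0 < W).
{ apply Rmult_lt_0_compat; [|apply exp_pos]; apply Rdiv_lt_0_compat; [apply sqrt_lt_R0; lra|].
  apply Rmult_lt_0_compat; [apply PI_RGT_0|apply sqrt_lt_R0; lra]. }
set (e := 1 / (INR al * INR n ^ k)) in *.
replace (sqrt 3 / (PI * sqrt (24 * INR n - 1)) * (1 - e) * exp (lambda n)) with (W * (1 - e)) by (unfold W, spt_approx, lambda; ring).
replace (sqrt 3 / (PI * sqrt (24 * INR n - 1)) * (1 + e) * exp (lambda n)) with (W * (1 + e)) by (unfold W, spt_approx, lambda; ring).
(* The threshold makes K e^(-sqrt(n)/1200) smaller than 1/(alpha n^k), and positivity of W keeps the
   inequality strict. *)
assert (H : Rabs (INR (spt n) - W) < e * W).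
{ eapply Rle_lt_trans; [exact Hspt|]; apply Rmult_lt_compat_r; assumption. }
apply Rabs_def2 in H; lra.
Qed.
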